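(* Let $\Sigma^m$ be an $m$-dimensional pmc submanifold of $M^n(c)\times\mathbb{R}$, with mean curvature vector field $H$, shape operator $A$, and second fundamental form $\sigma$. Then $$ \begin{array}{lcl} \frac{1}{2}\Delta|\sigma|^2&=&|\nabla^{\perp}\sigma|^2+c\Big\{(m-|T|^2)|\sigma|^2-2m\sum_{\alpha=m+1}^{n+1}|A_{\alpha} T|^2\\ &&+3m\langle \sigma(T,T),H\rangle+m|A_N|^2-m^2\langle H,N\rangle^2-m^2|H|^2\Big\}\\ &&+\sum_{\alpha,\beta=m+1}^{n+1}\Big\{(\operatorname{trace} A_{\beta})(\operatorname{trace}(A_{\alpha}^2A_{\beta}))+\operatorname{trace}[A_{\alpha},A_{\beta}]^2-(\operatorname{trace}(A_{\alpha}A_{\beta}))^2\Big\}, \end{array} $$ where $\{E_{\alpha}\}_{\alpha=m+1}^{n+1}$ is any local orthonormal frame field in the normal bundle of $\Sigma^m$ and $A_\alpha=A_{E_\alpha}$.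
   Context: $M^n(c)$ denotes the simply connected $n$-dimensional complete Riemannian manifold of constant sectional curvature $c\in\mathbb{R}$, and $M^n(c)\times\mathbb{R}$ carries the product metric. $\xi$ is the unit (parallel) vector field on $M^n(c)\times\mathbb{R}$ tangent to the factor $\mathbb{R}$. Along an immersed submanifold $\Sigma^m$, write $\xi=T+N$ with $T$ tangent and $N$ normal to $\Sigma^m$. The second fundamental form $\sigma$ is defined by $\bar\nabla_XY=\nabla_XY+\sigma(X,Y)$ for tangent $X,Y$, and the shape operator $A$ and normal connection $\nabla^\perp$ by $\bar\nabla_XV=-A_VX+\nabla^\perp_XV$ for tangent $X$ and normal $V$, where $\bar\nabla$, $\nabla$ are the Levi-Civita connections of the ambient space and of $\Sigma^m$. The mean curvature vector field is $H=\frac1m\operatorname{trace}\sigma$; $\Sigma^m$ is a pmc submanifold if $\nabla^\perp H=0$. Norms: $|A_V|^2=\operatorname{trace}(A_V^2)$, $|\sigma|^2=\sum_{\alpha}|A_\alpha|^2$, and $|\nabla^\perp\sigma|^2=\sum_{i,j,k}|(\nabla^\perp\sigma)(E_i,E_j,E_k)|^2$ for a local orthonormal tangent frame $\{E_i\}$, where $(\nabla^\perp\sigma)(X,Y,Z)=\nabla^\perp_X\sigma(Y,Z)-\sigma(\nabla_XY,Z)-\sigma(Y,\nabla_XZ)$. $[A_\alpha,A_\beta]=A_\alpha A_\beta-A_\beta A_\alpha$. $\Delta$ is the Laplacian on functions, $\Delta f=\operatorname{trace}\nabla^2 f$. *)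

(* Defs.v *)
From HB Require Import structures.
From mathcomp Require Import all_boot all_order all_algebra.
From mathcomp Require Import all_classical all_reals all_analysis.

Set Implicit Arguments.
Unset Strict Implicit.
Unset Printing Implicit Defensive.

Import Order.TTheory GRing.Theory Num.Theory.
Import numFieldNormedType.Exports.

Local Open Scope classical_set_scope.
Local Open Scope ring_scope.

(** * Calculus on open subsets of R^n, with points as row vectors *)

Definition basis_vec {R : realType} {n : nat} (i : 'I_n) : 'rV[R]_n :=
  delta_mx 0 i.

Definition pd {R : realType} {n : nat} (i : 'I_n) (u : 'rV[R]_n -> R)
    (x : 'rV[R]_n) : R :=
  'D_(basis_vec i) u x.

(* C^oo: every iterated partial derivative exists and is continuous on U. *)
Definition smooth {R : realType} {n : nat} (U : set 'rV[R]_n)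
    (u : 'rV[R]_n -> R) : Prop :=
  forall (s : seq 'I_n) (x : 'rV[R]_n), U x ->
    {for x, continuous (foldr pd u s)} /\
    forall i : 'I_n, derivable (foldr pd u s) x (basis_vec i).

Definition smooth_vec {R : realType} {n k : nat} (U : set 'rV[R]_n)
    (V : 'rV[R]_n -> 'rV[R]_k) : Prop :=
  forall j : 'I_k, smooth U (fun x => V x 0 j).

(* Row i is the partial derivative of f along the i-th coordinate, so that
   v *m jac f x is the image of the row vector v by the differential. *)
Definition jac {R : realType} {n k : nat} (f : 'rV[R]_n -> 'rV[R]_k)
    (x : 'rV[R]_n) : 'M[R]_(n, k) :=
  \matrix_(i, j) pd i (fun y => f y 0 j) x.

(** * Riemannian geometry in a coordinate chart *)

Definition ip {R : realType} {n : nat} (B : 'M[R]_n) (u v : 'rV[R]_n) : R :=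
  (u *m B *m v^T) 0 0.

Definition christoffel {R : realType} {n : nat} (g : 'rV[R]_n -> 'M[R]_n)
    (x : 'rV[R]_n) (i j k : 'I_n) : R :=
  2^-1 * \sum_(l < n) invmx (g x) k l *
    (pd i (fun y => g y j l) x + pd j (fun y => g y i l) x
     - pd l (fun y => g y i j) x).

Definition Gamma {R : realType} {n : nat} (g : 'rV[R]_n -> 'M[R]_n)
    (x u v : 'rV[R]_n) : 'rV[R]_n :=
  \row_k \sum_(i < n) \sum_(j < n) christoffel g x i j k * u 0 i * v 0 j.

(* Levi-Civita connection of g *)
Definition nabla {R : realType} {n : nat} (g : 'rV[R]_n -> 'M[R]_n)
    (X Y : 'rV[R]_n -> 'rV[R]_n) (x : 'rV[R]_n) : 'rV[R]_n :=
  X x *m jac Y x + Gamma g x (X x) (Y x).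

(* R(u,v)w = nabla_u nabla_v w - nabla_v nabla_u w - nabla_[u,v] w, with u, v
   and w extended with constant components, hence [u,v] = 0. *)
Definition curvature {R : realType} {n : nat} (g : 'rV[R]_n -> 'M[R]_n)
    (x u v w : 'rV[R]_n) : 'rV[R]_n :=
  nabla g (cst u) (nabla g (cst v) (cst w)) x
  - nabla g (cst v) (nabla g (cst u) (cst w)) x.

Definition sectional {R : realType} {n : nat} (g : 'rV[R]_n -> 'M[R]_n)
    (x u v : 'rV[R]_n) : R :=
  ip (g x) (curvature g x u v v) u /
  (ip (g x) u u * ip (g x) v v - ip (g x) u v ^+ 2).

Definition laplacian {R : realType} {n : nat} (g : 'rV[R]_n -> 'M[R]_n)
    (u : 'rV[R]_n -> R) (x : 'rV[R]_n) : R :=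
  \sum_(i < n) \sum_(j < n) invmx (g x) i j *
    (pd i (pd j u) x - \sum_(k < n) christoffel g x i j k * pd k u x).

(** * Geometry of an isometric immersion, in charts

    f : R^m -> R^k is the immersion read in charts, g and G are the metrics of
    the source and of the target in these charts.  A tangent vector of the
    submanifold is given by its m components in the chart of the source; an
    ambient vector along the submanifold (in particular a normal vector) by
    its k components in the chart of the target. *)

Section Immersion.
Context {R : realType} {m k : nat}.
Variables (g : 'rV[R]_m -> 'M[R]_m) (G : 'rV[R]_k -> 'M[R]_k).
Variable f : 'rV[R]_m -> 'rV[R]_k.

Definition push (X : 'rV[R]_m -> 'rV[R]_m) (x : 'rV[R]_m) : 'rV[R]_k :=
  X x *m jac f x.

(* Levi-Civita connection of the ambient space, along f *)
Definition nablabar (X : 'rV[R]_m -> 'rV[R]_m) (V : 'rV[R]_m -> 'rV[R]_k)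
    (x : 'rV[R]_m) : 'rV[R]_k :=
  X x *m jac V x + Gamma G (f x) (push X x) (V x).

(* tangent part: the X with g(X, Y) = G(w, df(Y)) for every Y *)
Definition tanp (w : 'rV[R]_k) (x : 'rV[R]_m) : 'rV[R]_m :=
  w *m G (f x) *m (jac f x)^T *m invmx (g x).

Definition norp (w : 'rV[R]_k) (x : 'rV[R]_m) : 'rV[R]_k :=
  w - tanp w x *m jac f x.

Definition sff (X Y : 'rV[R]_m -> 'rV[R]_m) (x : 'rV[R]_m) : 'rV[R]_k :=
  nablabar X (push Y) x - push (nabla g X Y) x.

Definition shape_op (V : 'rV[R]_m -> 'rV[R]_k) (X : 'rV[R]_m -> 'rV[R]_m)
    (x : 'rV[R]_m) : 'rV[R]_m :=
  - tanp (nablabar X V x) x.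

(* matrix of the endomorphism A_V; column j holds the components of the image
   of the j-th coordinate vector *)
Definition shape_mx (V : 'rV[R]_m -> 'rV[R]_k) (x : 'rV[R]_m) : 'M[R]_m :=
  \matrix_(i, j) shape_op V (cst (basis_vec j)) x 0 i.

Definition nablaN (X : 'rV[R]_m -> 'rV[R]_m) (V : 'rV[R]_m -> 'rV[R]_k)
    (x : 'rV[R]_m) : 'rV[R]_k :=
  norp (nablabar X V x) x.

Definition dsff (X Y Z : 'rV[R]_m -> 'rV[R]_m) (x : 'rV[R]_m) : 'rV[R]_k :=
  nablaN X (sff Y Z) x - sff (nabla g X Y) Z x - sff Y (nabla g X Z) x.

(* the trace of the bilinear map sff is taken with respect to g *)
Definition mean_curv (x : 'rV[R]_m) : 'rV[R]_k :=
  m%:R^-1 *: \sum_(i < m) \sum_(j < m)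
    invmx (g x) i j *: sff (cst (basis_vec i)) (cst (basis_vec j)) x.

Definition tangent_frame (W : set 'rV[R]_m)
    (e : 'I_m -> 'rV[R]_m -> 'rV[R]_m) : Prop :=
  (forall i, smooth_vec W (e i)) /\
  forall x, W x -> forall i j, ip (g x) (e i x) (e j x) = (i == j)%:R.

Definition normal_frame (W : set 'rV[R]_m)
    (nu : 'I_(k - m) -> 'rV[R]_m -> 'rV[R]_k) : Prop :=
  [/\ forall a, smooth_vec W (nu a),
      forall x, W x -> forall a (v : 'rV[R]_m),
        ip (G (f x)) (nu a x) (v *m jac f x) = 0 &
      forall x, W x -> forall a b,
        ip (G (f x)) (nu a x) (nu b x) = (a == b)%:R].

(* |A_V|^2 and |sigma|^2 *)
Definition shape_sq (V : 'rV[R]_m -> 'rV[R]_k) (x : 'rV[R]_m) : R :=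
  \tr (shape_mx V x *m shape_mx V x).

Definition sff_sq (nu : 'I_(k - m) -> 'rV[R]_m -> 'rV[R]_k)
    (x : 'rV[R]_m) : R :=
  \sum_a shape_sq (nu a) x.

Definition dsff_sq (e : 'I_m -> 'rV[R]_m -> 'rV[R]_m) (x : 'rV[R]_m) : R :=
  \sum_i \sum_j \sum_l
    ip (G (f x)) (dsff (e i) (e j) (e l) x) (dsff (e i) (e j) (e l) x).

End Immersion.

(** * Riemannian manifolds *)

Record chart (R : realType) (T : topologicalType) (n : nat) := Chart {
  chart_dom : set T;
  chart_map : T -> 'rV[R]_n;
  chart_inv : 'rV[R]_n -> T
}.

Definition is_chart {R : realType} {T : topologicalType} {n : nat}
    (phi : chart R T n) : Prop :=
  [/\ open (chart_dom phi),
      open (chart_map phi @` chart_dom phi),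
      forall p, chart_dom phi p -> chart_inv phi (chart_map phi p) = p,
      forall p, chart_dom phi p -> {for p, continuous (chart_map phi)} &
      forall p, chart_dom phi p -> {for chart_map phi p, continuous (chart_inv phi)}].

(* An atlas together with a matrix of metric coefficients in each chart; the
   axioms are stated separately, in riemannian_manifold. *)
Record riem (R : realType) (n : nat) := Riem {
  carrier :> topologicalType;
  chart_index : Type;
  atlas : chart_index -> chart R carrier n;
  metric : chart_index -> 'rV[R]_n -> 'M[R]_n
}.

Definition transition {R : realType} {n : nat} (M : riem R n)
    (i j : chart_index M) (x : 'rV[R]_n) : 'rV[R]_n :=
  chart_map (atlas j) (chart_inv (atlas i) x).

Definition riemannian_manifold {R : realType} {n : nat} (M : riem R n) : Prop :=
  [/\ hausdorff_space M /\ @second_countable M,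
      (forall i : chart_index M, is_chart (atlas i)) /\
      (forall p : M, exists i : chart_index M, chart_dom (atlas i) p),
      forall i j : chart_index M,
        smooth_vec (chart_map (atlas i) @` (chart_dom (atlas i) `&` chart_dom (atlas j)))
          (transition i j),
      (forall (i : chart_index M) a b,
        smooth (chart_map (atlas i) @` chart_dom (atlas i)) (fun x => metric i x a b)) /\
      (forall (i : chart_index M) p, chart_dom (atlas i) p ->
        (metric i (chart_map (atlas i) p))^T = metric i (chart_map (atlas i) p) /\
        forall v, v != 0 -> 0 < ip (metric i (chart_map (atlas i) p)) v v) &
      forall (i j : chart_index M) p, chart_dom (atlas i) p -> chart_dom (atlas j) p ->
        metric i (chart_map (atlas i) p) =
        jac (transition i j) (chart_map (atlas i) p) *m
        metric j (chart_map (atlas j) p) *m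
        (jac (transition i j) (chart_map (atlas i) p))^T].

Definition constant_sectional_curvature {R : realType} {n : nat}
    (M : riem R n) (c : R) : Prop :=
  forall (i : chart_index M) p, chart_dom (atlas i) p ->
  forall u v : 'rV[R]_n, \rank (col_mx u v) = 2%N ->
    sectional (metric i) (chart_map (atlas i) p) u v = c.

Definition geodesic {R : realType} {n : nat} (M : riem R n) (gam : R -> M) :
    Prop :=
  continuous gam /\
  forall (i : chart_index M) (t : R), chart_dom (atlas i) (gam t) ->
    let y := fun s : R => chart_map (atlas i) (gam s) in
    let dy := fun s : R => 'D_1 y s in
    [/\ derivable y t 1, derivable dy t 1 &
        'D_1 dy t + Gamma (metric i) (y t) (dy t) (dy t) = 0].

(* Geodesic completeness; for connected manifolds it is equivalent to metric
   completeness (Hopf-Rinow). *)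
Definition complete_manifold {R : realType} {n : nat} (M : riem R n) : Prop :=
  forall (i : chart_index M) (p : M) (v : 'rV[R]_n), chart_dom (atlas i) p ->
  exists gam : R -> M, [/\ geodesic gam, gam 0 = p &
    'D_1 (fun s : R => chart_map (atlas i) (gam s)) 0 = v].

Definition simply_connected (R : realType) (T : topologicalType) : Prop :=
  [/\ exists x : T, True,
      forall x y : T, exists gam : R -> T,
        [/\ {within `[0, 1], continuous gam}, gam 0 = x & gam 1 = y] &
      forall gam : R -> T,
        {within `[0, 1], continuous gam} -> gam 0 = gam 1 ->
        exists h : R * R -> T,
          [/\ {within `[0, 1] `*` `[0, 1], continuous h},
              forall s, `[0, 1]%classic s -> h (s, 0) = gam s,
              forall s, `[0, 1]%classic s -> h (s, 1) = gam 0 &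
              forall t, `[0, 1]%classic t ->
                h (0, t) = gam 0 /\ h (1, t) = gam 0]].

(* M is a model of M^n(c). *)
Definition space_form {R : realType} {n : nat} (M : riem R n) (c : R) : Prop :=
  [/\ riemannian_manifold M, simply_connected R M, complete_manifold M &
      constant_sectional_curvature M c].

(* Riemannian product M x R; the coordinate of R comes last. *)
Definition prod_chart {R : realType} {T : topologicalType} {n : nat}
    (phi : chart R T n) : chart R (T * R)%type (n + 1) :=
  Chart (chart_dom phi `*` setT)
    (fun q => row_mx (chart_map phi q.1) q.2%:M)
    (fun y => (chart_inv phi (lsubmx y), rsubmx y 0 0)).

Definition prod_line {R : realType} {n : nat} (M : riem R n) :
    riem R (n + 1) :=
  @Riem R (n + 1) (M * R)%type (chart_index M)
    (fun i => prod_chart (atlas i))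
    (fun i y => block_mx (metric i (lsubmx y)) 0 0 1%:M).

Definition xi {R : realType} {n : nat} : 'rV[R]_(n + 1) := row_mx 0 1%:M.

(** * Immersed submanifolds *)

Definition local_rep {R : realType} {m k : nat} {S : riem R m} {P : riem R k}
    (F : S -> P) (i : chart_index S) (j : chart_index P)
    (x : 'rV[R]_m) : 'rV[R]_k :=
  chart_map (atlas j) (F (chart_inv (atlas i) x)).

Definition local_dom {R : realType} {m k : nat} {S : riem R m} {P : riem R k}
    (F : S -> P) (i : chart_index S) (j : chart_index P) :
    set 'rV[R]_m :=
  chart_map (atlas i) @` (chart_dom (atlas i) `&` F @^-1` chart_dom (atlas j)).

(* The differential of F is injective because the metric of S, which is
   positive definite, is the pullback by F of that of P. *)
Definition isometric_immersion {R : realType} {m k : nat} {S : riem R m}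
    {P : riem R k} (F : S -> P) : Prop :=
  continuous F /\
  forall (i : chart_index S) (j : chart_index P),
    smooth_vec (local_dom F i j) (local_rep F i j) /\
    forall x, local_dom F i j x ->
      metric i x = jac (local_rep F i j) x *m metric j (local_rep F i j x)
                     *m (jac (local_rep F i j) x)^T.

Definition parallel_mean_curvature {R : realType} {m k : nat} {S : riem R m}
    {P : riem R k} (F : S -> P) : Prop :=
  forall (i : chart_index S) (j : chart_index P) x, local_dom F i j x ->
  forall X : 'rV[R]_m -> 'rV[R]_m,
    nablaN (metric i) (metric j) (local_rep F i j) X
      (mean_curv (metric i) (metric j) (local_rep F i j)) x = 0.

(* Main.v *)
Require Import Defs.
From HB Require Import structures.
From mathcomp Require Import all_boot all_order all_algebra.
From mathcomp Require Import all_classical all_reals all_analysis.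
From mathcomp Require Import ring lra.
Set Implicit Arguments.
Unset Strict Implicit.
Unset Printing Implicit Defensive.
Import Order.TTheory GRing.Theory Num.Theory.
Import numFieldNormedType.Exports.
Local Open Scope classical_set_scope.
Local Open Scope ring_scope.

(** The norm of the second fundamental form of a submanifold with parallel mean
curvature in M^n(c) x R satisfies an equation of the type found by Simons.

Choose orthonormal fields [e_i] tangent and [nu_a] normal to the submanifold.
The second fundamental form becomes a family of symmetric matrices [h_a], and
|sigma|^2 is the sum of the traces of [h_a *m h_a].  Its Laplacian is twice the
sum of |nabla sigma|^2 and of the pairing of [h] with its rough Laplacian
[h_jk,ii].  To compute the latter, the Codazzi equation replaces [h_jk,ii] by
[h_ik,ji], the Ricci identity exchanges the two derivatives at the cost of
curvature terms, and the Codazzi equation again replaces [h_ki,ij] by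
[h_ii,kj], which is the Hessian of the mean curvature and vanishes.  The
curvature of the ambient space is that of a space form evaluated on the
projections of the vectors to the orthogonal complement of xi.  Hence the Gauss
equation contains the rank one perturbation [1 - t t^T] of the identity, where
[t] holds the components of T; and the Codazzi equation has a defect built
from T and N, whose derivative is known since xi is parallel.  The traces of
all these contributions add up to the stated right hand side.

Apart from the existence of frames, which is given, this argument uses only
the Leibniz rule and the commutation of partial derivatives.  It is therefore
carried out over an arbitrary commutative ring with commuting derivations:
[simons_identity] derives the formula from the structure equations,
[simons_moving_frame] derives the structure equations from the connection
matrix of an adapted frame (Gauss, Codazzi and Ricci being the blocks of the
single equation [curvature_equation]), and [simons_submanifold] expresses the
result by the operators of the statement, which are defined in coordinates.

The ring to which this is applied consists of the smooth functions on an open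
subset of a chart ([smooth_fun]).  Analysis is needed to see that it is a ring
with commuting derivations: smooth functions are stable under products and
composition ([smooth_of_closure]), mixed partial derivatives agree ([pdC]), and
the immersion acts by the chain rule ([partial_pull]).  Evaluation at a point
is a ring morphism compatible with the derivations; it turns the identity in
the ring into the pointwise formula ([formula_lift]).

On the ambient side, constant sectional curvature determines the whole
curvature tensor by polarization ([curvature_tensor_eq0],
[riem_mx_constant]), and the Christoffel symbols of the product metric are
those of M ([Gamma_prod]), so that the ambient connection along the immersion
is a pullback ([amb_curvE]). *)

(** * Derivations of a commutative ring *)

Record derivation (K : comNzRingType) := Derivation {
  der_additive :> {additive K -> K};
  der_mul : forall a b, der_additive (a * b) = der_additive a * b + a * der_additive b
}.

Section Derivation.
Context {K : comNzRingType} (X : derivation K).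

Lemma derM a b : X (a * b) = X a * b + a * X b.
Proof. exact: der_mul. Qed.

Lemma der1 : X 1 = 0.
Proof.
have := derM 1 1; rewrite !mulr1 mul1r => /eqP.
by rewrite addrC -subr_eq subrr => /eqP <-.
Qed.

Lemma der_nat k : X k%:R = 0.
Proof. by rewrite raddfMn /= der1 mul0rn. Qed.

Lemma map_der_mul m n p (A : 'M[K]_(m, n)) (B : 'M[_]_(n, p)) :
  map_mx X (A *m B) = map_mx X A *m B + A *m map_mx X B.
Proof.
apply/matrixP => i j; rewrite !mxE raddf_sum -big_split /=.
by apply: eq_bigr => k _; rewrite !mxE derM.
Qed.

Lemma map_der_scale m n a (A : 'M[K]_(m, n)) :
  map_mx X (a *: A) = X a *: A + a *: map_mx X A.
Proof. by apply/matrixP => i j; rewrite !mxE derM. Qed.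

Lemma map_der_sum I (r : seq I) (P : pred I) m n (F : I -> 'M[K]_(m, n)) :
  map_mx X (\sum_(i <- r | P i) F i) = \sum_(i <- r | P i) map_mx X (F i).
Proof. exact: (raddf_sum (map_mx X)). Qed.

Lemma der_trace n (A : 'M[K]_n) : X (\tr A) = \tr (map_mx X A).
Proof. by rewrite raddf_sum; apply: eq_bigr => i _; rewrite mxE. Qed.

Lemma map_der1 n : map_mx X 1%:M = 0 :> 'M[K]_n.
Proof. by apply/matrixP => i j; rewrite !mxE der_nat. Qed.

End Derivation.

Lemma mxDE (V : nmodType) m n (A B : 'M[V]_(m, n)) i j : (A + B) i j = A i j + B i j.
Proof. by rewrite mxE. Qed.
Lemma mxNE (V : zmodType) m n (A : 'M[V]_(m, n)) i j : (- A) i j = - A i j.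
Proof. by rewrite mxE. Qed.

Lemma mxZE (V : pzRingType) m n c (A : 'M[V]_(m, n)) i j : (c *: A) i j = c * A i j.
Proof. by rewrite mxE. Qed.

(** * The identity of Simons from the structure equations *)

(** The derivations [X i] stand for the fields of an orthonormal tangent frame,
[w i j l] for the component of nabla_{X i} e_j along e_l and [th i a b] for that
of the normal derivative of nu_a along nu_b.  A bilinear map with values in the
normal bundle is given by its matrices [T a] in the frame. *)
Section Simons.
Context {K : comNzRingType} {m p : nat}.
Variable X : 'I_m -> derivation K.
Variables (w : 'I_m -> 'M[K]_m) (th : 'I_m -> 'M[K]_p).

Definition nact (M : 'M[K]_p) (T : 'I_p -> 'M[K]_m) (a : 'I_p) : 'M[K]_m :=
  \sum_b M a b *: T b.

(** The term + T *m w i is - T *m (w i)^T for the skew matrix [w i]. *)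
Definition cov (i : 'I_m) (T : 'I_p -> 'M[K]_m) (a : 'I_p) : 'M[K]_m :=
  map_mx (X i) (T a) - w i *m T a + T a *m w i - nact (th i) T a.

Lemma nact_mull M (A : 'M[_]_m) T a : A *m nact M T a = nact M (fun b => A *m T b) a.
Proof. by rewrite mulmx_sumr; apply: eq_bigr => b _; rewrite scalemxAr. Qed.

Lemma nact_mulr M (A : 'M[_]_m) T a : nact M T a *m A = nact M (fun b => T b *m A) a.
Proof. by rewrite mulmx_suml; apply: eq_bigr => b _; rewrite scalemxAl. Qed.

Lemma nactD M T U a : nact M (fun b => T b + U b) a = nact M T a + nact M U a.
Proof. by rewrite -big_split /=; apply: eq_bigr => b _; rewrite scalerDr. Qed.

Lemma nactN M T a : nact M (fun b => - T b) a = - nact M T a.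
Proof. by rewrite -sumrN; apply: eq_bigr => b _; rewrite scalerN. Qed.

Lemma nactM M N T a : nact M (nact N T) a = nact (M *m N) T a.
Proof.
rewrite /nact; under eq_bigr do rewrite scaler_sumr.
rewrite exchange_big /=; apply: eq_bigr => b _; rewrite mxE scaler_suml.
by apply: eq_bigr => e _; rewrite scalerA.
Qed.

Lemma nact_der M T a i : map_mx (X i) (nact M T a) =
  nact (map_mx (X i) M) T a + nact M (fun b => map_mx (X i) (T b)) a.
Proof.
rewrite map_der_sum -big_split /=; apply: eq_bigr => b _.
by rewrite map_der_scale mxE.
Qed.

Lemma nactDl M N T a : nact (M + N) T a = nact M T a + nact N T a.
Proof. by rewrite -big_split /=; apply: eq_bigr => b _; rewrite mxE scalerDl. Qed.

Lemma nactNl M T a : nact (- M) T a = - nact M T a.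
Proof. by rewrite -sumrN; apply: eq_bigr => b _; rewrite mxE scaleNr. Qed.

Lemma nact_suml I (r : seq I) (f : I -> K) (M : I -> 'M[_]_p) T a :
  nact (\sum_(l <- r) f l *: M l) T a = \sum_(l <- r) f l *: nact (M l) T a.
Proof.
rewrite /nact; under [RHS]eq_bigr do rewrite scaler_sumr.
rewrite exchange_big /=; apply: eq_bigr => b _.
rewrite summxE scaler_suml; apply: eq_bigr => l _.
by rewrite mxE scalerA.
Qed.

Hypothesis th_skew : forall i, (th i)^T = - th i.

Definition pairing (S T : 'I_p -> 'M[K]_m) : K := \sum_a \tr (S a *m T a).

(** The metric connections preserve the inner product: the terms in [w] cancel
under the trace, those in [th] by skewness. *)
Lemma der_pairing i S T :
  X i (pairing S T) = pairing (cov i S) T + pairing S (cov i T).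
Proof.
have E : \sum_a \tr (nact (th i) S a *m T a) + \sum_a \tr (S a *m nact (th i) T a) = 0.
  have -> : \sum_a \tr (S a *m nact (th i) T a) =
      \sum_a \sum_b th i a b * \tr (S a *m T b).
    apply: eq_bigr => a _; rewrite nact_mull raddf_sum.
    by apply: eq_bigr => b _; rewrite /= mxtraceZ.
  rewrite [X in _ + X]exchange_big -big_split /= big1 // => a _.
  rewrite nact_mulr raddf_sum -big_split /= big1 // => b _.
  have /matrixP/(_ b a) := th_skew i; rewrite !mxE => ->.
  by rewrite mxtraceZ mulNr addNr.
rewrite /pairing raddf_sum /=.
rewrite -[RHS]addr0 -[X in _ = _ + X]E -!big_split; apply: eq_bigr => a _ /=.
rewrite der_trace map_der_mul /cov !(mulmxDl, mulmxDr, mulNmx, mulmxN, raddfD, raddfN) /=.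
by rewrite -[w i *m S a *m T a]mulmxA [\tr (w i *m _)]mxtrace_mulC !mulmxA; ring.
Qed.

(** Components of the bracket of the i-th and j-th fields of the frame. *)
Definition tau i j l : K := w i j l - w j i l.

Hypothesis bracket : forall i j u,
  X i (X j u) - X j (X i u) = \sum_l tau i j l * X l u.

(** The coefficients [v j] act on row vectors, whence the order of the factors
in the quadratic terms.  The value at (a, b) is the component along the b-th
field of the curvature applied to the a-th field. *)
Definition curv q (v : 'I_m -> 'M[K]_q) i j : 'M[K]_q :=
  map_mx (X i) (v j) - map_mx (X j) (v i) + v j *m v i - v i *m v j
  - \sum_l tau i j l *: v l.

Definition cov2 (T : 'I_p -> 'M[K]_m) i j (a : 'I_p) : 'M[K]_m :=
  cov i (cov j T) a - \sum_l w i j l *: cov l T a.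

Lemma eq_nact M T U a : T =1 U -> nact M T a = nact M U a.
Proof. by move=> E; apply: eq_bigr => b _; rewrite E. Qed.

(** The Ricci identity.  The brackets produced by exchanging two derivatives are
absorbed by the correction which makes [cov2] tensorial. *)
Lemma cov2C T i j a :
  cov2 T i j a - cov2 T j i a =
  - (curv w i j *m T a) + T a *m curv w i j - nact (curv th i j) T a.
Proof.
have E : \sum_l tau i j l *: cov l T a =
   \sum_l tau i j l *: map_mx (X l) (T a)
   - (\sum_l tau i j l *: w l) *m T a + T a *m (\sum_l tau i j l *: w l)
   - nact (\sum_l tau i j l *: th l) T a.
  rewrite nact_suml mulmx_suml mulmx_sumr -!sumrN -!big_split /=.
  apply: eq_bigr => l _.
  by rewrite /cov !scalerDr !scalerN -!scalemxAl -!scalemxAr.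
have B : map_mx (X i) (map_mx (X j) (T a)) - map_mx (X j) (map_mx (X i) (T a)) =
   \sum_l tau i j l *: map_mx (X l) (T a).
  apply/matrixP => k l; rewrite !mxE bracket summxE.
  by apply: eq_bigr => q _; rewrite !mxE.
have -> : cov2 T i j a - cov2 T j i a = cov i (cov j T) a - cov j (cov i T) a
    - \sum_l tau i j l *: cov l T a.
  have -> : \sum_l tau i j l *: cov l T a =
     \sum_l w i j l *: cov l T a - \sum_l w j i l *: cov l T a.
    by rewrite -sumrB; apply: eq_bigr => l _; rewrite scalerBl.
  rewrite /cov2; apply/matrixP => k l; rewrite !(mxDE, mxNE); ring.
rewrite {}E -{}B.
have C k l : cov k (cov l T) a =
  map_mx (X k) (map_mx (X l) (T a))
  - (map_mx (X k) (w l) *m T a + w l *m map_mx (X k) (T a))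
  + (map_mx (X k) (T a) *m w l + T a *m map_mx (X k) (w l))
  - (nact (map_mx (X k) (th l)) T a + nact (th l) (fun b => map_mx (X k) (T b)) a)
  - (w k *m map_mx (X l) (T a) - w k *m w l *m T a + w k *m T a *m w l
     - nact (th l) (fun b => w k *m T b) a)
  + (map_mx (X l) (T a) *m w k - w l *m T a *m w k + T a *m (w l *m w k)
     - nact (th l) (fun b => T b *m w k) a)
  - (nact (th k) (fun b => map_mx (X l) (T b)) a
     - nact (th k) (fun b => w l *m T b) a
     + nact (th k) (fun b => T b *m w l) a - nact (th k *m th l) T a).
  rewrite {1}/cov; congr (_ + _ - _).
  - rewrite /cov; congr (_ - _).
    + by rewrite !(map_mxD, map_mxN) !map_der_mul nact_der.
    + by rewrite !(mulmxDr, mulmxN) nact_mull !mulmxA.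
  - by rewrite /cov !(mulmxDl, mulNmx) nact_mulr !mulmxA.
  - rewrite -nactM -!nactN -!nactD; exact: eq_nact.
rewrite !C /curv !(nactDl, nactNl) !(mulmxDl, mulmxDr, mulmxN, mulNmx).
apply/matrixP => k l; rewrite !(mxDE, mxNE) !mulmxA; ring.
Qed.

Hypothesis w_skew : forall i, (w i)^T = - w i.

Lemma skew_entry i j k : w i j k = - w i k j.
Proof. by have /matrixP/(_ k j) := w_skew i; rewrite !mxE. Qed.

Lemma cov_sym T i a : (forall b, (T b)^T = T b) -> (cov i T a)^T = cov i T a.
Proof.
move=> Ts; rewrite /cov !(linearD, linearN) /= !trmx_mul Ts w_skew mulmxN mulNmx opprK.
rewrite map_trmx Ts /nact (raddf_sum trmx) /=.
rewrite (eq_bigr (fun b => th i a b *: T b)) => [|b _]; last by rewrite linearZ /= Ts.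
by congr (_ - _); rewrite addrAC.
Qed.

Lemma cov2_sym T i j a : (forall b, (T b)^T = T b) -> (cov2 T i j a)^T = cov2 T i j a.
Proof.
move=> Ts; rewrite /cov2 linearB /= cov_sym => [|b]; last exact: cov_sym.
congr (_ - _); rewrite (raddf_sum trmx); apply: eq_bigr => l _ /=.
by rewrite linearZ /= cov_sym.
Qed.

Lemma trace_nact M T a : \tr (nact M T a) = \sum_b M a b * \tr (T b).
Proof. by rewrite raddf_sum; apply: eq_bigr => b _; rewrite /= mxtraceZ. Qed.

Lemma trace_cov T i a :
  \tr (cov i T a) = X i (\tr (T a)) - \sum_b th i a b * \tr (T b).
Proof.
by rewrite /cov !(raddfD, raddfN) /= mxtrace_mulC subrK -der_trace trace_nact.
Qed.

Lemma cov_entry T i a j k : cov i T a j k =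
  X i (T a j k) - \sum_q w i j q * T a q k + \sum_q T a j q * w i q k
  - \sum_b th i a b * T b j k.
Proof.
rewrite /cov !(mxDE, mxNE) !mxE summxE; congr (_ - _).
by apply: eq_bigr => b _; rewrite mxE.
Qed.

Lemma cov2_entry T i j a k l : cov2 T i j a k l =
  cov i (cov j T) a k l - \sum_q w i j q * cov q T a k l.
Proof.
rewrite /cov2 mxDE mxNE summxE; congr (_ - _).
by apply: eq_bigr => q _; rewrite mxE.
Qed.

Variables (h : 'I_p -> 'M[K]_m) (t : 'cV[K]_m) (n : 'cV[K]_p) (c : K).

Hypothesis h_sym : forall a, (h a)^T = h a.
Hypothesis c_const : forall i, X i c = 0.
Hypothesis dt : forall i j,
  X i (t j 0) = \sum_l w i j l * t l 0 + \sum_b n b 0 * h b i j.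
Hypothesis dn : forall i a,
  X i (n a 0) = \sum_b th i a b * n b 0 - \sum_l h a i l * t l 0.
Hypothesis codazzi : forall i j k a, cov i h a j k - cov j h a i k =
  c * ((i == k)%:R * t j 0 - (j == k)%:R * t i 0) * n a 0.

Lemma sum_delta_l q (f : 'I_q -> K) i : \sum_j (j == i)%:R * f j = f i.
Proof.
rewrite (bigD1 i) //= eqxx mul1r big1 ?addr0 // => j /negPf ->.
by rewrite mul0r.
Qed.

Lemma sum_delta_r q (f : 'I_q -> K) i : \sum_j f j * (i == j)%:R = f i.
Proof.
rewrite -[RHS]sum_delta_l; apply: eq_bigr => j _.
by rewrite eq_sym mulrC.
Qed.

(** Both sides of the Codazzi equation are tensors, so in its covariant
derivative all connection terms cancel; [dt] and [dn] give the rest. *)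
Lemma der_codazzi l i j k a :
  cov2 h l i a j k - cov2 h l j a i k =
  c * (((i == k)%:R * (\sum_b n b 0 * h b l j)
        - (j == k)%:R * (\sum_b n b 0 * h b l i)) * n a 0
     - ((i == k)%:R * t j 0 - (j == k)%:R * t i 0) * (\sum_q h a l q * t q 0)).
Proof.
pose C i j k a := cov i h a j k - cov j h a i k.
have E : cov2 h l i a j k - cov2 h l j a i k =
   X l (C i j k a) - \sum_q w l j q * C i q k a - \sum_q w l i q * C q j k a
   + \sum_q C i j q a * w l q k - \sum_b th l a b * C i j k b.
  have XB u v : X l (u - v) = X l u - X l v by rewrite raddfB.
  rewrite (cov2_entry h l i) (cov2_entry h l j) /C XB.
  rewrite (cov_entry (cov i h) l a j k) (cov_entry (cov j h) l a i k).
  have sB q (f g1 g2 : 'I_q -> K) :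
      \sum_r f r * (g1 r - g2 r) = \sum_r f r * g1 r - \sum_r f r * g2 r.
    by rewrite -sumrB; apply: eq_bigr => r _; rewrite mulrBr.
  have sB' q (f g1 g2 : 'I_q -> K) :
      \sum_r (g1 r - g2 r) * f r = \sum_r g1 r * f r - \sum_r g2 r * f r.
    by rewrite -sumrB; apply: eq_bigr => r _; rewrite mulrBl.
  rewrite !sB sB'; ring.
have D1 : X l (C i j k a) = c * (((i == k)%:R * X l (t j 0)
     - (j == k)%:R * X l (t i 0)) * n a 0
     + ((i == k)%:R * t j 0 - (j == k)%:R * t i 0) * X l (n a 0)).
  rewrite /C codazzi !derM c_const raddfB /= !derM !der_nat; ring.
have S1 : \sum_q w l j q * C i q k a =
    c * n a 0 * ((i == k)%:R * (\sum_q w l j q * t q 0) - w l j k * t i 0).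
  rewrite -(sum_delta_l (w l j) k) mulrBr mulr_suml !mulr_sumr -sumrB.
  by apply: eq_bigr => q _; rewrite /C codazzi; ring.
have S2 : \sum_q w l i q * C q j k a =
    c * n a 0 * (w l i k * t j 0 - (j == k)%:R * (\sum_q w l i q * t q 0)).
  rewrite -(sum_delta_l (w l i) k) mulrBr mulr_suml !mulr_sumr -sumrB.
  by apply: eq_bigr => q _; rewrite /C codazzi; ring.
have S3 : \sum_q C i j q a * w l q k =
    c * n a 0 * (w l i k * t j 0 - w l j k * t i 0).
  rewrite -(sum_delta_l (fun q => w l q k) i) -(sum_delta_l (fun q => w l q k) j).
  rewrite mulrBr !mulr_suml !mulr_sumr -sumrB; apply: eq_bigr => q _.
  by rewrite /C codazzi [q == i]eq_sym [q == j]eq_sym; ring.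
have S4 : \sum_b th l a b * C i j k b =
    c * ((i == k)%:R * t j 0 - (j == k)%:R * t i 0) * (\sum_b th l a b * n b 0).
  by rewrite mulr_sumr; apply: eq_bigr => b _; rewrite /C codazzi; ring.
rewrite E D1 S1 S2 S3 S4 !dt dn; ring.
Qed.

(** The algebraic curvature tensor generated by the symmetric form B; for the
identity it is the curvature of the unit sphere, and for the second fundamental
form it is the quadratic part of the Gauss equation. *)
Definition rot (B : 'M[K]_m) i j : 'M[K]_m :=
  \matrix_(k, l) (B j k * B i l - B i k * B j l).

(** Effect of [rot B], acting as curvature on the symmetric form T, after one
contraction. *)
Definition simons (B T : 'M[K]_m) : 'M[K]_m :=
  \tr B *: (B *m T) - B *m B *m T + B *m T *m B - \tr (B *m T) *: B.

Lemma rot_contract (B T : 'M[K]_m) j k : B^T = B -> T^T = T ->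
  \sum_i (- (rot B i j *m T) + T *m rot B i j) i k = simons B T j k.
Proof.
move=> Bs Ts.
have Be x y : B x y = B y x by rewrite -[in LHS]Bs mxE.
have Te x y : T x y = T y x by rewrite -[in LHS]Ts mxE.
have E1 i : (rot B i j *m T) i k = B j i * (B *m T) i k - B i i * (B *m T) j k.
  rewrite [LHS]mxE [(B *m T) i k]mxE [(B *m T) j k]mxE !mulr_sumr -sumrB.
  by apply: eq_bigr => q _; rewrite mxE; ring.
have E2 i : (T *m rot B i j) i k = (B *m T) j i * B i k - (B *m T) i i * B j k.
  rewrite [LHS]mxE [(B *m T) j i]mxE [(B *m T) i i]mxE !mulr_suml -sumrB.
  by apply: eq_bigr => q _; rewrite mxE (Te i q); ring.
under eq_bigr do rewrite mxDE mxNE E1 E2.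
rewrite /simons !(mxDE, mxNE, mxZE) -mulmxA.
rewrite [(B *m (B *m T)) j k]mxE [(B *m T *m B) j k]mxE /mxtrace.
rewrite !mulr_suml -!sumrN -!big_split /=; apply: eq_bigr => i _.
ring.
Qed.

(** The hypothesis holds for P = t t^T: compression to a line is multiplication
by a scalar.  All words in P and H then reduce to the traces shown. *)
Lemma trace_simons_rank1 (P H : 'M[K]_m) :
  (forall A, P *m A *m P = \tr (P *m A) *: P) ->
  \tr (simons (1%:M - P) H *m H) = (m%:R - \tr P) * \tr (H *m H)
    - m%:R * \tr (P *m H *m H) - \tr H ^+ 2 + 2 * (\tr (P *m H) * \tr H).
Proof.
move=> rank1; pose u := 1%:M - P; rewrite -/u.
have trZ a (A : 'M[K]_m) : \tr (a *: A) = a * \tr A by exact: mxtraceZ.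
have trD (A A' : 'M[K]_m) : \tr (A + A') = \tr A + \tr A' by exact: mxtraceD.
have trN (A : 'M[K]_m) : \tr (- A) = - \tr A by rewrite raddfN.
have PP : P *m P = \tr P *: P by have := rank1 1%:M; rewrite !mulmx1.
have tru : \tr u = m%:R - \tr P by rewrite /u trD trN mxtrace1.
have uH : u *m H = H - P *m H by rewrite /u mulmxBl mul1mx.
have truH : \tr (u *m H) = \tr H - \tr (P *m H) by rewrite uH trD trN.
have truHH : \tr (u *m H *m H) = \tr (H *m H) - \tr (P *m H *m H).
  by rewrite uH mulmxBl trD trN.
have truuHH : \tr (u *m u *m H *m H) =
    \tr (H *m H) + (\tr P - 2) * \tr (P *m H *m H).
  rewrite -[u *m u *m H]mulmxA uH /u !(mulmxBl, mulmxBr, mul1mx) !mulmxA PP.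
  by rewrite -!scalemxAl !(trD, trN, trZ); ring.
have PHPH : \tr (P *m H *m P *m H) = \tr (P *m H) ^+ 2.
  by rewrite rank1 -scalemxAl trZ expr2.
have HPH : \tr (H *m P *m H) = \tr (P *m H *m H).
  by rewrite -mulmxA mxtrace_mulC.
have truHuH : \tr (u *m H *m u *m H) =
    \tr (H *m H) - 2 * \tr (P *m H *m H) + \tr (P *m H) ^+ 2.
  rewrite -mulmxA uH !(mulmxBl, mulmxBr) !mulmxA !(trD, trN) HPH PHPH; ring.
clearbody u; rewrite /simons !(mulmxDl, mulNmx) -!scalemxAl !(trD, trN, trZ).
rewrite tru truHH truuHH truHuH truH; ring.
Qed.

(** The left hand side collects the contributions of the Gauss and Ricci
equations to the pair (H, B); the words H B B H combine into a commutator. *)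
Lemma trace_simons_commutator (B H : 'M[K]_m) :
  \tr (simons B H *m H) - \tr ((H *m B *m B - B *m H *m B) *m H) =
  \tr B * \tr (H *m H *m B) + \tr ((H *m B - B *m H) *m (H *m B - B *m H))
  - \tr (H *m B) ^+ 2.
Proof.
have trZ a (A : 'M[K]_m) : \tr (a *: A) = a * \tr A by exact: mxtraceZ.
have trD (A A' : 'M[K]_m) : \tr (A + A') = \tr A + \tr A' by exact: mxtraceD.
have trN (A : 'M[K]_m) : \tr (- A) = - \tr A by rewrite raddfN.
have W1 : \tr (B *m H *m H) = \tr (H *m H *m B) by rewrite -mulmxA mxtrace_mulC.
have W2 : \tr (B *m B *m H *m H) = \tr (H *m B *m B *m H).
  by rewrite mxtrace_mulC !mulmxA.
have W3 : \tr (B *m H *m H *m B) = \tr (H *m B *m B *m H).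
  by rewrite mxtrace_mulC !mulmxA W2.
have W4 : \tr (B *m H *m B *m H) = \tr (H *m B *m H *m B).
  by rewrite mxtrace_mulC !mulmxA.
have W5 : \tr (B *m H) = \tr (H *m B) by exact: mxtrace_mulC.
rewrite /simons !(mulmxDl, mulmxDr, mulNmx, mulmxN) -!scalemxAl !(trD, trN, trZ).
rewrite !mulmxA W1 W2 W3 W4 W5; ring.
Qed.

Let u : 'M[K]_m := 1%:M - t *m t^T.

Hypothesis gauss : forall i j, curv w i j = c *: rot u i j + \sum_b rot (h b) i j.
Hypothesis ricci : forall i j,
  curv th i j = \matrix_(a, b) ((h a *m h b) j i - (h a *m h b) i j).
Hypothesis pmc : forall i a, X i (\tr (h a)) = \sum_b th i a b * \tr (h b).

Let nu : 'M[K]_m := \sum_b n b 0 *: h b.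

(** Parallel mean curvature enters through this vanishing: the traces of the h_a
are the components of a parallel normal field. *)
Lemma cov2_trace i j a : \tr (cov2 h i j a) = 0.
Proof.
have tr0 l b : \tr (cov l h b) = 0 by rewrite trace_cov pmc subrr.
rewrite /cov2 raddfB /= trace_cov tr0 raddf0 sub0r (raddf_sum (@mxtrace K m)) /=.
rewrite !big1 ?oppr0 ?addr0 // => [l|b] _; first by rewrite mxtraceZ tr0 mulr0.
by rewrite tr0 mulr0.
Qed.

Lemma cov2C_contract j k a :
  \sum_i (cov2 h i j a i k - cov2 h j i a i k) =
  (c *: simons u (h a) + \sum_b simons (h b) (h a)
   - \sum_b (h a *m h b *m h b - h b *m h a *m h b)) j k.
Proof.
have us : u^T = u by rewrite /u linearB /= trmx1 trmx_mul trmxK.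
have E i : cov2 h i j a i k - cov2 h j i a i k =
   c * (- (rot u i j *m h a) + h a *m rot u i j) i k
   + \sum_b (- (rot (h b) i j *m h a) + h a *m rot (h b) i j) i k
   - \sum_b ((h a *m h b) j i - (h a *m h b) i j) * h b i k.
  have -> : cov2 h i j a i k - cov2 h j i a i k = (cov2 h i j a - cov2 h j i a) i k.
    by rewrite mxDE mxNE.
  rewrite (cov2C h i j a) gauss ricci mulmxDl mulmxDr.
  rewrite -scalemxAl -scalemxAr mulmx_suml mulmx_sumr.
  rewrite [LHS]mxDE [X in _ + X = _]mxNE.
  have -> : nact (\matrix_(a, b) ((h a *m h b) j i - (h a *m h b) i j)) h a i k
     = \sum_b ((h a *m h b) j i - (h a *m h b) i j) * h b i k.
    by rewrite /nact summxE; apply: eq_bigr => b _; rewrite !mxE.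
  have -> : \sum_b (- (rot (h b) i j *m h a) + h a *m rot (h b) i j) i k =
      - (\sum_b rot (h b) i j *m h a) i k + (\sum_b h a *m rot (h b) i j) i k.
    rewrite !summxE -sumrN -big_split /=.
    by apply: eq_bigr => b _; rewrite mxDE mxNE.
  rewrite !(mxDE, mxNE, mxZE); ring.
under eq_bigr do rewrite E.
rewrite sumrB big_split /= -mulr_sumr rot_contract //.
rewrite [X in _ + X - _]exchange_big [X in _ - X]exchange_big /=.
rewrite !(mxDE, mxNE, mxZE) !summxE; congr (_ + _ - _).
  by apply: eq_bigr => b _; rewrite rot_contract.
apply: eq_bigr => b _; rewrite mxDE mxNE [X in _ = X - _]mxE [X in _ = _ - X]mxE.
rewrite -sumrB; apply: eq_bigr => i _.
have -> : (h a *m h b) i j = (h b *m h a) j i.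
  by rewrite -(h_sym a) -(h_sym b) -trmx_mul mxE !h_sym.
ring.
Qed.

Let P : 'M[K]_m := t *m t^T.

Lemma P_mid (A : 'M[_]_m) : P *m A *m P = \tr (P *m A) *: P.
Proof.
have -> : \tr (P *m A) = (t^T *m A *m t) 0 0.
  by rewrite /P -mulmxA mxtrace_mulC /mxtrace big_ord1.
rewrite /P !mulmxA -[t *m t^T *m A *m t]mulmxA -!(mulmxA t).
rewrite [t^T *m (A *m t)]mulmxA [t^T *m A *m t]mx11_scalar.
by rewrite mul_scalar_mx -scalemxAr [(_%:M) 0 0]mxE eqxx mulr1n.
Qed.

(** The two applications of the Codazzi equation in the computation of the rough
Laplacian, contracted. *)
Lemma der_codazzi_contract j k a :
  \sum_i (cov2 h i i a j k - cov2 h i j a i k)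
  + \sum_i (cov2 h j i a k i - cov2 h j k a i i) =
  (c *: (n a 0 *: nu - (n a 0 * \tr nu) *: 1%:M - P *m h a
         + \tr (P *m h a) *: 1%:M
         + (m%:R - 1) *: (n a 0 *: nu - h a *m P))) j k.
Proof.
have nuE x y : \sum_b n b 0 * h b x y = nu x y.
  by rewrite /nu summxE; apply: eq_bigr => b _; rewrite mxE.
have nuC x y : nu x y = nu y x.
  rewrite -!nuE; apply: eq_bigr => b _; congr (_ * _).
  by rewrite -[in LHS]h_sym mxE.
pose ht i := \sum_q h a i q * t q 0.
have PhE x y : (P *m h a) x y = t x 0 * ht y.
  rewrite /P -mulmxA -{1}(h_sym a) -trmx_mul mxE big_ord1.
  by rewrite mxE [(_ *m _) _ _]mxE.
have hPE x y : (h a *m P) x y = ht x * t y 0.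
  by rewrite /P mulmxA mxE big_ord1 [(_ *m _) _ _]mxE [(t^T) _ _]mxE.
under eq_bigr do rewrite der_codazzi !nuE.
under [X in _ + X]eq_bigr do rewrite der_codazzi !nuE eqxx.
rewrite !(mxDE, mxNE, mxZE) PhE hPE [\tr (P *m h a)]/mxtrace.
under [in RHS]eq_bigr do rewrite PhE.
have -> : (1%:M : 'M[K]_m) j k = (j == k)%:R by rewrite mxE.
rewrite -!mulr_sumr -mulrDr; congr (_ * _).
rewrite !sumrB -!/(ht _).
have -> : \sum_i ((i == k)%:R * nu i j - (j == k)%:R * nu i i) * n a 0
    = (nu j k - (j == k)%:R * \tr nu) * n a 0.
  by rewrite -mulr_suml sumrB sum_delta_l -mulr_sumr nuC.
have -> : \sum_i ((i == k)%:R * t j 0 - (j == k)%:R * t i 0) * ht i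
    = t j 0 * ht k - (j == k)%:R * (\sum_i t i 0 * ht i).
  rewrite mulr_sumr -(sum_delta_l ht k) mulr_sumr -sumrB.
  by apply: eq_bigr => i _; ring.
have -> : \sum_(i < m) (true%:R * nu j k - (k == i)%:R * nu j i) * n a 0
    = (m%:R - 1) * nu j k * n a 0.
  rewrite -mulr_suml sumrB sumr_const card_ord.
  under [X in _ - X]eq_bigr do rewrite mulrC.
  by rewrite sum_delta_r -mulr_natl /=; ring.
have -> : \sum_(i < m) (true%:R * t k 0 - (k == i)%:R * t i 0) * ht j
    = (m%:R - 1) * t k 0 * ht j.
  rewrite -mulr_suml sumrB sumr_const card_ord.
  under [X in _ - X]eq_bigr do rewrite mulrC.
  by rewrite sum_delta_r -mulr_natl /=; ring.
ring.
Qed.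

(** h_jk,ii = h_ik,ij + [Codazzi] + [Ricci identity], and h_ki,ij = h_ii,kj +
[Codazzi]; the sum of h_ii,kj vanishes. *)
Lemma rough_laplacian a :
  \sum_i cov2 h i i a = c *: simons u (h a) + \sum_b simons (h b) (h a)
   - \sum_b (h a *m h b *m h b - h b *m h a *m h b)
   + c *: (n a 0 *: nu - (n a 0 * \tr nu) *: 1%:M - P *m h a
         + \tr (P *m h a) *: 1%:M
         + (m%:R - 1) *: (n a 0 *: nu - h a *m P)).
Proof.
apply/matrixP => j k; rewrite [RHS]mxDE -cov2C_contract -der_codazzi_contract.
have z : \sum_i cov2 h j k a i i = 0 by exact: cov2_trace.
rewrite summxE -!big_split /= -[LHS]subr0 -[X in _ - X = _]z -sumrB.
apply: eq_bigr => i _.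
have -> : cov2 h j i a k i = cov2 h j i a i k.
  by rewrite -[in LHS]cov2_sym // mxE.
ring.
Qed.

Theorem simons_identity :
  let S := pairing h h in
  \sum_i (X i (X i S) - \sum_l w i i l * X l S) =
  2 * (\sum_i pairing (cov i h) (cov i h)
   + c * ((m%:R - \tr P) * S - 2 * m%:R * (\sum_a \tr (P *m h a *m h a))
          + 3 * (\sum_a \tr (P *m h a) * \tr (h a)) + m%:R * \tr (nu *m nu)
          - \tr nu ^+ 2 - \sum_a \tr (h a) ^+ 2)
   + \sum_a \sum_b (\tr (h b) * \tr (h a *m h a *m h b)
      + \tr ((h a *m h b - h b *m h a) *m (h a *m h b - h b *m h a))
      - \tr (h a *m h b) ^+ 2)).
Proof.
move=> S.
have pC U V : pairing U V = pairing V U.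
  by apply: eq_bigr => a _; exact: mxtrace_mulC.
have D1 i : X i S = 2 * pairing (cov i h) h.
  by rewrite /S der_pairing [pairing h _]pC; ring.
have D2 i : X i (X i S) = 2 * (pairing (cov i h) (cov i h) + pairing (cov i (cov i h)) h).
  by rewrite D1 derM der_nat der_pairing; ring.
have -> : \sum_i (X i (X i S) - \sum_l w i i l * X l S) =
   2 * (\sum_i pairing (cov i h) (cov i h)
        + \sum_a \tr ((\sum_i cov2 h i i a) *m h a)).
  have -> : \sum_a \tr ((\sum_i cov2 h i i a) *m h a) =
      \sum_i \sum_a \tr (cov2 h i i a *m h a).
    rewrite [RHS]exchange_big; apply: eq_bigr => a _.
    by rewrite mulmx_suml raddf_sum.
  rewrite -big_split mulr_sumr; apply: eq_bigr => i _ /=.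
  rewrite D2 !mulrDr -addrA; congr (_ + _).
  have -> : \sum_a \tr (cov2 h i i a *m h a) =
     pairing (cov i (cov i h)) h - \sum_l w i i l * pairing (cov l h) h.
    rewrite /pairing; under [X in _ = _ - X]eq_bigr do rewrite mulr_sumr.
    rewrite [X in _ = _ - X]exchange_big -sumrB; apply: eq_bigr => a _ /=.
    rewrite {1}/cov2 mulmxBl mulmx_suml (raddfB (@mxtrace K m)) /=.
    rewrite (raddf_sum (@mxtrace K m)); congr (_ - _).
    by apply: eq_bigr => l _; rewrite -scalemxAl /= mxtraceZ.
  rewrite mulrBr; congr (_ - _); rewrite mulr_sumr; apply: eq_bigr => l _.
  by rewrite D1; ring.
congr (2 * _); rewrite -addrA; congr (_ + _).
have trZ a (A : 'M[K]_m) : \tr (a *: A) = a * \tr A by exact: mxtraceZ.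
have trD (A A' : 'M[K]_m) : \tr (A + A') = \tr A + \tr A' by exact: mxtraceD.
have trN (A : 'M[K]_m) : \tr (- A) = - \tr A by rewrite raddfN.
have nuT : \sum_a n a 0 * \tr (nu *m h a) = \tr (nu *m nu).
  rewrite {3}/nu mulmx_sumr raddf_sum; apply: eq_bigr => a _.
  by rewrite -scalemxAr /= trZ.
have nuH : \sum_a n a 0 * \tr (h a) = \tr nu.
  by rewrite /nu raddf_sum; apply: eq_bigr => a _; rewrite /= trZ.
have E a : \tr ((\sum_i cov2 h i i a) *m h a) =
   c * ((m%:R - \tr P) * \tr (h a *m h a) - 2 * m%:R * \tr (P *m h a *m h a)
          + 3 * (\tr (P *m h a) * \tr (h a)) + m%:R * (n a 0 * \tr (nu *m h a))
          - \tr nu * (n a 0 * \tr (h a)) - \tr (h a) ^+ 2)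
   + \sum_b (\tr (h b) * \tr (h a *m h a *m h b)
      + \tr ((h a *m h b - h b *m h a) *m (h a *m h b - h b *m h a))
      - \tr (h a *m h b) ^+ 2).
  rewrite rough_laplacian.
  set H := h a.
  have Eu := trace_simons_rank1 H P_mid.
  have Es : \sum_b (\tr (h b) * \tr (H *m H *m h b)
      + \tr ((H *m h b - h b *m H) *m (H *m h b - h b *m H))
      - \tr (H *m h b) ^+ 2) = \tr ((\sum_b simons (h b) H) *m H)
      - \tr ((\sum_b (H *m h b *m h b - h b *m H *m h b)) *m H).
    rewrite !mulmx_suml !(raddf_sum (@mxtrace K m)) -sumrB.
    by apply: eq_bigr => b _; rewrite /= trace_simons_commutator.
  have HPH : \tr (H *m P *m H) = \tr (P *m H *m H).
    by rewrite -mulmxA mxtrace_mulC.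
  have Ed : \tr ((n a 0 *: nu - (n a 0 * \tr nu) *: 1%:M - P *m H +
        \tr (P *m H) *: 1%:M + (m%:R - 1) *: (n a 0 *: nu - H *m P)) *m H) =
     m%:R * (n a 0 * \tr (nu *m H)) - \tr nu * (n a 0 * \tr H)
     - m%:R * \tr (P *m H *m H) + \tr (P *m H) * \tr H.
    move: HPH; move: (nu) (P) (H) => N Q B HPH.
    rewrite !(mulmxDl, mulNmx) -!scalemxAl !(mulmxDl, mulNmx, mul1mx) -!scalemxAl.
    rewrite !(trD, trN, trZ) HPH; ring.
  rewrite Es !mulmxDl mulNmx -!scalemxAl !(trD, trN, trZ) Eu Ed; ring.
rewrite (eq_bigr _ (fun a _ => E a)) big_split /=; congr (_ + _).
rewrite -mulr_sumr; congr (_ * _).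
rewrite !(sumrB, big_split) /= -!mulr_sumr nuT nuH.
by rewrite /S /pairing expr2.
Qed.

End Simons.

(** * Levi-Civita connection and curvature in coordinates *)

Section LeviCivita.
Context {K : comNzRingType} {n : nat}.
Variable D : 'I_n -> derivation K.
Hypothesis DC : forall i j a, D i (D j a) = D j (D i a).
Variables (g gi : 'M[K]_n) (half : K).
Hypothesis g_sym : g^T = g.
Hypothesis gK : gi *m g = 1%:M.
Hypothesis halfE : half * 2 = 1.

(** Christoffel symbols of the first kind, with the direction as first index. *)
Definition koszul i : 'M[K]_n :=
  \matrix_(j, l) (half * (D i (g j l) + D j (g i l) - D l (g i j))).

Definition lc i : 'M[K]_n := koszul i *m gi^T.

Lemma g_entry_sym i j : g i j = g j i.
Proof. by rewrite -[in LHS]g_sym mxE. Qed.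

Lemma lc_lower i : lc i *m g = koszul i.
Proof.
by rewrite /lc -mulmxA -{1}g_sym -trmx_mul (mulmx1C gK) trmx1 mulmx1.
Qed.

Lemma lc_metric i : map_mx (D i) g = lc i *m g + g *m (lc i)^T.
Proof.
rewrite -[X in _ + X *m _]g_sym -trmx_mul lc_lower.
apply/matrixP => j l; rewrite !mxE (g_entry_sym l j).
transitivity (half * 2 * D i (g j l)); first by rewrite halfE mul1r.
ring.
Qed.

Lemma lc_torsion i j k : lc i j k = lc j i k.
Proof.
rewrite [LHS]mxE [RHS]mxE; apply: eq_bigr => l _; rewrite !mxE.
by rewrite (g_entry_sym j i) [D i _ + _]addrC.
Qed.

Definition riemann i j : 'M[K]_n :=
  map_mx (D i) (lc j) - map_mx (D j) (lc i) + lc j *m lc i - lc i *m lc j.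

(** Twice differentiating the metric and skew-symmetrizing: the second
derivatives of g commute, and compatibility leaves exactly the curvature and its
transpose. *)
Lemma riemann_skew34 i j : (riemann i j *m g)^T = - (riemann i j *m g).
Proof.
have second k l : map_mx (D k) (map_mx (D l) g) =
   map_mx (D k) (lc l) *m g + lc l *m (lc k *m g) + lc l *m (g *m (lc k)^T)
   + (lc k *m g *m (lc l)^T + g *m (lc k)^T *m (lc l)^T
   + g *m (map_mx (D k) (lc l))^T).
  rewrite (lc_metric l) map_mxD (map_der_mul _ (lc l) g) (map_der_mul _ g).
  rewrite -map_trmx !lc_metric.
  by rewrite mulmxDl mulmxDr !addrA.
have sw : map_mx (D i) (map_mx (D j) g) - map_mx (D j) (map_mx (D i) g) = 0.
  by apply/matrixP => k l; rewrite !mxE DC subrr.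
rewrite trmx_mul g_sym; apply/eqP; rewrite -addr_eq0 addrC; apply/eqP.
have trD (A B : 'M[K]_n) : (A + B)^T = A^T + B^T by exact: linearD.
have trN (A : 'M[K]_n) : (- A)^T = - A^T by exact: linearN.
rewrite -{}sw !second /riemann !(trD, trN) !trmx_mul.
rewrite !(mulmxDl, mulmxDr, mulNmx, mulmxN) !mulmxA.
apply/matrixP => k l; rewrite !(mxDE, mxNE); ring.
Qed.

Lemma riemann_bianchi i j k l :
  riemann i j k l + riemann j k i l + riemann k i j l = 0.
Proof.
have E a b q : riemann a b q l = D a (lc b q l) - D b (lc a q l)
   + \sum_r lc b q r * lc a r l - \sum_r lc a q r * lc b r l.
  by rewrite /riemann !(mxDE, mxNE) !mxE.
rewrite !E (lc_torsion k j) (lc_torsion k i) (lc_torsion j i).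
have T a b c : \sum_r lc a b r * lc c r l = \sum_r lc b a r * lc c r l.
  by apply: eq_bigr => r _; rewrite lc_torsion.
rewrite (T k i) (T k j) (T j i); ring.
Qed.

End LeviCivita.

(** * Tensors with the symmetries of the curvature *)

Section CurvatureTensor.
Context {R : realType} {V : zmodType} (S : V -> V -> V -> V -> R).
Hypothesis S1 : forall u u' v w z, S (u + u') v w z = S u v w z + S u' v w z.
Hypothesis S12 : forall u v w z, S u v w z = - S v u w z.
Hypothesis S34 : forall u v w z, S u v w z = - S u v z w.
Hypothesis bianchi : forall u v w z, S u v w z + S v w u z + S w u v z = 0.
Hypothesis S3 : forall u v w w' z, S u v (w + w') z = S u v w z + S u v w' z.
Hypothesis sect : forall u v, S u v v u = 0.

(** Polarizing [sect] in the outer arguments, with pair symmetry, gives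
skewness in the first and third arguments as well; the Bianchi identity then
says that three times the tensor vanishes. *)
Lemma curvature_tensor_eq0 u v w z : S u v w z = 0.
Proof.
have S2 a b b' x y : S a (b + b') x y = S a b x y + S a b' x y.
  by rewrite S12 S1 opprD -!S12.
have S4 a b x y y' : S a b x (y + y') = S a b x y + S a b x y'.
  by rewrite S34 S3 opprD -!S34.
have pair a b x y : S a b x y = S x y a b.
  have B1 := bianchi a b x y; have B2 := bianchi b x y a.
  have B3 := bianchi x y a b; have B4 := bianchi y a b x.
  have E1 := S12 x a b y; have E2 := S34 b x y a; have E3 := S34 x y b a.
  have E4 := S12 y b x a; have E5 := S34 b y x a; have E6 := S12 y a x b.
  have E7 := S34 a y x b; have E8 := S34 a x y b; have E9 := S12 y a b x.
  have E10 := S34 a b y x; lra.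
have S0 a b y : S a b b y = 0.
  have := sect (a + y) b; rewrite S1 !S4 !sect.
  have E1 := pair y b b a; have E2 := S12 b a y b; have E3 := S34 a b y b; lra.
have swap a b x y : S a b x y = - S a x b y.
  have := S0 a (b + x) y; rewrite S2 !S3 !S0; lra.
have B := bianchi u v w z; have E1 := S12 v w u z; have E2 := swap w v u z.
have E3 := swap v u w z; have E4 := S12 u v w z; have E5 := swap u v w z.
have E6 := S12 w u v z; have E7 := swap u w v z; have E8 := S12 w v u z.
lra.
Qed.

End CurvatureTensor.

(** * Structure equations of an adapted moving frame *)

Section Combination.
Context {K : comNzRingType} {m : nat} (v : 'I_m -> K) (d : 'I_m -> derivation K).

Definition comb_fun (a : K) : K := \sum_k v k * d k a.

Lemma comb_is_zmod : zmod_morphism comb_fun.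
Proof.
move=> a b; rewrite /comb_fun -sumrB; apply: eq_bigr => k _.
by rewrite raddfB /= mulrBr.
Qed.

HB.instance Definition _ := GRing.isZmodMorphism.Build K K comb_fun comb_is_zmod.

Lemma combM a b : comb_fun (a * b) = comb_fun a * b + a * comb_fun b.
Proof.
rewrite /comb_fun mulr_suml mulr_sumr -big_split; apply: eq_bigr => k _ /=.
rewrite derM; ring.
Qed.

Definition der_comb : derivation K := Derivation combM.

Lemma der_combE a : der_comb a = \sum_k v k * d k a. Proof. by []. Qed.

Lemma map_der_comb p q (A : 'M[K]_(p, q)) :
  map_mx der_comb A = \sum_k v k *: map_mx (d k) A.
Proof.
apply/matrixP => a b; rewrite !mxE der_combE summxE.
by apply: eq_bigr => k _; rewrite !mxE.
Qed.

End Combination.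

(* From here on frame derivatives are compared by name, never by unfolding
   the sums which define them. *)
#[global] Opaque der_comb.

(** The coordinate fields of the submanifold are the derivations [d i].  The
rows of [J] are their images under the differential of the immersion, [G] is the
ambient metric along the immersion, and [Gt i] the matrix of the ambient
connection in the i-th direction.  The rows of [e] and [nu] form a tangent and
a normal orthonormal frame, the former in coordinates of the submanifold, the
latter in ambient coordinates.  [amb_curvE] says that the ambient curvature is
that of constant curvature [c] in the directions orthogonal to [xi]: [a_ i] is the
covector dual to the projection of the i-th coordinate field. *)
Section MovingFrame.
Context {K : comNzRingType} {m k p : nat}.
Variable d : 'I_m -> derivation K.
Hypothesis dC : forall i j a, d i (d j a) = d j (d i a).
Variables (e : 'M[K]_m) (J : 'M[K]_(m, k)) (G : 'M[K]_k) (Gt : 'I_m -> 'M[K]_k).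
Variables (nu : 'M[K]_(p, k)) (xi : 'rV[K]_k) (c : K).

(** Covariant derivative, along the immersion, of each row of V. *)
Definition nabla_dir i q (V : 'M[K]_(q, k)) := map_mx (d i) V + V *m Gt i.

Hypothesis c_const : forall i, d i c = 0.
Hypothesis G_sym : G^T = G.
Hypothesis metric_compat : forall i, map_mx (d i) G = Gt i *m G + G *m (Gt i)^T.
Hypothesis torsion_free : forall i j, row j (nabla_dir i J) = row i (nabla_dir j J).
Hypothesis xi_parallel : forall i, nabla_dir i xi = 0.
Let a_ i : 'rV[K]_k := row i J *m G - (row i J *m G *m xi^T) *m xi *m G.
Definition amb_curv i j : 'M[K]_k :=
  map_mx (d i) (Gt j) - map_mx (d j) (Gt i) + Gt j *m Gt i - Gt i *m Gt j.
Hypothesis amb_curvE : forall i j,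
  amb_curv i j *m G = c *: ((a_ j)^T *m a_ i - (a_ i)^T *m a_ j).

Definition frame : 'M[K]_(m + p, k) := col_mx (e *m J) nu.
Local Notation P := frame.
Hypothesis frame_orth : P *m G *m P^T = 1%:M.
Hypothesis frame_complete : P^T *m P *m G = 1%:M.

Definition dframe i : derivation K := der_comb (e i) d.
Definition Gframe i : 'M[K]_k := \sum_l e i l *: Gt l.
Definition nabla_frame i q (V : 'M[K]_(q, k)) := map_mx (dframe i) V + V *m Gframe i.

Lemma nabla_frameE i q (V : 'M[K]_(q, k)) : nabla_frame i V = \sum_l e i l *: nabla_dir l V.
Proof.
rewrite /nabla_frame /dframe map_der_comb mulmx_sumr -big_split; apply: eq_bigr => l _ /=.
by rewrite /nabla_dir scalerDr scalemxAr.
Qed.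

(** Entry (a, b) is the component along the b-th field of the adapted frame of the
ambient derivative of the a-th field. *)
Definition frame_conn i : 'M[K]_(m + p) := nabla_frame i P *m G *m P^T.

(** The transposed form of completeness recovers an ambient vector from its
components in the frame. *)
Lemma frame_dual : G *m P^T *m P = 1%:M.
Proof.
by have := congr1 trmx frame_complete; rewrite !trmx_mul trmxK G_sym trmx1 mulmxA.
Qed.

Lemma nabla_frame_frame i : nabla_frame i P = frame_conn i *m P.
Proof. by rewrite /frame_conn -!mulmxA [G *m _]mulmxA frame_dual mulmx1. Qed.

Lemma dframe_metric i : map_mx (dframe i) G = Gframe i *m G + G *m (Gframe i)^T.
Proof.
rewrite /dframe map_der_comb /Gframe mulmx_suml [(\sum_l _)^T]raddf_sum mulmx_sumr -big_split.
apply: eq_bigr => l _ /=; rewrite metric_compat scalerDr scalemxAl.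
by rewrite linearZ /= scalemxAr.
Qed.

(** Product rule for the inner product of two families of ambient fields. *)
Lemma dframe_pairing i q r (V : 'M[K]_(q, k)) (U : 'M[K]_(r, k)) :
  map_mx (dframe i) (V *m G *m U^T) = nabla_frame i V *m G *m U^T + V *m G *m (nabla_frame i U)^T.
Proof.
rewrite !map_der_mul dframe_metric -map_trmx /nabla_frame.
have trD (A B : 'M[K]_(r, k)) : (A + B)^T = A^T + B^T by exact: linearD.
rewrite trD trmx_mul !(mulmxDl, mulmxDr) !mulmxA.
move: (map_mx (dframe i) V *m G *m U^T) (V *m Gframe i *m G *m U^T).
move: (V *m G *m (Gframe i)^T *m U^T) (V *m G *m (map_mx (dframe i) U)^T) => A B C D.
by rewrite -!addrA [A + B]addrC.
Qed.

Lemma frame_conn_skew i : (frame_conn i)^T = - frame_conn i.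
Proof.
have := dframe_pairing i P P; rewrite frame_orth map_der1 -/(frame_conn i) => E.
apply/eqP; rewrite -addr_eq0 addrC E; apply/eqP; congr (_ + _).
by rewrite /frame_conn !trmx_mul trmxK G_sym mulmxA.
Qed.

Let eps : 'M[K]_(m, k) := e *m J.

Lemma eps_orth : eps *m G *m eps^T = 1%:M.
Proof.
have := frame_orth; rewrite /frame mul_col_mx tr_col_mx mul_col_row.
by rewrite (@scalar_mx_block K m p 1) => /eq_block_mx[].
Qed.

Lemma eps_nu : eps *m G *m nu^T = 0.
Proof.
have := frame_orth; rewrite /frame mul_col_mx tr_col_mx mul_col_row.
by rewrite (@scalar_mx_block K m p 1) => /eq_block_mx[].
Qed.

Lemma nu_eps : nu *m G *m eps^T = 0.
Proof. by have := congr1 trmx eps_nu; rewrite !trmx_mul trmxK G_sym trmx0 mulmxA. Qed.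

Lemma nu_orth : nu *m G *m nu^T = 1%:M.
Proof.
have := frame_orth; rewrite /frame mul_col_mx tr_col_mx mul_col_row.
by rewrite (@scalar_mx_block K m p 1) => /eq_block_mx[].
Qed.

Definition gram : 'M[K]_m := J *m G *m J^T.

Lemma e_orth : e *m gram *m e^T = 1%:M.
Proof. by rewrite -eps_orth /gram /eps trmx_mul !mulmxA. Qed.

Lemma e_complete : gram *m e^T *m e = 1%:M.
Proof. by apply: mulmx1C; rewrite mulmxA e_orth. Qed.

Lemma e_completeT : e^T *m e *m gram = 1%:M.
Proof. by rewrite -mulmxA; apply: mulmx1C; rewrite e_orth. Qed.

Definition bracket_coord i j : 'rV[K]_m :=
  map_mx (dframe i) (row j e) - map_mx (dframe j) (row i e).

(** The ambient connection is torsion free along the immersion, so the torsion of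
the frame is its bracket. *)
Lemma torsion_frame i j :
  row j (nabla_frame i eps) - row i (nabla_frame j eps) = bracket_coord i j *m J.
Proof.
have E a b : row b (nabla_frame a eps) = map_mx (dframe a) (row b e) *m J
    + \sum_l \sum_q (e a l * e b q) *: row q (nabla_dir l J).
  have -> : nabla_frame a eps = map_mx (dframe a) e *m J + e *m nabla_frame a J.
    by rewrite /nabla_frame /eps map_der_mul mulmxDr !mulmxA addrA.
  rewrite linearD /= !row_mul map_row; congr (_ + _).
  rewrite nabla_frameE mulmx_sumr; apply: eq_bigr => l _.
  rewrite -scalemxAr mulmx_sum_row scaler_sumr; apply: eq_bigr => q _.
  by rewrite scalerA mxE.
rewrite !E /bracket_coord mulmxBl opprD addrACA [X in _ + X]addrC.
suff -> : \sum_l \sum_q (e i l * e j q) *: row q (nabla_dir l J) =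
    \sum_l \sum_q (e j l * e i q) *: row q (nabla_dir l J).
  by rewrite addNr addr0.
rewrite exchange_big; apply: eq_bigr => l _; apply: eq_bigr => q _ /=.
by rewrite torsion_free mulrC.
Qed.

(** By skewness the connection matrix has three independent blocks: the tangent
connection, the normal connection and the second fundamental form. *)
Definition conn i : 'M[K]_m := ulsubmx (frame_conn i).
Definition nconn i : 'M[K]_p := drsubmx (frame_conn i).
Definition sff_frame i : 'M[K]_(m, p) := ursubmx (frame_conn i).
Definition shape a : 'M[K]_m := \matrix_(i, j) sff_frame i j a.

Lemma frame_conn_parts i : frame_conn i =
  block_mx (nabla_frame i eps *m G *m eps^T) (nabla_frame i eps *m G *m nu^T)
           (nabla_frame i nu *m G *m eps^T) (nabla_frame i nu *m G *m nu^T).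
Proof.
rewrite /frame_conn /frame.
have -> : nabla_frame i (col_mx (e *m J) nu) =
    col_mx (nabla_frame i eps) (nabla_frame i nu).
  by rewrite /nabla_frame map_col_mx mul_col_mx add_col_mx.
by rewrite mul_col_mx tr_col_mx mul_col_row.
Qed.

Lemma connE i : conn i = nabla_frame i eps *m G *m eps^T.
Proof. by rewrite /conn frame_conn_parts block_mxKul. Qed.
Lemma sff_frameE i : sff_frame i = nabla_frame i eps *m G *m nu^T.
Proof. by rewrite /sff_frame frame_conn_parts block_mxKur. Qed.
Lemma nconnE i : nconn i = nabla_frame i nu *m G *m nu^T.
Proof. by rewrite /nconn frame_conn_parts block_mxKdr. Qed.

Lemma frame_conn_block i : frame_conn i =
  block_mx (conn i) (sff_frame i) (- (sff_frame i)^T) (nconn i).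
Proof.
rewrite -[LHS]submxK -/(conn i) -/(sff_frame i) -/(nconn i); congr block_mx.
have := frame_conn_skew i; rewrite -[frame_conn i]submxK tr_block_mx opp_block_mx.
move=> /eq_block_mx[_ _ E _].
by rewrite ?block_mxKdl /sff_frame E opprK.
Qed.

Lemma conn_skew i : (conn i)^T = - conn i.
Proof.
by have := frame_conn_skew i; rewrite frame_conn_block tr_block_mx opp_block_mx => /eq_block_mx[].
Qed.

Lemma nconn_skew i : (nconn i)^T = - nconn i.
Proof.
by have := frame_conn_skew i; rewrite frame_conn_block tr_block_mx opp_block_mx => /eq_block_mx[].
Qed.

Lemma J_eps : J = gram *m e^T *m eps.
Proof. by rewrite /eps mulmxA e_complete mul1mx. Qed.

Lemma J_nu : J *m G *m nu^T = 0.
Proof. by rewrite J_eps -(mulmxA _ eps) -(mulmxA _ (eps *m G)) eps_nu mulmx0. Qed.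

Lemma shape_entry a i j : shape a i j = (row j (nabla_frame i eps) *m G *m nu^T) 0 a.
Proof. by rewrite /shape mxE sff_frameE -!row_mul [RHS]mxE. Qed.

Lemma conn_entry i j l : conn i j l = (row j (nabla_frame i eps) *m G *m eps^T) 0 l.
Proof. by rewrite connE -!row_mul [RHS]mxE. Qed.

Lemma shape_sym a : (shape a)^T = shape a.
Proof.
apply/matrixP => i j; rewrite [LHS]mxE !shape_entry; apply/eqP; rewrite -subr_eq0; apply/eqP.
have : (row i (nabla_frame j eps) - row j (nabla_frame i eps)) *m G *m nu^T = 0.
  by rewrite torsion_frame -!mulmxA [J *m _]mulmxA J_nu mulmx0.
by move/matrixP/(_ 0 a); rewrite !mulmxBl mxDE mxNE [RHS]mxE.
Qed.

Lemma tauE i j : \row_l tau conn i j l = bracket_coord i j *m gram *m e^T.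
Proof.
have -> : bracket_coord i j *m gram *m e^T =
    (row j (nabla_frame i eps) - row i (nabla_frame j eps)) *m G *m eps^T.
  by rewrite torsion_frame /gram /eps trmx_mul !mulmxA.
by apply/rowP => l; rewrite mxE /tau !conn_entry !mulmxBl mxDE mxNE.
Qed.

Lemma bracket_coordE i j q : bracket_coord i j 0 q = \sum_l tau conn i j l * e l q.
Proof.
have -> : bracket_coord i j = (\row_l tau conn i j l) *m e.
  by rewrite tauE -mulmxA -mulmxA [gram *m _]mulmxA e_complete mulmx1.
by rewrite mxE; apply: eq_bigr => l _; rewrite mxE.
Qed.

(** The structure functions of the frame are read off from the tangent
connection, as the latter has no torsion. *)
Lemma bracket i j u :
  dframe i (dframe j u) - dframe j (dframe i u) = \sum_l tau conn i j l * dframe l u.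
Proof.
have E a b : dframe a (dframe b u) = \sum_q dframe a (e b q) * d q u
   + \sum_q \sum_r e b q * e a r * d r (d q u).
  rewrite [dframe b u]der_combE raddf_sum -big_split; apply: eq_bigr => q _ /=.
  rewrite derM; congr (_ + _); rewrite [dframe a _]der_combE mulr_sumr.
  by apply: eq_bigr => r _; rewrite mulrA.
rewrite !E opprD addrACA [X in _ + X](_ : _ = 0) ?addr0.
  have -> : \sum_l tau conn i j l * dframe l u = \sum_q bracket_coord i j 0 q * d q u.
    under [RHS]eq_bigr do rewrite bracket_coordE mulr_suml.
    rewrite [RHS]exchange_big; apply: eq_bigr => l _ /=.
    rewrite [dframe l u]der_combE mulr_sumr; apply: eq_bigr => q _.
    by rewrite mulrA.
  rewrite -sumrB; apply: eq_bigr => q _.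
  by rewrite /bracket_coord mxDE mxNE !mxE mulrBl.
apply/eqP; rewrite subr_eq0 exchange_big; apply/eqP.
apply: eq_bigr => q _; apply: eq_bigr => r _ /=.
by rewrite dC [e j _ * _]mulrC.
Qed.

Lemma bracket_mx i j q r (A : 'M[K]_(q, r)) :
  map_mx (dframe i) (map_mx (dframe j) A) - map_mx (dframe j) (map_mx (dframe i) A) =
  \sum_l tau conn i j l *: map_mx (dframe l) A.
Proof.
apply/matrixP => a b; rewrite mxDE mxNE !mxE bracket summxE.
by apply: eq_bigr => l _; rewrite !mxE.
Qed.

(** Curvature transforms by conjugation under a change of frame: both sides are
the commutator of two covariant derivatives, applied to the frame. *)
Lemma curv_frame i j : curv dframe conn frame_conn i j *m P = P *m curv dframe conn Gframe i j.
Proof.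
have E a b : (map_mx (dframe a) (frame_conn b) + frame_conn b *m frame_conn a) *m P =
   map_mx (dframe a) (map_mx (dframe b) P) + map_mx (dframe a) P *m Gframe b
   + map_mx (dframe b) P *m Gframe a
   + P *m (map_mx (dframe a) (Gframe b) + Gframe b *m Gframe a).
  have := congr1 (map_mx (dframe a)) (nabla_frame_frame b); rewrite map_der_mul.
  rewrite [map_mx (dframe a) (nabla_frame b P)]map_mxD map_der_mul => E1.
  have E2 : frame_conn b *m frame_conn a *m P = frame_conn b *m map_mx (dframe a) P
     + (map_mx (dframe b) P + P *m Gframe b) *m Gframe a.
    rewrite -(mulmxA (frame_conn b)) -(nabla_frame_frame a) [nabla_frame a P]/(_ + _).
    rewrite mulmxDr (mulmxA (frame_conn b) P).
    by rewrite -(nabla_frame_frame b).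
  have E3 : map_mx (dframe a) (frame_conn b) *m P = map_mx (dframe a) (map_mx (dframe b) P) +
     (map_mx (dframe a) P *m Gframe b + P *m map_mx (dframe a) (Gframe b))
     - frame_conn b *m map_mx (dframe a) P.
    by rewrite E1 addrK.
  rewrite mulmxDl E2 E3 mulmxDl mulmxDr (mulmxA P).
  move: (map_mx (dframe a) (map_mx _ _)) (_ *m Gframe b) (P *m map_mx _ _).
  move: (frame_conn b *m map_mx _ _).
  move=> A4 A1 A2 A3; move: (map_mx _ _ *m Gframe a) (P *m _ *m Gframe a) => A5 A6.
  apply/matrixP => q r; rewrite !(mxDE, mxNE); ring.
have F : curv dframe conn frame_conn i j =
   (map_mx (dframe i) (frame_conn j) + frame_conn j *m frame_conn i)
   - (map_mx (dframe j) (frame_conn i) + frame_conn i *m frame_conn j)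
   - \sum_l tau conn i j l *: frame_conn l.
  by rewrite /curv opprD addrACA addrA.
have F' : curv dframe conn Gframe i j = (map_mx (dframe i) (Gframe j) + Gframe j *m Gframe i)
   - (map_mx (dframe j) (Gframe i) + Gframe i *m Gframe j) - \sum_l tau conn i j l *: Gframe l.
  by rewrite /curv opprD addrACA addrA.
have T : (\sum_l tau conn i j l *: frame_conn l) *m P =
   map_mx (dframe i) (map_mx (dframe j) P) - map_mx (dframe j) (map_mx (dframe i) P)
   + P *m (\sum_l tau conn i j l *: Gframe l).
  rewrite bracket_mx mulmx_suml mulmx_sumr -big_split; apply: eq_bigr => l _ /=.
  by rewrite -scalemxAl -scalemxAr -scalerDr -nabla_frame_frame.
rewrite F F' !mulmxBl !mulmxBr !E T.
set A := map_mx (dframe i) (map_mx (dframe j) P); set B := map_mx (dframe j) (map_mx (dframe i) P).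
move: (map_mx (dframe i) P *m Gframe j) (map_mx (dframe j) P *m Gframe i) => C D.
move: (P *m _) (P *m _) (P *m _) => U V Z.
apply/matrixP => q r; rewrite !(mxDE, mxNE); ring.
Qed.

Let al i : 'rV[K]_k := row i eps *m G - (row i eps *m G *m xi^T) *m xi *m G.

Lemma alE i : al i = \sum_l e i l *: a_ l.
Proof.
have E : row i eps = \sum_l e i l *: row l J.
  by rewrite /eps row_mul mulmx_sum_row; apply: eq_bigr => l _; rewrite mxE.
rewrite /al E !mulmx_suml -sumrB; apply: eq_bigr => l _.
by rewrite /a_ scalerBr -!scalemxAl.
Qed.

(** Curvature is tensorial; the derivatives of the coefficients [e] of the frame
cancel against the bracket. *)
Lemma curv_ambient i j :
  curv dframe conn Gframe i j = \sum_q \sum_r (e i q * e j r) *: amb_curv q r.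
Proof.
have E a b : map_mx (dframe a) (Gframe b) = \sum_q dframe a (e b q) *: Gt q
   + \sum_q \sum_r (e a q * e b r) *: map_mx (d q) (Gt r).
  rewrite [X in _ = _ + X]exchange_big /Gframe map_der_sum -big_split.
  apply: eq_bigr => q _ /=; rewrite map_der_scale; congr (_ + _).
  rewrite [map_mx _ _]map_der_comb scaler_sumr; apply: eq_bigr => r _.
  by rewrite scalerA mulrC.
have M a b : Gframe b *m Gframe a = \sum_q \sum_r (e a q * e b r) *: (Gt r *m Gt q).
  rewrite exchange_big /Gframe mulmx_suml; apply: eq_bigr => r _ /=.
  rewrite mulmx_sumr; apply: eq_bigr => q _.
  by rewrite -scalemxAl -scalemxAr scalerA mulrC.
have T : \sum_l tau conn i j l *: Gframe l = \sum_q bracket_coord i j 0 q *: Gt q.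
  under [RHS]eq_bigr do rewrite bracket_coordE scaler_suml.
  rewrite [RHS]exchange_big; apply: eq_bigr => l _ /=.
  by rewrite /Gframe scaler_sumr; apply: eq_bigr => q _; rewrite scalerA.
have S (F : 'I_m -> 'I_m -> 'M[K]_k) : \sum_q \sum_r (e j q * e i r) *: F r q =
    \sum_q \sum_r (e i q * e j r) *: F q r.
  rewrite exchange_big; apply: eq_bigr => q _; apply: eq_bigr => r _ /=.
  by rewrite mulrC.
rewrite /curv !E !M T (S (fun q r => map_mx (d r) (Gt q))).
rewrite (S (fun q r => Gt q *m Gt r)).
have -> : \sum_q bracket_coord i j 0 q *: Gt q = \sum_q dframe i (e j q) *: Gt q
    - \sum_q dframe j (e i q) *: Gt q.
  by rewrite -sumrB; apply: eq_bigr => q _; rewrite /bracket_coord mxDE mxNE !mxE scalerBl.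
have -> : \sum_q \sum_r (e i q * e j r) *: amb_curv q r =
   \sum_q \sum_r (e i q * e j r) *: map_mx (d q) (Gt r)
   - \sum_q \sum_r (e i q * e j r) *: map_mx (d r) (Gt q)
   + \sum_q \sum_r (e i q * e j r) *: (Gt r *m Gt q)
   - \sum_q \sum_r (e i q * e j r) *: (Gt q *m Gt r).
  rewrite -!sumrB -big_split -sumrB; apply: eq_bigr => q _ /=.
  rewrite -!sumrB -big_split -sumrB; apply: eq_bigr => r _ /=.
  by rewrite /amb_curv !(scalerBr, scalerDr).
move: (\sum_q \sum_r _) (\sum_q \sum_r _) (\sum_q \sum_r _) (\sum_q \sum_r _).
move=> A1 A2 A3 A4; move: (\sum_q _) (\sum_q _) => B C.
apply/matrixP => q r; rewrite !(mxDE, mxNE); ring.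
Qed.

Lemma curv_ambientG i j :
  curv dframe conn Gframe i j *m G = c *: ((al j)^T *m al i - (al i)^T *m al j).
Proof.
rewrite curv_ambient mulmx_suml.
have S a b : (al b)^T *m al a = \sum_q \sum_r (e a q * e b r) *: ((a_ r)^T *m a_ q).
  rewrite exchange_big !alE [(\sum_l _)^T]raddf_sum mulmx_suml; apply: eq_bigr => r _ /=.
  rewrite mulmx_sumr; apply: eq_bigr => q _.
  have -> : (e b r *: a_ r)^T = e b r *: (a_ r)^T by exact: linearZ.
  by rewrite -scalemxAl -scalemxAr scalerA mulrC.
rewrite !S [X in _ - X]exchange_big -sumrB scaler_sumr; apply: eq_bigr => q _ /=.
rewrite mulmx_suml -sumrB scaler_sumr; apply: eq_bigr => r _.
rewrite -scalemxAl amb_curvE scalerA [_ * c]mulrC -[LHS]scalerA; congr (c *: _).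
by rewrite [LHS]scalerBr [e j r * _]mulrC.
Qed.

Definition xi_coord : 'rV[K]_(m + p) := xi *m G *m P^T.

(* the projection of the i-th tangent field orthogonally to xi, in the frame *)
Let be i : 'rV[K]_(m + p) := row (lshift p i) 1%:M - xi_coord 0 (lshift p i) *: xi_coord.

(** The source of the equations of Gauss, Codazzi and Ricci, which are its
tangent, mixed and normal blocks. *)
Lemma curvature_equation i j :
  curv dframe conn frame_conn i j = c *: ((be j)^T *m be i - (be i)^T *m be j).
Proof.
have alP a : al a *m P^T = be a.
  rewrite /al /be mulmxBl; congr (_ - _).
    have -> : row a eps = row (lshift p a) P by rewrite /frame rowKu.
    by rewrite -!row_mul frame_orth.
  have -> : row a eps *m G *m xi^T = (xi_coord 0 (lshift p a))%:M.
    rewrite [LHS]mx11_scalar; congr (_%:M).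
    have -> : row a eps = row (lshift p a) P by rewrite /frame rowKu.
    have T (A : 'M[K]_1) : A 0 0 = A^T 0 0 by rewrite mxE.
    rewrite T !trmx_mul trmxK G_sym mulmxA tr_row.
    rewrite /xi_coord [LHS]mxE [RHS]mxE; apply: eq_bigr => q _; congr (_ * _).
    by rewrite [LHS]mxE.
  by rewrite mul_scalar_mx -!scalemxAl.
rewrite -[LHS]mulmx1 -frame_orth !mulmxA curv_frame -[P *m _ *m G]mulmxA curv_ambientG.
rewrite -scalemxAr -scalemxAl mulmxBr mulmxBl -!alP !trmx_mul !trmxK.
by rewrite !mulmxA.
Qed.

(** Its two blocks are nabla_X T = A_N X and nabla^perp_X N = - sigma(X, T). *)
Lemma xi_coord_parallel i : map_mx (dframe i) xi_coord = - (xi_coord *m frame_conn i).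
Proof.
have z : nabla_frame i xi = 0 by rewrite nabla_frameE big1 // => l _; rewrite xi_parallel scaler0.
rewrite /xi_coord dframe_pairing z !mul0mx add0r nabla_frame_frame trmx_mul frame_conn_skew.
by rewrite mulmxN mulmxN mulmxA.
Qed.

Definition xi_tan : 'cV[K]_m := (lsubmx xi_coord)^T.
Definition xi_nor : 'cV[K]_p := (rsubmx xi_coord)^T.

Lemma frame_conn_ll i j l : frame_conn i (lshift p j) (lshift p l) = conn i j l.
Proof. by rewrite frame_conn_block block_mxEul. Qed.
Lemma frame_conn_lr i j a : frame_conn i (lshift p j) (rshift m a) = shape a i j.
Proof. by rewrite frame_conn_block block_mxEur /shape mxE. Qed.
Lemma frame_conn_rl i j a : frame_conn i (rshift m a) (lshift p j) = - shape a i j.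
Proof. by rewrite frame_conn_block block_mxEdl /shape !mxE. Qed.
Lemma frame_conn_rr i a b : frame_conn i (rshift m a) (rshift m b) = nconn i a b.
Proof. by rewrite frame_conn_block block_mxEdr. Qed.

Lemma xi_tanE j : xi_coord 0 (lshift p j) = xi_tan j 0.
Proof. by rewrite /xi_tan !mxE. Qed.
Lemma xi_norE a : xi_coord 0 (rshift m a) = xi_nor a 0.
Proof. by rewrite /xi_nor !mxE. Qed.

Lemma der_xi_coord i q : dframe i (xi_coord 0 q) = \sum_r frame_conn i q r * xi_coord 0 r.
Proof.
have /matrixP/(_ 0 q) := xi_coord_parallel i; rewrite mxE => ->.
rewrite mxNE mxE -sumrN; apply: eq_bigr => r _.
have /matrixP/(_ r q) := frame_conn_skew i; rewrite mxNE mxE => ->.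
by rewrite mulNr mulrC.
Qed.

Lemma der_xi_tan i j : dframe i (xi_tan j 0) =
  \sum_l conn i j l * xi_tan l 0 + \sum_b xi_nor b 0 * shape b i j.
Proof.
rewrite -xi_tanE der_xi_coord big_split_ord; congr (_ + _).
  by apply: eq_bigr => l _; rewrite frame_conn_ll xi_tanE.
by apply: eq_bigr => b _; rewrite frame_conn_lr xi_norE mulrC.
Qed.

Lemma der_xi_nor i a : dframe i (xi_nor a 0) =
  \sum_b nconn i a b * xi_nor b 0 - \sum_l shape a i l * xi_tan l 0.
Proof.
rewrite -xi_norE der_xi_coord big_split_ord -sumrN [RHS]addrC; congr (_ + _).
  by apply: eq_bigr => l _; rewrite frame_conn_rl xi_tanE mulNr.
by apply: eq_bigr => b _; rewrite frame_conn_rr xi_norE.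
Qed.

Lemma shape_sym_entry a i j : shape a i j = shape a j i.
Proof. by rewrite -[in LHS]shape_sym mxE. Qed.

Lemma curv_entry q (v : 'I_m -> 'M[K]_q) i j a b : curv dframe conn v i j a b =
  dframe i (v j a b) - dframe j (v i a b) + \sum_r v j a r * v i r b - \sum_r v i a r * v j r b
  - \sum_l tau conn i j l * v l a b.
Proof.
rewrite /curv !(mxDE, mxNE) summxE; congr (_ - _ + _ - _ - _); rewrite ?mxE //.
by apply: eq_bigr => l _; rewrite mxE.
Qed.

Let u : 'M[K]_m := 1%:M - xi_tan *m xi_tan^T.

Lemma be_l i j : be i 0 (lshift p j) = u i j.
Proof.
have D : row (lshift p i) (1%:M : 'M[K]_(m + p)) 0 (lshift p j) = (1%:M : 'M[K]_m) i j.
  by rewrite !mxE (inj_eq (@lshift_inj m p)).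
have Z : (xi_coord 0 (lshift p i) *: xi_coord) 0 (lshift p j) = xi_tan i 0 * xi_tan j 0.
  by rewrite mxE !xi_tanE.
have U : (xi_tan *m xi_tan^T) i j = xi_tan i 0 * xi_tan j 0.
  by rewrite mxE big_ord1 [in X in _ * X]mxE.
by rewrite /be /u mxDE mxNE D Z mxDE mxNE U.
Qed.

Lemma be_r i a : be i 0 (rshift m a) = - (xi_tan i 0 * xi_nor a 0).
Proof.
have D : row (lshift p i) (1%:M : 'M[K]_(m + p)) 0 (rshift m a) = 0.
  by rewrite !mxE eq_lrshift.
have Z : (xi_coord 0 (lshift p i) *: xi_coord) 0 (rshift m a) = xi_tan i 0 * xi_nor a 0.
  by rewrite mxE xi_tanE xi_norE.
by rewrite /be mxDE mxNE D Z add0r.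
Qed.

Lemma frame_curvature_entry i j q r :
  curv dframe conn frame_conn i j q r = c * (be j 0 q * be i 0 r - be i 0 q * be j 0 r).
Proof.
have O a b : ((be a)^T *m be b) q r = be a 0 q * be b 0 r.
  by rewrite mxE big_ord1 [_^T _ _]mxE.
by rewrite curvature_equation [LHS]mxE mxDE mxNE !O.
Qed.

Lemma frame_conn_mul_ll i j q r : \sum_s frame_conn j (lshift p q) s * frame_conn i s (lshift p r) =
  \sum_l conn j q l * conn i l r - \sum_b shape b j q * shape b i r.
Proof.
rewrite big_split_ord -sumrN; congr (_ + _); apply: eq_bigr => s _.
  by rewrite !frame_conn_ll.
by rewrite frame_conn_lr frame_conn_rl mulrN.
Qed.

Lemma frame_conn_mul_lr i j q a : \sum_s frame_conn j (lshift p q) s * frame_conn i s (rshift m a) =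
  \sum_l conn j q l * shape a i l + \sum_b shape b j q * nconn i b a.
Proof.
rewrite big_split_ord; congr (_ + _); apply: eq_bigr => s _.
  by rewrite frame_conn_ll frame_conn_lr.
by rewrite frame_conn_lr frame_conn_rr.
Qed.

Lemma frame_conn_mul_rr i j a b : \sum_s frame_conn j (rshift m a) s * frame_conn i s (rshift m b) =
  - \sum_l shape a j l * shape b i l + \sum_e nconn j a e * nconn i e b.
Proof.
rewrite big_split_ord -sumrN; congr (_ + _); apply: eq_bigr => s _.
  by rewrite frame_conn_rl frame_conn_lr mulNr.
by rewrite !frame_conn_rr.
Qed.

(** The skew off-diagonal blocks of the connection matrix contribute the quadratic
terms in the second fundamental form. *)
Lemma gauss i j : curv dframe conn conn i j = c *: rot u i j + \sum_b rot (shape b) i j.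
Proof.
apply/matrixP => q r; have := frame_curvature_entry i j (lshift p q) (lshift p r).
rewrite curv_entry !frame_conn_mul_ll !be_l !frame_conn_ll.
under [X in _ - X = _]eq_bigr do rewrite frame_conn_ll.
move=> E; rewrite [RHS]mxDE mxZE [rot u i j q r]mxE -E.
rewrite curv_entry summxE.
under [X in _ = _ + X]eq_bigr do rewrite mxE.
rewrite sumrB; ring.
Qed.

(** The ambient term vanishes in the normal block: the projections of both
arguments have normal components proportional to those of xi. *)
Lemma ricci i j :
  curv dframe conn nconn i j = \matrix_(a, b) ((shape a *m shape b) j i - (shape a *m shape b) i j).
Proof.
apply/matrixP => a b; have := frame_curvature_entry i j (rshift m a) (rshift m b).
rewrite curv_entry !frame_conn_mul_rr !be_r !frame_conn_rr.
under [X in _ - X = _]eq_bigr do rewrite frame_conn_rr.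
move=> E; rewrite curv_entry [RHS]mxE ![(shape a *m shape b) _ _]mxE.
have S x y : \sum_l shape a x l * shape b l y = \sum_l shape a x l * shape b y l.
  by apply: eq_bigr => l _; rewrite (shape_sym_entry b l).
rewrite !S; apply/eqP; rewrite -subr_eq0; apply/eqP.
transitivity (c * (- (xi_tan j 0 * xi_nor a 0) * - (xi_tan i 0 * xi_nor b 0) -
        - (xi_tan i 0 * xi_nor a 0) * - (xi_tan j 0 * xi_nor b 0))); last by ring.
rewrite -E; ring.
Qed.

(** The quadratic terms of the mixed block complete the frame derivatives to
covariant ones, and the bracket compensates the connection of the direction. *)
Lemma codazzi i j q a : cov dframe conn nconn i shape a j q - cov dframe conn nconn j shape a i q =
  c * ((i == q)%:R * xi_tan j 0 - (j == q)%:R * xi_tan i 0) * xi_nor a 0.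
Proof.
have := frame_curvature_entry i j (lshift p q) (rshift m a).
rewrite curv_entry !frame_conn_mul_lr !be_l !be_r !frame_conn_lr.
under [X in _ - X = _]eq_bigr do rewrite frame_conn_lr /tau mulrBl.
have uE x y : u x y = (x == y)%:R - xi_tan x 0 * xi_tan y 0.
  by rewrite /u mxDE mxNE !mxE big_ord1 !mxE.
rewrite sumrB !uE !cov_entry => E.
have W x y : \sum_l shape a x l * conn y l q = - \sum_l conn y q l * shape a x l.
  rewrite -sumrN; apply: eq_bigr => l _.
  by rewrite (skew_entry conn_skew y l q) mulrN mulrC.
have T x y z : \sum_b shape b x z * nconn y b a = - \sum_b nconn y a b * shape b x z.
  rewrite -sumrN; apply: eq_bigr => b _.
  have -> : nconn y b a = - nconn y a b.
    by have /matrixP/(_ a b) := nconn_skew y; rewrite mxNE mxE.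
  by rewrite mulrN mulrC.
rewrite !T in E; rewrite !W.
transitivity (c * (((j == q)%:R - xi_tan j 0 * xi_tan q 0) * - (xi_tan i 0 * xi_nor a 0) -
        ((i == q)%:R - xi_tan i 0 * xi_tan q 0) * - (xi_tan j 0 * xi_nor a 0))); last by ring.
rewrite -E; ring.
Qed.

(** The shape operator of the normal part N of xi. *)
Definition nu_shape : 'M[K]_m := \sum_b xi_nor b 0 *: shape b.

Theorem simons_moving_frame
    (pmc : forall i a, dframe i (\tr (shape a)) = \sum_b nconn i a b * \tr (shape b)) :
  let S := pairing shape shape in
  let P := xi_tan *m xi_tan^T in
  \sum_i (dframe i (dframe i S) - \sum_l conn i i l * dframe l S) =
  2 * (\sum_i pairing (cov dframe conn nconn i shape) (cov dframe conn nconn i shape)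
   + c * ((m%:R - \tr P) * S - 2 * m%:R * (\sum_a \tr (P *m shape a *m shape a))
          + 3 * (\sum_a \tr (P *m shape a) * \tr (shape a)) + m%:R * \tr (nu_shape *m nu_shape)
          - \tr nu_shape ^+ 2 - \sum_a \tr (shape a) ^+ 2)
   + \sum_a \sum_b (\tr (shape b) * \tr (shape a *m shape a *m shape b)
      + \tr ((shape a *m shape b - shape b *m shape a) *m (shape a *m shape b - shape b *m shape a))
      - \tr (shape a *m shape b) ^+ 2)).
Proof.
apply: simons_identity.
- exact: nconn_skew.
- exact: bracket.
- exact: conn_skew.
- exact: shape_sym.
- by move=> i; rewrite der_combE big1 // => l _; rewrite c_const mulr0.
- exact: der_xi_tan.
- exact: der_xi_nor.
- exact: codazzi.
- exact: gauss.
- exact: ricci.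
- exact: pmc.
Qed.

(** * Coordinate operators in the adapted frame *)

Variables (half minv : K).
Hypothesis halfE : half * 2 = 1.
Hypothesis minvE : minv * m%:R = 1.

Definition gram_inv : 'M[K]_m := e^T *m e.
Definition lc_gram l : 'M[K]_m := lc d gram gram_inv half l.

Lemma gram_sym : gram^T = gram.
Proof. by rewrite /gram !trmx_mul trmxK G_sym mulmxA. Qed.

(** The tangent part of the ambient derivative is the Levi-Civita connection of the
induced metric, since it satisfies the Koszul formula: S below is symmetric in
its first two indices and symmetrizes to the derivative of the metric. *)
Lemma lc_gram_lower l : lc_gram l *m gram = nabla_dir l J *m G *m J^T.
Proof.
pose S a := nabla_dir a J *m G *m J^T.
have Ssym a b q : S a b q = S b a q.
  have E x y z : S x y z = (row y (nabla_dir x J) *m G *m J^T) 0 z.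
    by rewrite /S -!row_mul [RHS]mxE.
  by rewrite !E torsion_free.
have dg a : map_mx (d a) gram = S a + (S a)^T.
  rewrite /gram !map_der_mul metric_compat -map_trmx /S /nabla_dir.
  have trD (A B : 'M[K]_(m, k)) : (A + B)^T = A^T + B^T by exact: linearD.
  rewrite !trmx_mul !trmxK trD !trmx_mul G_sym !(mulmxDl, mulmxDr) !mulmxA.
  move: (map_mx (d a) J *m G *m J^T) (J *m Gt a *m G *m J^T).
  move: (J *m G *m (Gt a)^T *m J^T) (J *m G *m (map_mx (d a) J)^T) => A B C D.
  by rewrite -!addrA [A + B]addrC.
rewrite /lc_gram (lc_lower d half gram_sym e_completeT).
apply/matrixP => a b; rewrite mxE -/(S l).
have dgE x y z : d x (gram y z) = S x y z + S x z y.
  by have /matrixP/(_ y z) := dg x; rewrite mxDE !mxE.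
rewrite !dgE (Ssym b l a) (Ssym b a l) (Ssym a l b).
transitivity (half * 2 * S l a b); last by rewrite halfE mul1r.
ring.
Qed.

(** The operators of an isometric immersion read in charts, with elements of K in
place of functions and rows over K in place of vector fields. *)
Definition nablabarK q (A : 'rV[K]_m) (V : 'M[K]_(q, k)) := \sum_l A 0 l *: nabla_dir l V.
Definition nablaK (A Y : 'rV[K]_m) : 'rV[K]_m :=
  \sum_l A 0 l *: (map_mx (d l) Y + Y *m lc_gram l).
Definition tangentK (v : 'rV[K]_k) : 'rV[K]_m := v *m G *m J^T *m gram_inv.
Definition normalK (v : 'rV[K]_k) : 'rV[K]_k := v - tangentK v *m J.
Definition sffK (A Y : 'rV[K]_m) : 'rV[K]_k := nablabarK A (Y *m J) - nablaK A Y *m J.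
Definition shape_opK (v : 'rV[K]_k) (A : 'rV[K]_m) : 'rV[K]_m := - tangentK (nablabarK A v).
Definition shape_mxK (v : 'rV[K]_k) : 'M[K]_m :=
  \matrix_(i, j) shape_opK v (delta_mx 0 j) 0 i.
Definition meanK : 'rV[K]_k :=
  minv *: \sum_i \sum_j gram_inv i j *: sffK (delta_mx 0 i) (delta_mx 0 j).
Definition dsffK (A Y Z : 'rV[K]_m) : 'rV[K]_k :=
  normalK (nablabarK A (sffK Y Z)) - sffK (nablaK A Y) Z - sffK Y (nablaK A Z).
Definition lapK (f : K) : K :=
  \sum_i \sum_j gram_inv i j * (d i (d j f) - \sum_q lc_gram i j q * d q f).
Definition shape_sqK (v : 'rV[K]_k) : K := \tr (shape_mxK v *m shape_mxK v).

Definition frame_coord (A : 'rV[K]_m) : 'rV[K]_m := A *m gram *m e^T.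

Lemma frame_coordK A : frame_coord A *m e = A.
Proof. by rewrite /frame_coord -!(mulmxA A) e_complete mulmx1. Qed.

Lemma frame_coord_e A : frame_coord (A *m e) = A.
Proof. by rewrite /frame_coord -!(mulmxA A) e_orth mulmx1. Qed.

(** The derivative is linear over K in the direction, which may be expanded in
the frame. *)
Lemma nablabarK_frame q A (V : 'M[K]_(q, k)) : nablabarK A V =
  \sum_i frame_coord A 0 i *: nabla_frame i V.
Proof.
rewrite /nablabarK -{1}(frame_coordK A).
under [RHS]eq_bigr do rewrite nabla_frameE scaler_sumr.
rewrite [RHS]exchange_big; apply: eq_bigr => l _ /=.
rewrite mxE scaler_suml; apply: eq_bigr => i _.
by rewrite scalerA.
Qed.

Lemma nablabarK_row q i (V : 'M[K]_(q, k)) : nablabarK (row i e) V = nabla_frame i V.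
Proof. by rewrite nabla_frameE; apply: eq_bigr => l _; rewrite mxE. Qed.

Lemma tangentKE v : tangentK v = v *m G *m eps^T *m e.
Proof. by rewrite /tangentK /gram_inv /eps trmx_mul !mulmxA. Qed.

Lemma frame_split q (v : 'M[K]_(q, k)) :
  v = v *m G *m eps^T *m eps + v *m G *m nu^T *m nu.
Proof.
rewrite -{1}[v]mulmx1 -frame_dual /frame tr_col_mx -/eps mulmxA mul_mx_row mul_mx_row.
by rewrite mul_row_col !mulmxA.
Qed.

Lemma normalKE v : normalK v = v *m G *m nu^T *m nu.
Proof. by rewrite /normalK tangentKE {1}(frame_split v) -(mulmxA _ e J) addrAC subrr add0r. Qed.

Lemma nabla_dir_mul q l (Y : 'M[K]_(q, m)) : nabla_dir l (Y *m J) =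
  map_mx (d l) Y *m J + Y *m nabla_dir l J.
Proof. by rewrite /nabla_dir map_der_mul mulmxDr !mulmxA addrA. Qed.

Lemma lc_gram_J l : lc_gram l *m J = nabla_dir l J *m G *m eps^T *m eps.
Proof.
rewrite [X in _ *m X = _]J_eps (mulmxA _ (gram *m e^T)) (mulmxA _ gram) lc_gram_lower.
by rewrite /eps trmx_mul !mulmxA.
Qed.

(** The tangent part of the ambient derivative cancels against the connection of
the induced metric, leaving the normal part. *)
Lemma sffK_nb A Y : sffK A Y = \sum_l A 0 l *: (Y *m (nabla_dir l J *m G *m nu^T) *m nu).
Proof.
rewrite /sffK /nablabarK /nablaK mulmx_suml -sumrB; apply: eq_bigr => l _.
rewrite -scalemxAl -scalerBr nabla_dir_mul mulmxDl -(mulmxA Y (lc_gram l)) lc_gram_J.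
rewrite {1}(frame_split (nabla_dir l J)) mulmxDr; congr (_ *: _).
rewrite opprD addrACA subrr add0r addrAC subrr add0r.
by rewrite !mulmxA.
Qed.

Lemma sff_frame_e i : sff_frame i = e *m \sum_l e i l *: (nabla_dir l J *m G *m nu^T).
Proof.
have -> : \sum_l e i l *: (nabla_dir l J *m G *m nu^T) = nabla_frame i J *m G *m nu^T.
  by rewrite nabla_frameE !mulmx_suml; apply: eq_bigr => l _; rewrite -!scalemxAl.
rewrite sff_frameE; have -> : nabla_frame i eps = map_mx (dframe i) e *m J + e *m nabla_frame i J.
  by rewrite /nabla_frame /eps map_der_mul mulmxDr !mulmxA addrA.
rewrite (mulmxDl _ _ G) (mulmxDl _ _ nu^T) -(mulmxA _ J) -(mulmxA _ (J *m G)) J_nu.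
by rewrite mulmx0 add0r !mulmxA.
Qed.

Lemma sffKE A Y : sffK A Y = \sum_i frame_coord A 0 i *: (frame_coord Y *m sff_frame i *m nu).
Proof.
rewrite sffK_nb -{1}(frame_coordK A).
under [RHS]eq_bigr do rewrite sff_frame_e mulmxA frame_coordK mulmx_sumr mulmx_suml scaler_sumr.
rewrite [RHS]exchange_big; apply: eq_bigr => l _ /=.
rewrite mxE scaler_suml; apply: eq_bigr => i _.
by rewrite -scalemxAr -scalemxAl scalerA.
Qed.

Lemma frame_coord_row i : frame_coord (row i e) = row i 1%:M.
Proof. by rewrite rowE frame_coord_e rowE mulmx1. Qed.

Lemma sum_row1 (V : lmodType K) (Z : 'I_m -> V) i :
  \sum_j (row i (1%:M : 'M[K]_m)) 0 j *: Z j = Z i.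
Proof.
rewrite (bigD1 i) //= big1 ?addr0 => [|j ji].
  by rewrite !mxE eqxx scale1r.
by rewrite !mxE eq_sym (negPf ji) scale0r.
Qed.

Lemma sffK_row i j : sffK (row i e) (row j e) = row j (sff_frame i) *m nu.
Proof. by rewrite sffKE !frame_coord_row sum_row1 -row_mul mul1mx. Qed.

Lemma nabla_frame_nu_tan i : nabla_frame i nu *m G *m eps^T = - (sff_frame i)^T.
Proof.
rewrite -[LHS](block_mxKdl (nabla_frame i eps *m G *m eps^T)
  (nabla_frame i eps *m G *m nu^T) _ (nabla_frame i nu *m G *m nu^T)).
by rewrite -frame_conn_parts frame_conn_block block_mxKdl.
Qed.

Definition shape_comb (v : 'rV[K]_p) : 'M[K]_m := \sum_a v 0 a *: shape a.

Lemma shape_opKE (v : 'rV[K]_p) A : shape_opK (v *m nu) A = frame_coord A *m shape_comb v *m e.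
Proof.
rewrite /shape_opK nablabarK_frame tangentKE !mulmx_suml -sumrN.
rewrite [frame_coord A *m shape_comb v]mulmx_sum_row mulmx_suml; apply: eq_bigr => i _.
rewrite -!scalemxAl -scalerN; congr (_ *: _); rewrite -mulNmx; congr (_ *m e).
have -> : nabla_frame i (v *m nu) = map_mx (dframe i) v *m nu + v *m nabla_frame i nu.
  by rewrite /nabla_frame map_der_mul mulmxDr !mulmxA addrA.
rewrite (mulmxDl _ _ G) (mulmxDl _ _ eps^T) -(mulmxA _ nu) -(mulmxA _ (nu *m G)) nu_eps.
rewrite mulmx0 add0r -(mulmxA v) -(mulmxA v) nabla_frame_nu_tan mulmxN opprK.
apply/rowP => q; rewrite !mxE summxE; apply: eq_bigr => a _.
by rewrite [(sff_frame i)^T _ _]mxE [(_ *: shape a) _ _]mxE [shape a _ _]mxE.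
Qed.

Lemma gramE : gram = J *m G *m J^T. Proof. by []. Qed.
Local Opaque gram.

(** Matrix in coordinates, acting on columns, of the endomorphism which is
represented by the symmetric matrix M in the frame. *)
Definition frame_conj (M : 'M[K]_m) : 'M[K]_m := e^T *m M *m e *m gram.

Lemma frame_conjM M N : frame_conj M *m frame_conj N = frame_conj (M *m N).
Proof.
rewrite /frame_conj; move: (gram) e_orth => gg eo.
by rewrite !mulmxA -2!(mulmxA (e^T *m M)) eo mulmx1.
Qed.

Lemma frame_conjB M N : frame_conj (M - N) = frame_conj M - frame_conj N.
Proof. by rewrite /frame_conj mulmxBr !mulmxBl. Qed.

Lemma tr_frame_conj M : \tr (frame_conj M) = \tr M.
Proof. by rewrite /frame_conj -(mulmxA e^T) -mulmxA mxtrace_mulC -!(mulmxA M) e_orth mulmx1. Qed.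

Lemma shape_mxKE v : shape_mxK (v *m nu) = frame_conj (shape_comb v).
Proof.
have hs_sym : (shape_comb v)^T = shape_comb v.
  rewrite /shape_comb [LHS]raddf_sum; apply: eq_bigr => a _ /=.
  by rewrite linearZ /= shape_sym.
apply/matrixP => i j; rewrite mxE shape_opKE /frame_coord.
have -> : frame_conj (shape_comb v) = (gram *m e^T *m shape_comb v *m e)^T.
  rewrite (trmx_mul _ e) (trmx_mul _ (shape_comb v)) (trmx_mul _ e^T) trmxK.
  by rewrite hs_sym gram_sym (mulmxA e^T) (mulmxA _ e).
by rewrite [RHS]mxE -!(mulmxA (delta_mx _ _)) -rowE [LHS]mxE.
Qed.

Lemma shape_mxK_row a : shape_mxK (row a nu) = frame_conj (shape a).
Proof.
rewrite rowE shape_mxKE /shape_comb; congr frame_conj.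
rewrite (bigD1 a) //= big1 ?addr0 => [|b ba]; first by rewrite mxE !eqxx scale1r.
by rewrite mxE eqxx (negPf ba) scale0r.
Qed.

Lemma shape_opK_row a A : shape_opK (row a nu) A = frame_coord A *m shape a *m e.
Proof.
rewrite rowE shape_opKE /shape_comb; congr (_ *m _ *m _).
rewrite (bigD1 a) //= big1 ?addr0 => [|b ba]; first by rewrite mxE !eqxx scale1r.
by rewrite mxE eqxx (negPf ba) scale0r.
Qed.

Lemma tangentK_xi : tangentK xi = xi_tan^T *m e.
Proof.
rewrite tangentKE; congr (_ *m e); rewrite /xi_tan trmxK /xi_coord /frame tr_col_mx mul_mx_row.
by rewrite row_mxKl.
Qed.

Lemma normalK_xi : normalK xi = xi_nor^T *m nu.
Proof.
rewrite normalKE; congr (_ *m nu); rewrite /xi_nor trmxK /xi_coord /frame tr_col_mx mul_mx_row.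
by rewrite row_mxKr.
Qed.

Definition shape_trace : 'rV[K]_p := \row_a \tr (shape a).

(** The trace with respect to the metric is the trace over the orthonormal
frame. *)
Lemma meanKE : meanK = minv *: (shape_trace *m nu).
Proof.
rewrite /meanK; congr (_ *: _).
have E i j : sffK (delta_mx 0 i) (delta_mx 0 j) =
   \sum_q \sum_r ((gram *m e^T) i q * (gram *m e^T) j r) *: (row r (sff_frame q) *m nu).
  have D l q : frame_coord (delta_mx 0 l) 0 q = (gram *m e^T) l q.
    by rewrite /frame_coord -mulmxA -rowE mxE.
  rewrite sffKE; apply: eq_bigr => q _; rewrite D -mulmxA mulmx_sum_row scaler_sumr.
  by apply: eq_bigr => r _; rewrite D scalerA row_mul.
under eq_bigr do under eq_bigr do rewrite E scaler_sumr.
under eq_bigr do rewrite exchange_big.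
rewrite exchange_big /=.
have gg q r : \sum_i \sum_j gram_inv i j * ((gram *m e^T) i q * (gram *m e^T) j r) = (q == r)%:R.
  have -> : (q == r)%:R = ((gram *m e^T)^T *m gram_inv *m (gram *m e^T)) q r.
    rewrite (trmx_mul gram) trmxK gram_sym /gram_inv (mulmxA (e *m gram)) e_orth mul1mx mulmxA.
    by rewrite e_orth mxE.
  rewrite mxE exchange_big; apply: eq_bigr => j _ /=.
  rewrite [X in _ = X * _]mxE mulr_suml; apply: eq_bigr => i _.
  by rewrite [(_^T) _ _]mxE mulrA mulrAC mulrC -mulrA [gram_inv i j * _]mulrC; ring.
transitivity (\sum_q row q (sff_frame q) *m nu).
  apply: eq_bigr => q _; under eq_bigr do under eq_bigr do rewrite scaler_sumr.
  under eq_bigr do rewrite exchange_big.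
  rewrite exchange_big (bigD1 q) //= [X in _ + X]big1 ?addr0 => [|r rq].
    under eq_bigr do under eq_bigr do rewrite scalerA.
    under eq_bigr do rewrite -scaler_suml.
    by rewrite -scaler_suml gg eqxx scale1r.
  under eq_bigr do under eq_bigr do rewrite scalerA.
  under eq_bigr do rewrite -scaler_suml.
  by rewrite -scaler_suml gg eq_sym (negPf rq) scale0r.
rewrite -mulmx_suml; congr (_ *m nu); apply/rowP => a.
rewrite summxE mxE /mxtrace; apply: eq_bigr => q _.
by rewrite !mxE.
Qed.

Lemma sffK_comp A Y : sffK A Y = (\row_a (frame_coord A *m shape a *m (frame_coord Y)^T) 0 0) *m nu.
Proof.
rewrite sffKE; under eq_bigr do rewrite scalemxAl.
rewrite -mulmx_suml; congr (_ *m nu); apply/rowP => a.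
rewrite summxE [RHS]mxE mxE.
under [RHS]eq_bigr do rewrite mxE mulr_suml.
rewrite exchange_big; apply: eq_bigr => i _ /=.
rewrite mxZE [X in _ * X = _]mxE mulr_sumr; apply: eq_bigr => j _.
by rewrite [shape a i j]mxE [(_^T) _ _]mxE; ring.
Qed.

Lemma normalK_nabla_frame i (v : 'rV[K]_p) :
  normalK (nabla_frame i (v *m nu)) = (map_mx (dframe i) v + v *m nconn i) *m nu.
Proof.
have -> : nabla_frame i (v *m nu) = map_mx (dframe i) v *m nu + v *m nabla_frame i nu.
  by rewrite /nabla_frame map_der_mul mulmxDr !mulmxA addrA.
rewrite normalKE; congr (_ *m nu); rewrite nconnE.
rewrite (mulmxDl _ _ G) (mulmxDl _ _ nu^T) -(mulmxA _ nu) -(mulmxA _ (nu *m G)) nu_orth.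
by rewrite mulmx1 !(mulmxA v).
Qed.

(** Both have the same image under the differential, the tangent part of the
ambient derivative. *)
Lemma nablaK_row i j : nablaK (row i e) (row j e) = row j (conn i) *m e.
Proof.
rewrite -[LHS]frame_coordK; congr (_ *m e).
have -> : frame_coord (nablaK (row i e) (row j e)) =
   nablaK (row i e) (row j e) *m J *m G *m eps^T.
  by rewrite /frame_coord /eps trmx_mul gramE !mulmxA.
have -> : nablaK (row i e) (row j e) *m J = nablabarK (row i e) (row j e *m J)
    - sffK (row i e) (row j e) by rewrite /sffK opprB addrC subrK.
rewrite sffK_row nablabarK_row -row_mul (mulmxDl _ _ G) (mulmxDl _ _ eps^T) !mulNmx.
rewrite -(mulmxA _ nu) -(mulmxA _ (nu *m G)) nu_eps mulmx0 subr0 connE !row_mul.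
congr (_ *m G *m eps^T).
have rD (A B : 'M[K]_(m, k)) : row j (A + B) = row j A + row j B by exact: linearD.
by rewrite /nabla_frame -(row_mul j e J) map_row rD (row_mul j (e *m J) (Gframe i)).
Qed.

Lemma dsffK_row i j l : dsffK (row i e) (row j e) (row l e) =
  (\row_a cov dframe conn nconn i shape a j l) *m nu.
Proof.
rewrite /dsffK !nablaK_row sffK_row nablabarK_row normalK_nabla_frame.
rewrite !sffK_comp !frame_coord_e !frame_coord_row.
rewrite -!mulmxBl; congr (_ *m nu); apply/rowP => a.
rewrite mxDE mxNE mxDE mxNE mxDE [RHS]mxE cov_entry.
have -> : (\row_a0 (row j (conn i) *m shape a0 *m (row l 1%:M)^T) 0 0) 0 a =
    \sum_q conn i j q * shape a q l.
  by rewrite mxE -row_mul [row l 1%:M]rowE mulmx1 trmx_delta -colE !mxE.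
have -> : (\row_a0 (row j 1%:M *m shape a0 *m (row l (conn i))^T) 0 0) 0 a =
    \sum_q shape a j q * conn i l q.
  rewrite mxE -row_mul mul1mx mxE; apply: eq_bigr => q _.
  by rewrite !mxE.
have -> : (map_mx (dframe i) (row l (sff_frame j))) 0 a = dframe i (shape a j l) by rewrite !mxE.
have -> : (row l (sff_frame j) *m nconn i) 0 a = \sum_b shape b j l * nconn i b a.
  by rewrite mxE; apply: eq_bigr => b _; rewrite !mxE.
have -> : \sum_q shape a j q * conn i q l = - \sum_q shape a j q * conn i l q.
  by rewrite -sumrN; apply: eq_bigr => q _; rewrite (skew_entry conn_skew i q) mulrN.
have -> : \sum_b nconn i a b * shape b j l = - \sum_b shape b j l * nconn i b a.
  rewrite -sumrN; apply: eq_bigr => b _.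
  have -> : nconn i a b = - nconn i b a by have /matrixP/(_ b a) := nconn_skew i; rewrite mxNE mxE.
  by rewrite mulNr mulrC.
ring.
Qed.

(** The Laplacian is the trace of the Hessian; in the frame its correction term is
the derivative along nabla_{e_i} e_i. *)
Lemma lapK_frame f :
  lapK f = \sum_i (dframe i (dframe i f) - \sum_l conn i i l * dframe l f).
Proof.
pose D : 'cV[K]_m := \col_q d q f.
have XE i : dframe i f = (row i e *m D) 0 0.
  by rewrite /dframe der_combE mxE; apply: eq_bigr => q _; rewrite !mxE.
have -> : lapK f = \sum_i \sum_l \sum_j e i l * e i j *
    (d l (d j f) - \sum_q lc_gram l j q * d q f).
  rewrite /lapK [RHS]exchange_big; apply: eq_bigr => l _ /=.
  rewrite [RHS]exchange_big; apply: eq_bigr => j _ /=.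
  rewrite /gram_inv mxE mulr_suml; apply: eq_bigr => i _; by rewrite [_^T _ _]mxE.
apply: eq_bigr => i _.
have -> : \sum_l conn i i l * dframe l f = (nablaK (row i e) (row i e) *m D) 0 0.
  rewrite nablaK_row -mulmxA [RHS]mxE; apply: eq_bigr => l _.
  by rewrite XE -row_mul !mxE.
have -> : (nablaK (row i e) (row i e) *m D) 0 0 =
   \sum_l \sum_j e i l * (d l (e i j) * d j f + e i j * \sum_q lc_gram l j q * d q f).
  rewrite /nablaK mulmx_suml summxE; apply: eq_bigr => l _.
  rewrite -mulr_sumr -scalemxAl mxZE mulmxDl mxDE [row _ _ _ _]mxE; congr (_ * _).
  rewrite big_split /=; congr (_ + _).
    by rewrite mxE; apply: eq_bigr => j _; rewrite !mxE.
  rewrite -mulmxA mxE; apply: eq_bigr => j _; rewrite [row _ _ _ _]mxE mxE.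
  by congr (_ * _); apply: eq_bigr => q _; rewrite [D _ _]mxE.
rewrite {1}/dframe der_combE.
have -> : \sum_l e i l * d l (dframe i f) =
   \sum_l \sum_j e i l * (d l (e i j) * d j f + e i j * d l (d j f)).
  apply: eq_bigr => l _; rewrite -mulr_sumr; congr (_ * _).
  by rewrite /dframe der_combE raddf_sum; apply: eq_bigr => j _; rewrite /= derM.
rewrite -sumrB; apply: eq_bigr => l _; rewrite -sumrB; apply: eq_bigr => j _.
ring.
Qed.

Hypothesis pmc : forall i, normalK (nablabarK (row i e) meanK) = 0.

(** As m is invertible, parallelism of H is that of m H, which has components
[tr h_a]. *)
Lemma shape_trace_parallel i a : dframe i (\tr (shape a)) = \sum_b nconn i a b * \tr (shape b).
Proof.
have := congr1 (fun v => v *m G *m nu^T) (pmc i).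
rewrite nablabarK_row meanKE scalemxAl normalK_nabla_frame !mul0mx.
rewrite -!(mulmxA (_ + _)) nu_orth mulmx1.
move=> /rowP/(_ a); rewrite mxDE map_der_scale mxDE -scalemxAl !mxZE.
rewrite [map_mx _ _ _ _]mxE [shape_trace _ _]mxE [X in _ = X]mxE => E.
have E' := congr1 (fun z => m%:R * z) E; rewrite mulr0 in E'.
have dm : dframe i minv * m%:R = 0.
  have := derM (dframe i) minv m%:R; rewrite minvE der1 der_nat mulr0 addr0 => <-.
  by [].
have -> : dframe i (\tr (shape a)) = - (shape_trace *m nconn i) 0 a.
  apply/eqP; rewrite -subr_eq0 opprK; apply/eqP.
  transitivity (m%:R * (dframe i minv * \tr (shape a) + minv * dframe i (\tr (shape a))
      + minv * (shape_trace *m nconn i) 0 a) - (dframe i minv * m%:R) * \tr (shape a)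
      - (minv * m%:R - 1) * (dframe i (\tr (shape a)) + (shape_trace *m nconn i) 0 a)); first ring.
  by rewrite E' dm minvE subrr !mul0r !subr0.
rewrite mxE -sumrN; apply: eq_bigr => b _; rewrite mxE.
have -> : nconn i a b = - nconn i b a by have /matrixP/(_ b a) := nconn_skew i; rewrite mxNE mxE.
by rewrite mulNr mulrC.
Qed.

Definition ipK q (B : 'M[K]_q) (y z : 'rV[K]_q) : K := (y *m B *m z^T) 0 0.

Lemma ip_frame (y z : 'rV[K]_m) : ipK gram (y *m e) (z *m e) = (y *m z^T) 0 0.
Proof.
by rewrite /ipK trmx_mul (mulmxA _ e^T) -2!(mulmxA y) e_orth mulmx1.
Qed.

Lemma ip_nu (y z : 'rV[K]_p) : ipK G (y *m nu) (z *m nu) = (y *m z^T) 0 0.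
Proof.
by rewrite /ipK trmx_mul (mulmxA _ nu^T) -2!(mulmxA y) nu_orth mulmx1.
Qed.

Lemma dot_sum q (y z : 'rV[K]_q) : (y *m z^T) 0 0 = \sum_b y 0 b * z 0 b.
Proof. by rewrite mxE; apply: eq_bigr => b _; rewrite mxE. Qed.

Definition simons_rhs : K :=
  let T := tangentK xi in
  let N := normalK xi in
  let H := meanK in
  let A := fun a => shape_mxK (row a nu) in
  let AT := fun a => shape_opK (row a nu) T in
  \sum_i \sum_j \sum_l ipK G (dsffK (row i e) (row j e) (row l e))
                             (dsffK (row i e) (row j e) (row l e))
  + c * ((m%:R - ipK gram T T) * (\sum_a shape_sqK (row a nu))
         - 2 * m%:R * (\sum_a ipK gram (AT a) (AT a))
         + 3 * m%:R * ipK G (sffK T T) H + m%:R * shape_sqK N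
         - m%:R ^+ 2 * ipK G H N ^+ 2 - m%:R ^+ 2 * ipK G H H)
  + \sum_a \sum_b
      (\tr (A b) * \tr (A a *m A a *m A b)
       + \tr ((A a *m A b - A b *m A a) *m (A a *m A b - A b *m A a))
       - \tr (A a *m A b) ^+ 2).

Theorem simons_submanifold : lapK (\sum_a shape_sqK (row a nu)) = 2 * simons_rhs.
Proof.
rewrite /simons_rhs; set S := \sum_a shape_sqK _; set T := tangentK xi.
set N := normalK xi; set H := meanK.
have SE : S = pairing shape shape.
  by apply: eq_bigr => a _; rewrite /shape_sqK shape_mxK_row frame_conjM tr_frame_conj.
have TE : T = xi_tan^T *m e by exact: tangentK_xi.
have NE : N = xi_nor^T *m nu by exact: normalK_xi.
have HE : H = (minv *: shape_trace) *m nu by rewrite /H meanKE scalemxAl.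
have trP (B : 'M[K]_m) : \tr (xi_tan *m xi_tan^T *m B) = (xi_tan^T *m B *m xi_tan) 0 0.
  by rewrite -mulmxA mxtrace_mulC /mxtrace big_ord1.
have hsN : shape_comb xi_nor^T = nu_shape.
  by apply: eq_bigr => b _; rewrite mxE.
have trN : \tr nu_shape = \sum_b xi_nor b 0 * \tr (shape b).
  by rewrite raddf_sum; apply: eq_bigr => b _; rewrite /= mxtraceZ.
rewrite SE lapK_frame simons_moving_frame; last exact: shape_trace_parallel.
congr (2 * (_ + c * (_ * _ - _ * _ + _ + _ - _ - _) + _)).
- apply: eq_bigr => i _; rewrite /pairing.
  under [RHS]eq_bigr do under eq_bigr do rewrite dsffK_row ip_nu dot_sum.
  under [RHS]eq_bigr do rewrite exchange_big.
  rewrite [RHS]exchange_big; apply: eq_bigr => a _ /=.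
  rewrite /mxtrace; apply: eq_bigr => j _; rewrite mxE; apply: eq_bigr => l _.
  have -> : (\row_b cov dframe conn nconn i shape b j l) 0 a =
      cov dframe conn nconn i shape a j l by rewrite mxE.
  have /matrixP/(_ j l) := cov_sym dframe nconn conn_skew i a shape_sym.
  by rewrite [X in X = _]mxE => ->.
- by rewrite TE ip_frame trmxK -[xi_tan *m xi_tan^T]mulmx1 trP mulmx1.
- apply: eq_bigr => a _; rewrite TE shape_opK_row frame_coord_e ip_frame.
  by rewrite -mulmxA trP trmx_mul trmxK shape_sym !mulmxA.
- rewrite TE sffK_comp frame_coord_e HE ip_nu dot_sum -!mulrA; congr (3 * _).
  rewrite mulr_sumr; apply: eq_bigr => a _.
  have -> : (\row_b (xi_tan^T *m shape b *m xi_tan^T^T) 0 0) 0 a =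
      \tr (xi_tan *m xi_tan^T *m shape a).
    by rewrite mxE trmxK trP.
  rewrite mxZE [shape_trace _ _]mxE.
  transitivity (minv * m%:R * (\tr (xi_tan *m xi_tan^T *m shape a) * \tr (shape a))); last ring.
  by rewrite minvE mul1r.
- by rewrite /shape_sqK NE shape_mxKE frame_conjM tr_frame_conj hsN.
- rewrite -exprMn; congr (_ ^+ 2); rewrite HE NE ip_nu dot_sum trN mulr_sumr.
  apply: eq_bigr => a _; rewrite mxZE [shape_trace _ _]mxE [_^T _ _]mxE.
  transitivity (minv * m%:R * (xi_nor a 0 * \tr (shape a))); last ring.
  by rewrite minvE mul1r.
- rewrite HE ip_nu dot_sum mulr_sumr; apply: eq_bigr => a _.
  rewrite mxZE [shape_trace _ _]mxE.
  transitivity ((minv * m%:R) ^+ 2 * \tr (shape a) ^+ 2); last ring.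
  by rewrite minvE expr1n mul1r.
apply: eq_bigr => a _; apply: eq_bigr => b _.
by rewrite !shape_mxK_row !frame_conjM -!frame_conjB !frame_conjM !tr_frame_conj.
Qed.

End MovingFrame.

(** * The ambient connection along a map into a product with the line *)

(** KV is a ring of functions on a chart of M and K one of functions on the
submanifold; [pl] is composition with the projection of the immersion to M and
[F] its family of coordinate functions. *)
Section ProductPullback.
Context {KV K : comNzRingType} {m n : nat}.
Variables (dV : 'I_n -> derivation KV) (d : 'I_m -> derivation K).
Hypothesis dC : forall i j a, d i (d j a) = d j (d i a).
Variables (pl : {rmorphism KV -> K}) (F : 'I_(n + 1) -> K).
Hypothesis chain : forall i a,
  d i (pl a) = \sum_k d i (F (lshift 1 k)) * pl (dV k a).
Variables (gK giK : 'M[KV]_n) (half cV : KV).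
Hypothesis gK_sym : gK^T = gK.
Hypothesis gmK : giK *m gK = 1%:M.
Hypothesis halfE : half * 2 = 1.
Let Gm := lc dV gK giK half.
Hypothesis gK_curv : forall i j, riemann dV gK giK half i j *m gK = cV *:
  \matrix_(k, l) (gK j k * gK i l - gK i k * gK j l).

Definition jacK : 'M[K]_(m, n + 1) := \matrix_(i, j) d i (F j).

Lemma chain_rule i p q (A : 'M[KV]_(p, q)) :
  map_mx (d i) (map_mx pl A) =
  \sum_k jacK i (lshift 1 k) *: map_mx pl (map_mx (dV k) A).
Proof.
apply/matrixP => a b; rewrite summxE mxE [map_mx pl A a b]mxE chain.
by apply: eq_bigr => k _; rewrite !mxE.
Qed.

Definition GMK : 'M[K]_n := map_mx pl gK.
Definition GtM i : 'M[K]_n := \sum_k jacK i (lshift 1 k) *: map_mx pl (Gm k).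

Definition ambient_metricK : 'M[K]_(n + 1) := block_mx GMK 0 0 1%:M.
Definition ambient_connK i : 'M[K]_(n + 1) := block_mx (GtM i) 0 0 0.
Definition xiK : 'rV[K]_(n + 1) := row_mx 0 1%:M.

Lemma GMK_sym : GMK^T = GMK.
Proof. by rewrite /GMK map_trmx gK_sym. Qed.

Lemma ambient_metricK_sym : ambient_metricK^T = ambient_metricK.
Proof. by rewrite /ambient_metricK tr_block_mx !trmx0 trmx1 GMK_sym. Qed.

(** Compatibility with the metric is preserved under pullback by the chain rule. *)
Lemma GM_compat i : map_mx (d i) GMK = GtM i *m GMK + GMK *m (GtM i)^T.
Proof.
rewrite /GMK chain_rule /GtM mulmx_suml [(\sum_k _)^T]raddf_sum mulmx_sumr -big_split.
apply: eq_bigr => k _ /=.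
have -> : map_mx (dV k) gK = Gm k *m gK + gK *m (Gm k)^T.
  exact: lc_metric gK_sym gmK halfE k.
have -> : (jacK i (lshift 1 k) *: map_mx pl (Gm k))^T =
    jacK i (lshift 1 k) *: map_mx pl (Gm k)^T by rewrite linearZ /= map_trmx.
by rewrite map_mxD !map_mxM -scalemxAl -scalemxAr scalerDr.
Qed.

Lemma map_der0 p q i : map_mx (d i) (0 : 'M[K]_(p, q)) = 0.
Proof. exact: map_mx0. Qed.

Lemma ambient_metricK_compat i : map_mx (d i) ambient_metricK =
  ambient_connK i *m ambient_metricK + ambient_metricK *m (ambient_connK i)^T.
Proof.
rewrite /ambient_metricK /ambient_connK map_block_mx !map_der0 map_der1 GM_compat.
rewrite tr_block_mx !trmx0.
rewrite !mulmx_block !(mulmx0, mul0mx, addr0) add_block_mx.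
by rewrite !addr0.
Qed.

Lemma xi_parallel i : nabla_dir d ambient_connK i xiK = 0.
Proof.
rewrite /nabla_dir /xiK map_row_mx map_der0 map_der1 row_mx0 add0r /ambient_connK mul_row_block.
by rewrite !mul0mx !mulmx0 !addr0 row_mx0.
Qed.

Lemma Gm_row k l : row k (Gm l) = row l (Gm k).
Proof.
apply/rowP => q; rewrite [LHS]mxE [RHS]mxE; exact: lc_torsion gK_sym _ _ _.
Qed.

(** Second derivatives of the map and Christoffel symbols are both symmetric. *)
Lemma torsion_free i j : row j (nabla_dir d ambient_connK i jacK) =
  row i (nabla_dir d ambient_connK j jacK).
Proof.
suff E a b : row b (nabla_dir d ambient_connK a jacK) = map_mx (d a) (row b jacK) +
    row_mx (\sum_k \sum_l (jacK a (lshift 1 k) * jacK b (lshift 1 l)) *: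
      row l (map_mx pl (Gm k))) 0.
  rewrite !E; congr (_ + row_mx _ _).
    by apply/rowP => q; rewrite !mxE dC.
  rewrite exchange_big; apply: eq_bigr => k _; apply: eq_bigr => l _ /=.
  by rewrite [X in X *: _ = _]mulrC -!map_row (Gm_row k l).
rewrite /nabla_dir linearD /= row_mul map_row; congr (_ + _).
rewrite -[row b jacK]hsubmxK /ambient_connK mul_row_block !(mulmx0, addr0); congr row_mx.
rewrite /GtM mulmx_sumr; apply: eq_bigr => k _.
rewrite -scalemxAr mulmx_sum_row scaler_sumr; apply: eq_bigr => l _.
by rewrite scalerA !mxE.
Qed.

Let JM : 'M[K]_(m, n) := lsubmx jacK.

Lemma JME i k : JM i k = jacK i (lshift 1 k). Proof. by rewrite mxE. Qed.

(** The curvature of a pulled back connection is the pullback of the curvature;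
the second derivatives of the map cancel. *)
Lemma curv_pull i j : amb_curv d GtM i j =
  \sum_k \sum_l (JM i k * JM j l) *:
    map_mx pl (riemann dV gK giK half k l).
Proof.
have E a b : map_mx (d a) (GtM b) =
    \sum_k d a (JM b k) *: map_mx pl (Gm k)
    + \sum_k \sum_l (JM a k * JM b l) *: map_mx pl (map_mx (dV k) (Gm l)).
  rewrite [X in _ = _ + X]exchange_big /GtM map_der_sum -big_split; apply: eq_bigr => k _ /=.
  rewrite map_der_scale chain_rule -JME scaler_sumr; congr (_ + _).
  by apply: eq_bigr => l _; rewrite scalerA -JME mulrC.
have M a b : GtM b *m GtM a =
    \sum_k \sum_l (JM a k * JM b l) *: map_mx pl (Gm l *m Gm k).
  rewrite exchange_big /GtM mulmx_suml; apply: eq_bigr => l _ /=.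
  rewrite mulmx_sumr; apply: eq_bigr => k _.
  by rewrite (map_mxM pl (Gm l)) -scalemxAl -scalemxAr scalerA !JME [jacK b _ * _]mulrC.
have S (Z : 'I_n -> 'I_n -> 'M[K]_n) : \sum_k \sum_l (JM j k * JM i l) *: Z k l =
    \sum_k \sum_l (JM i k * JM j l) *: Z l k.
  rewrite exchange_big; apply: eq_bigr => k _; apply: eq_bigr => l _ /=.
  by rewrite mulrC.
have T : \sum_k d i (JM j k) *: map_mx pl (Gm k) =
    \sum_k d j (JM i k) *: map_mx pl (Gm k).
  by apply: eq_bigr => k _; rewrite !mxE dC.
rewrite /amb_curv !E !M T.
rewrite !(S (fun k l => map_mx pl (map_mx (dV k) (Gm l)))).
rewrite !(S (fun k l => map_mx pl (Gm l *m Gm k))).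
have -> : \sum_k \sum_l (JM i k * JM j l) *:
    map_mx pl (riemann dV gK giK half k l) =
   \sum_k \sum_l (JM i k * JM j l) *: map_mx pl (map_mx (dV k) (Gm l))
   - \sum_k \sum_l (JM i k * JM j l) *: map_mx pl (map_mx (dV l) (Gm k))
   + \sum_k \sum_l (JM i k * JM j l) *: map_mx pl (Gm l *m Gm k)
   - \sum_k \sum_l (JM i k * JM j l) *: map_mx pl (Gm k *m Gm l).
  rewrite -!sumrB -big_split -sumrB; apply: eq_bigr => k _ /=.
  rewrite -!sumrB -big_split -sumrB; apply: eq_bigr => l _ /=.
  by rewrite -scalerBr -scalerDr -scalerBr -map_mxB -map_mxD -map_mxB.
by rewrite opprD addrACA subrr add0r.
Qed.

Let cK : K := pl cV.

(** The line factor is flat and splits off, so projecting to it kills the last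
coordinate: the horizontal covectors are those of M. *)
Lemma amb_curvE i j :
  let a_ i := row i jacK *m ambient_metricK
    - (row i jacK *m ambient_metricK *m xiK^T) *m xiK *m ambient_metricK in
  amb_curv d ambient_connK i j *m ambient_metricK = cK *: ((a_ j)^T *m a_ i - (a_ i)^T *m a_ j).
Proof.
move=> a_.
have aE k : a_ k = row_mx (row k JM *m GMK) 0.
  rewrite /a_ -[row k jacK]hsubmxK /ambient_metricK mul_row_block !mulmx0 add0r addr0 mulmx1.
  rewrite /xiK tr_row_mx trmx0 trmx1 mul_row_col mulmx0 add0r mulmx1.
  rewrite mul_mx_row mulmx0 mulmx1 mul_row_block !(mul0mx, mulmx0, addr0, add0r) mulmx1.
  rewrite opp_row_mx add_row_mx subrr oppr0 addr0 /JM.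
  by congr (row_mx (_ *m _) _); apply/rowP => q; rewrite !mxE.
rewrite !aE !tr_row_mx trmx0 !mul_col_row !(mul0mx, mulmx0).
have -> : amb_curv d ambient_connK i j = block_mx (amb_curv d GtM i j) 0 0 0.
  rewrite /amb_curv /ambient_connK !map_block_mx !map_der0 !mulmx_block.
  rewrite !(mulmx0, mul0mx, addr0) !opp_block_mx !add_block_mx.
  by rewrite !(oppr0, addr0).
rewrite /ambient_metricK mulmx_block !(mulmx0, mul0mx, addr0).
rewrite opp_block_mx add_block_mx scale_block_mx !(oppr0, addr0, scaler0).
congr (block_mx _ _ _ _); rewrite curv_pull mulmx_suml.
have row_g k : row k JM *m GMK = \sum_l JM k l *: row l GMK.
  by rewrite mulmx_sum_row; apply: eq_bigr => l _; rewrite mxE.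
have S a b : (row b JM *m GMK)^T *m (row a JM *m GMK) =
    \sum_k \sum_l (JM a k * JM b l) *: ((row l GMK)^T *m row k GMK).
  rewrite exchange_big !row_g [(\sum_l _)^T]raddf_sum mulmx_suml; apply: eq_bigr => l _ /=.
  rewrite mulmx_sumr; apply: eq_bigr => k _.
  have -> : (JM b l *: row l GMK)^T = JM b l *: (row l GMK)^T by exact: linearZ.
  by rewrite -scalemxAl -scalemxAr scalerA mulrC.
rewrite !S [X in _ - X]exchange_big -sumrB scaler_sumr; apply: eq_bigr => k _ /=.
rewrite mulmx_suml -sumrB scaler_sumr; apply: eq_bigr => l _.
rewrite -scalemxAl [JM j l * _]mulrC -scalerBr [RHS]scalerA [cK * _]mulrC -[RHS]scalerA.
congr (_ *: _); rewrite /GMK -map_mxM.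
rewrite gK_curv.
apply/matrixP => a b; rewrite [LHS]mxE [X in pl X]mxE rmorphM /= [RHS]mxE.
congr (_ * _); rewrite mxE rmorphB !rmorphM /= mxDE mxNE.
by congr (_ - _); rewrite mxE big_ord1 !mxE.
Qed.

End ProductPullback.

(** * Chain rule and symmetry of second derivatives *)

Section Lines.
Context {R : realType} {V : normedModType R}.
Implicit Types (u : V -> R) (x v : V).

Lemma is_derive_line u x v (a t : R) : derivable u (x + (a * t) *: v) v ->
  is_derive t 1 (fun s => u (x + (a * s) *: v)) (a * 'D_v u (x + (a * t) *: v)).
Proof.
set p := x + _ => du; pose w (h : R) : R := u (h *: v + p).
have dw : derivable w 0 1 by move/derivable1P: du.
have Dw : 'D_1 w 0 = 'D_v u p.
  rewrite /derive; set d := (fun _ : R => _); set d' := (fun _ : R => _).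
  suff -> : d = d' by []; apply/funext => h; rewrite /d /d' /=.
  by rewrite /w addr0 scale0r add0r [_%:A]mulr1.
have E : (fun s => u (x + (a * s) *: v)) = w \o (fun s => a * (s - t)).
  apply/funext => s /=; congr u; rewrite /p addrCA -scalerDl; congr (_ + _ *: _).
  by rewrite -mulrDr subrK.
have dl : is_derive t 1 (fun s : R => a * (s - t)) a.
  have -> : (fun s : R => a * (s - t)) = a \*: (id - cst t) :> (R -> R).
    by apply/funext => s.
  by apply: is_derive_eq; rewrite subr0 [_ *: _]mulr1.
have w0 : w = w \o shift 0 by apply/funext => h /=; rewrite addr0.
have at0 : a * (t - t) = 0 by rewrite subrr mulr0.
have dwt : derivable w (a * (t - t)) 1 by rewrite at0.
have [ld lE] := dl.
have ld' := (derivable1_diffP _ _).1 ld.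
have dwt' := (derivable1_diffP _ _).1 dwt.
rewrite E; apply: DeriveDef.
  exact/derivable1_diffP/differentiable_comp.
rewrite -derive1E (derive1_comp ld dwt) [(fun s : R => _)^`()%classic t]derive1E.
by rewrite lE at0 derive1E Dw mulrC.
Qed.

(** Stated along the segment of length a, of either sign, so that it applies to the
coordinate steps of an increment. *)
Lemma MVT_line u x v (a : R) :
  (forall s, `|s| <= `|a| -> derivable u (x + s *: v) v) ->
  exists2 s, `|s| <= `|a| & u (x + a *: v) - u x = a * 'D_v u (x + s *: v).
Proof.
move=> du.
have dl (t : R) : t \in `[0, 1]%R -> derivable u (x + (a * t) *: v) v.
  rewrite in_itv /= => /andP[t0 t1]; apply: du; rewrite normrM (ger0_norm t0).
  by rewrite ler_piMr.
pose phi (s : R) : R := u (x + (a * s) *: v).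
pose dphi (s : R) : R := a * 'D_v u (x + (a * s) *: v).
have dl' (t : R) : t \in `[0, 1]%R -> is_derive t 1 phi (dphi t).
  by move=> /dl; exact: is_derive_line.
have H1 (t : R) : t \in `]0, 1[%R -> is_derive t 1 phi (dphi t).
  by move=> t01; apply: dl'; exact: subset_itv_oo_cc.
have H2 : {within `[0, 1], continuous phi}.
  by apply: derivable_within_continuous => t t01; case: (dl' t t01).
have [t t01 E] := MVT_segment ler01 H1 H2.
exists (a * t).
  by move: t01; rewrite in_itv /= => /andP[t0 t1]; rewrite normrM (ger0_norm t0) ler_piMr.
by move: E; rewrite /phi /dphi mulr1 mulr0 scale0r addr0 subr0 mulr1.
Qed.

End Lines.

Lemma diff_of_increment {R : realType} {V W : normedModType R} (f : V -> W)
    (L : {linear V -> W}) x : continuous L ->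
  (forall e : R, 0 < e ->
     \forall v \near (0 : V), `|f (v + x) - (f x + L v)| <= e * `|v|) ->
  differentiable f x /\ 'd f x = L :> (V -> W).
Proof.
move=> Lc H.
have E : f \o shift x = cst (f x) + L +o_ 0 id.
  by apply/eqaddoP => e e0; exact: H.
have D : 'd f x = L :> (V -> W) by exact: diff_unique.
by split=> //; apply/diff_locallyP; rewrite D.
Qed.

Section C1.
Context {R : realType} {n : nat}.
Implicit Types (u : 'rV[R]_n -> R) (x v : 'rV[R]_n).

Lemma norm_row_le v (e : R) : 0 <= e -> (forall j, `|v 0 j| <= e) -> `|v| <= e.
Proof.
move=> e0 H; rewrite /Num.Def.normr/= mx_normrE (bigmax_le _ e0) //= => -[i j] _ /=.
by rewrite ord1.
Qed.

Lemma norm_coord_le v j : `|v 0 j| <= `|v|.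
Proof.
rewrite [leRHS]/Num.Def.normr/= mx_normrE.
exact: (le_bigmax _ (fun i => `|v i.1 i.2|) (0, j)).
Qed.

(** The increment is split into steps along the coordinate axes, and the mean value
theorem is applied to each step. *)
Lemma increment_coord u x v (r : R) : `|v| < r ->
  (forall y, `|y - x| < r -> forall i, derivable u y (basis_vec i)) ->
  exists y : 'I_n -> 'rV[R]_n, (forall i, `|y i - x| <= `|v|) /\
    u (x + v) - u x = \sum_i v 0 i * pd i u (y i).
Proof.
move=> vr du.
pose p (k : nat) := x + \row_(i < n) (if (i < k)%N then v 0 i else 0).
have step (i : 'I_n) : exists y, `|y - x| <= `|v| /\
    u (p i.+1) - u (p i) = v 0 i * pd i u y.
  have E : p i.+1 = p i + v 0 i *: basis_vec i.
    rewrite /p -addrA; congr (_ + _); apply/rowP => j; rewrite !mxE eqxx /=.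
    rewrite ltnS -val_eqE /=; case: ltngtP => [//| |/val_inj->];
      by rewrite ?mulr0 ?addr0 ?mulr1 ?add0r.
  have pn s : `|s| <= `|v 0 i| -> `|p i + s *: basis_vec i - x| <= `|v|.
    move=> sv; rewrite /p addrAC [x + _]addrC addrK.
    apply: norm_row_le => // j; rewrite !mxE eqxx /= -val_eqE /=.
    case: ltngtP => _; rewrite ?mulr0 ?addr0 ?mulr1 ?add0r ?normr0 //.
      exact: norm_coord_le.
    exact: le_trans sv (norm_coord_le _ _).
  have [|s sa] := @MVT_line R _ u (p i) (basis_vec i) (v 0 i).
    by move=> s sv; apply: du; apply: le_lt_trans vr; exact: pn.
  by rewrite -E => ->; exists (p i + s *: basis_vec i); split => //; exact: pn.
have [y Hy] := choice step.
exists y; split; first by move=> i; have [] := Hy i.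
have -> : u (x + v) - u x = \sum_(0 <= k < n) (u (p k.+1) - u (p k)).
  rewrite telescope_sumr //; congr (u _ - u _).
    by congr (_ + _); apply/rowP => j; rewrite !mxE ltn_ord.
  by rewrite /p -[LHS]addr0; congr (_ + _); apply/rowP => j; rewrite !mxE.
rewrite big_mkord; apply: eq_bigr => i _; by have [] := Hy i.
Qed.

(** The intermediate points of [increment_coord] tend to x, where the partial
derivatives are continuous. *)
Lemma C1_differentiable u x :
  (\forall y \near x, forall i, derivable u y (basis_vec i)) ->
  (forall i, {for x, continuous (pd i u)}) ->
  differentiable u x /\ forall v, 'd u x v = \sum_i v 0 i * pd i u x.
Proof.
move=> du cu.
pose L v : R := \sum_i v 0 i * pd i u x.
have Ll : linear L.
  move=> a v w; rewrite /L scaler_sumr -big_split /=; apply: eq_bigr => i _.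
  by rewrite !mxE mulrDl /= -mulrA.
pose LL : {linear 'rV[R]_n -> R} := HB.pack L (GRing.isLinear.Build _ _ _ _ L Ll).
have Lc : continuous LL.
  have -> : (LL : _ -> _) = \sum_i (fun v : 'rV[R]_n => pd i u x *: (v 0 i : R)).
    by apply/funext => v; rewrite /= /L fct_sumE; apply: eq_bigr => i _; rewrite mulrC.
  move=> v; apply: differentiable_continuous.
  apply: differentiable_sum => i; apply: differentiableZ.
  exact: differentiable_coord.
suff H (e : R) : 0 < e ->
    \forall v \near (0 : 'rV[R]_n), `|u (v + x) - (u x + L v)| <= e * `|v|.
  have [d D] := @diff_of_increment R _ R^o u LL x Lc H.
  by split => // v; rewrite D.
move=> /posnumP[{}e].
  have [r r0 Hr] : exists2 r : R, 0 < r & forall y, `|y - x| < r ->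
     (forall i, derivable u y (basis_vec i)) /\
     (forall i, `|pd i u y - pd i u x| <= e%:num / (n%:R + 1)).
    have e0 : 0 < e%:num / (n%:R + 1) by rewrite divr_gt0 // ltr_wpDl.
    have H : \forall y \near x, (forall i, derivable u y (basis_vec i)) /\
       (forall i, `|pd i u y - pd i u x| <= e%:num / (n%:R + 1)).
      near=> y; split; first by near: y.
      near: y; apply: filter_forall => i.
      have /cvgrPdist_le/(_ _ e0) := cu i.
      by apply: filterS => y; rewrite distrC.
    have /nbhs_ballP[r /= r0 Hr] := H.
    by exists r => // y yr; apply: Hr; rewrite -ball_normE /= distrC.
  near=> v.
  have vr : `|v| < r.
    near: v; apply/nbhs_ballP; exists r => // w.
    by rewrite -ball_normE /= sub0r normrN.
  have [y [yv Ey]] := increment_coord vr (fun y Hy => (Hr y Hy).1).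
  rewrite [v + x]addrC opprD addrA Ey /L -sumrB.
  apply: le_trans (ler_norm_sum _ _ _) _.
  have : \sum_(i < n) `|v 0 i * pd i u (y i) - v 0 i * pd i u x|
    <= \sum_(i < n) `|v| * (e%:num / (n%:R + 1)).
    apply: ler_sum => i _; rewrite -mulrBr normrM ler_pM //.
      exact: norm_coord_le.
    by apply: (Hr _ _).2; apply: le_lt_trans vr.
  move=> /le_trans; apply; rewrite sumr_const card_ord -mulrnAr [leRHS]mulrC.
have n1 : 0 < n%:R + 1 :> R by rewrite ltr_wpDl.
rewrite ler_wpM2l // -mulrnAr ler_piMr // -mulr_natr mulrC.
by rewrite ler_pdivrMr // mul1r lerDl.
Unshelve. all: by end_near. Qed.

End C1.
Section ChainRule.
Context {R : realType}.

Lemma derive_compose {V W X : normedModType R} (u : W -> X) (f : V -> W) x v :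
  differentiable u (f x) -> derivable f x v ->
  derivable (u \o f) x v /\ 'D_v (u \o f) x = 'd u (f x) ('D_v f x).
Proof.
move=> ud fd; pose l (h : R) : W := f (h *: v + x).
have l0 : l 0 = f x by rewrite /l scale0r add0r.
have ld1 : derivable l 0 1 by move/derivable1P: fd.
have ld : differentiable l 0 by apply/derivable1_diffP.
have ud0 : differentiable u (l 0) by rewrite l0.
have cd : differentiable (u \o l) 0 by exact: differentiable_comp.
have D (Y : normedModType R) (g : V -> Y) :
    'D_v g x = 'D_1 (fun h : R => g (h *: v + x)) 0.
  rewrite /derive; set d := (fun h : R => h^-1 *: _).
  set d' := (fun h : R => h^-1 *: _).
  suff -> : d = d' by []; apply/funext => h; rewrite /d /d' /=.
  by rewrite addr0 scale0r add0r [_%:A]mulr1.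
split; first by apply/derivable1P; have /derivable1_diffP := cd.
rewrite [LHS]D [in RHS]D -[fun h : R => f _]/l.
by rewrite -[fun h : R => _]/(u \o l) deriveE // diff_comp //= l0 deriveE.
Qed.

Lemma derive_comp_rV {m n} (u : 'rV[R]_n -> R) (f : 'rV[R]_m -> 'rV[R]_n) x v :
  (\forall y \near f x, forall i, derivable u y (basis_vec i)) ->
  (forall i, {for f x, continuous (pd i u)}) ->
  (forall k, derivable (fun y => f y 0 k) x v) ->
  derivable (u \o f) x v /\
  'D_v (u \o f) x = \sum_k 'D_v (fun y => f y 0 k) x * pd k u (f x).
Proof.
move=> du cu df.
have [udiff uE] := C1_differentiable du cu.
have fdiff : derivable f x v.
  by apply/derivable_mxP => i j; rewrite ord1; exact: df.
have [cd cE] := @derive_compose _ _ R^o u f x v udiff fdiff.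
split=> //; rewrite cE uE; apply: eq_bigr => k _.
by rewrite derive_mx // mxE.
Qed.

Lemma is_derive_translate {V W : normedModType R} (u : V -> W) x v p :
  derivable u (x + p) v -> is_derive x v (fun y => u (y + p)) ('D_v u (x + p)).
Proof.
have E : (fun h : R => h^-1 *: (((fun y => u (y + p)) \o shift x) (h *: v)
      - u (x + p))) =
   (fun h : R => h^-1 *: ((u \o shift (x + p)) (h *: v) - u (x + p))).
  by apply/funext => h /=; rewrite addrA.
by move=> d1; apply: DeriveDef; [move: d1|]; rewrite /derivable /derive E.
Qed.

Lemma ball_coord {n} (x : 'rV[R]_n) (i j : 'I_n) (s t r : R) :
  `|s| < r -> `|t| < r ->
  ball x (r + r) (x + s *: basis_vec i + t *: basis_vec j).
Proof.
move=> sr tr; rewrite -ball_normE /=.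
set p := s *: _; set q := t *: _.
have -> : x - (x + p + q) = - (p + q) by rewrite -addrA opprD addNKr.
rewrite normrN.
have b (a : R) (k : 'I_n) : `|a *: (basis_vec k : 'rV[R]_n)| <= `|a|.
  apply: norm_row_le => // l; rewrite !mxE eqxx /=.
  by case: (l == k); rewrite ?mulr1 // mulr0 normr0.
by apply: le_lt_trans (ler_normD _ _) _; apply: ltrD; apply: le_lt_trans (b _ _) _.
Qed.

(** Two mean value theorems: first for the difference in the j-th direction as a
function of the i-th coordinate, then for the i-th partial derivative. *)
Lemma second_difference {n} (u : 'rV[R]_n -> R) x (i j : 'I_n) (r : R) :
  (forall y, ball x (r + r) y -> derivable u y (basis_vec i) /\
     derivable (pd i u) y (basis_vec j)) ->
  forall a, 0 < a -> a < r -> exists2 y, ball x (r + r) y &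
  u (x + a *: basis_vec i + a *: basis_vec j) - u (x + a *: basis_vec i)
  - u (x + a *: basis_vec j) + u x = a * a * pd j (pd i u) y.
Proof.
move=> du a a0 ar; set ei := basis_vec i; set ej := basis_vec j.
pose w y := u (y + a *: ej) - u y.
have na : `|a| = a by rewrite gtr0_norm.
have dw (s : R) : `|s| <= `|a| -> derivable w (x + s *: ei) ei /\
   'D_ei w (x + s *: ei) = pd i u (x + s *: ei + a *: ej) - pd i u (x + s *: ei).
  rewrite na => sa; have sr : `|s| < r by exact: le_lt_trans ar.
  have d0 : derivable u (x + s *: ei) ei.
    have r0 : `|0 : R| < r by rewrite normr0 (lt_trans a0 ar).
    have := ball_coord x i j sr r0.
    by rewrite scale0r addr0 => /du[].
  have d1 : derivable u (x + s *: ei + a *: ej) ei.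
    have ar' : `|a| < r by rewrite na.
    by have [] := du _ (ball_coord x i j sr ar').
  have sh := is_derive_translate d1.
  have [shd shE] := sh.
  split; first exact: derivableB.
  by rewrite (deriveB shd d0) shE.
have [|s sa E1] := @MVT_line R _ w x ei a; first by move=> s /dw[].
have [_ E2] := dw s sa; rewrite E2 in E1.
have sr : `|s| < r by apply: le_lt_trans sa _; rewrite na.
have [|t ta E3] := @MVT_line R _ (pd i u) (x + s *: ei) ej a.
  move=> t; rewrite na => ta.
  by have /du[] : ball x (r + r) (x + s *: ei + t *: ej)
    by apply: ball_coord => //; exact: le_lt_trans ar.
exists (x + s *: ei + t *: ej).
  by apply: ball_coord => //; apply: le_lt_trans ta _; rewrite na.
rewrite E3 mulrA in E1; rewrite -E1 /w opprB [u x - _]addrC.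
by rewrite -!addrA.
Qed.

Lemma near_dist_le {n} (u : 'rV[R]_n -> R) x (e : R) :
  {for x, continuous u} -> 0 < e -> \forall y \near x, `|u x - u y| <= e.
Proof. by move=> /cvgrPdist_le cu e0; exact: cu. Qed.

(** The second difference is symmetric in the two directions, and converges to
either mixed derivative by [second_difference]. *)
Lemma pdC {n} (U : set 'rV[R]_n) u i j x : open U -> smooth U u -> U x ->
  pd i (pd j u) x = pd j (pd i u) x.
Proof.
move=> oU su Ux; apply/eqP; rewrite -subr_eq0 -normr_eq0; apply/eqP/le_anti.
rewrite normr_ge0 andbT; apply/ler_addgt0Pl => e e0; rewrite addr0.
have c1 : {for x, continuous (pd i (pd j u))} by have [] := su [:: i; j] x Ux.
have c2 : {for x, continuous (pd j (pd i u))} by have [] := su [:: j; i] x Ux.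
have e2 : 0 < e / 2 by rewrite divr_gt0.
have A0 : \forall y \near x, U y by exact: open_nbhs_nbhs.
have A1 : \forall y \near x, `|pd i (pd j u) x - pd i (pd j u) y| <= e / 2.
  exact: near_dist_le c1 e2.
have A2 : \forall y \near x, `|pd j (pd i u) x - pd j (pd i u) y| <= e / 2.
  exact: near_dist_le c2 e2.
have /nbhs_ballP[r /= r0 Hr] : \forall y \near x, U y /\
   `|pd i (pd j u) x - pd i (pd j u) y| <= e / 2 /\
   `|pd j (pd i u) x - pd j (pd i u) y| <= e / 2.
  exact: filterI A0 (filterI A1 A2).
pose r' := r / 2; have r'0 : 0 < r' by rewrite divr_gt0.
have rr : r = r' + r' by rewrite /r' -splitr.
rewrite rr in Hr.
have du k l y : ball x (r' + r') y -> derivable u y (basis_vec k) /\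
     derivable (pd k u) y (basis_vec l).
  move=> /Hr[Uy _]; split; first by have [_] := su [::] y Uy; apply.
  by have [_] := su [:: k] y Uy; apply.
pose a := r' / 2; have a0 : 0 < a by rewrite divr_gt0.
have ar : a < r' by rewrite ltr_pdivrMr // ltr_pMr // ltr1n.
have [y By Ey] := second_difference (du j i) a0 ar.
have [z Bz Ez] := second_difference (du i j) a0 ar.
have aa : a * a != 0 by rewrite mulf_neq0 ?gt_eqF.
have [_ [Hy _]] := Hr y By; have [_ [_ Hz]] := Hr z Bz.
move: Ey Ez Hy Hz; rewrite (addrAC x (a *: basis_vec j)).
move: (pd i (pd j u) x) (pd j (pd i u) x) => P Q.
move: (pd i (pd j u) y) (pd j (pd i u) z) => p q Ey Ez.
have <- : p = q.
  by apply: (mulfI aa); rewrite -Ey -Ez; congr (_ + _); exact: addrAC.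
move=> H1 H2; rewrite -(subrKA p) -[X in `|_ + X|]opprB.
by apply: le_trans (ler_normB _ _) _; rewrite (splitr e); exact: lerD.
Qed.

End ChainRule.
(** * Stability of smooth functions *)

Section SmoothClosure.
Context {R : realType}.

Lemma eq_open_near {n} (U : set 'rV[R]_n) (u v : 'rV[R]_n -> R) x :
  open U -> (forall y, U y -> u y = v y) -> U x -> \forall y \near x, u y = v y.
Proof.
move=> oU uv Ux; have H : \forall y \near x, U y by exact: open_nbhs_nbhs.
by apply: filterS H => y; exact: uv.
Qed.

Lemma near_eq_continuous {T : topologicalType} (u v : T -> R) x :
  (\forall y \near x, u y = v y) -> {for x, continuous u} ->
  {for x, continuous v}.
Proof.
move=> uv cu; rewrite /prop_for /continuous_at -(nbhs_singleton uv).
by apply: cvg_trans cu; apply: near_eq_cvg; apply: filterS uv => y ->.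
Qed.

Lemma pd_eq_on {n} (U : set 'rV[R]_n) (u v : 'rV[R]_n -> R) i x :
  open U -> (forall y, U y -> u y = v y) -> U x -> pd i u x = pd i v x.
Proof. by move=> oU uv Ux; apply: near_eq_derive; exact: eq_open_near uv Ux. Qed.

Lemma smooth_pd {n} (U : set 'rV[R]_n) u i : smooth U u -> smooth U (pd i u).
Proof. by move=> su s x Ux; have := su (rcons s i) x Ux; rewrite foldr_rcons. Qed.

Lemma smooth_continuous {n} (U : set 'rV[R]_n) u x :
  smooth U u -> U x -> {for x, continuous u}.
Proof. by move=> su Ux; have [] := su [::] x Ux. Qed.

Lemma smooth_derivable {n} (U : set 'rV[R]_n) u x i :
  smooth U u -> U x -> derivable u x (basis_vec i).
Proof. by move=> su Ux; have [_] := su [::] x Ux; apply. Qed.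

Lemma continuous_rV {T : topologicalType} {n} (f : T -> 'rV[R]_n) x :
  (forall k, {for x, continuous (fun y => f y 0 k)}) -> {for x, continuous f}.
Proof.
move=> cf A [P HP PA].
have H : \forall y \near x, forall k, P ord0 k (f y ord0 k).
  apply: filter_forall => k.
  exact: cf k _ (HP ord0 k).
by apply: filterS H => y H; apply: PA => i k; rewrite ord1; exact: H.
Qed.

(** Smoothness of products, inverses and composites cannot be shown one operation
at a time by induction on the order of differentiation, because each derivative
mixes the operations.  The class generated by all of them is stable under partial
derivatives, which settles them together. *)
Inductive smooth_closure {m} (U : set 'rV[R]_m) : ('rV[R]_m -> R) -> Prop :=
| closure_smooth u : smooth U u -> smooth_closure U u
| closure_cst c : smooth_closure U (cst c)
| closure_add u v : smooth_closure U u -> smooth_closure U v ->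
    smooth_closure U (fun x => u x + v x)
| closure_mul u v : smooth_closure U u -> smooth_closure U v ->
    smooth_closure U (fun x => u x * v x)
| closure_inv u : smooth_closure U u -> (forall x, U x -> u x != 0) ->
    smooth_closure U (fun x => (u x)^-1)
| closure_comp n (V : set 'rV[R]_n) f h : open V -> smooth_vec U f ->
    (forall x, U x -> V (f x)) -> smooth V h -> smooth_closure U (fun x => h (f x)).

Lemma closure_sum {m} (U : set 'rV[R]_m) n (u : 'I_n -> 'rV[R]_m -> R) :
  (forall k, smooth_closure U (u k)) -> smooth_closure U (fun x => \sum_k u k x).
Proof.
elim: n u => [|n IH] u H.
  have -> : (fun x => \sum_k u k x) = cst 0 :> ('rV[R]_m -> R).
    by apply/funext => x; rewrite big_ord0.
  exact: closure_cst.
have -> : (fun x => \sum_k u k x) =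
    (fun x => u ord0 x + \sum_(k < n) u (lift ord0 k) x) :> ('rV[R]_m -> R).
  by apply/funext => x; rewrite big_ord_recl.
by apply: closure_add => //; apply: IH.
Qed.

Lemma smooth_comp1 {m n} (U : set 'rV[R]_m) (V : set 'rV[R]_n) f h x i :
  open V -> smooth_vec U f -> (forall x, U x -> V (f x)) -> smooth V h -> U x ->
  [/\ {for x, continuous (fun x => h (f x))},
      derivable (fun x => h (f x)) x (basis_vec i) &
      pd i (fun x => h (f x)) x =
        \sum_k pd i (fun y => f y 0 k) x * pd k h (f x)].
Proof.
move=> oV sf UV sh Ux; have Vf := UV _ Ux.
have nV : \forall y \near f x, forall k, derivable h y (basis_vec k).
  have H : \forall y \near f x, V y by exact: open_nbhs_nbhs.
  by apply: filterS H => y Vy k; exact: smooth_derivable sh Vy.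
have ch k : {for f x, continuous (pd k h)}.
  exact: smooth_continuous (smooth_pd k sh) Vf.
have df k : derivable (fun y => f y 0 k) x (basis_vec i).
  exact: smooth_derivable (sf k) Ux.
have [d E] := derive_comp_rV nV ch df.
split => //.
have cf : {for x, continuous f}.
  by apply: continuous_rV => k; exact: smooth_continuous (sf k) Ux.
have ch0 := smooth_continuous sh Vf.
exact: (continuous_comp cf ch0).
Qed.

(** Every operation is differentiable, with a derivative in the same class. *)
Lemma closure_regular {m} (U : set 'rV[R]_m) u : open U -> smooth_closure U u ->
  (forall x, U x -> {for x, continuous u} /\ forall i, derivable u x (basis_vec i))
  /\ forall i, exists2 v, smooth_closure U v & forall x, U x -> pd i u x = v x.
Proof.
move=> oU; elim => {u}
  [u su|c|u v su [ru du] sv [rv dv]|u v su [ru du] sv [rv dv]|u su [ru du] u0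
  |n V f h oV sf UV sh].
- split=> [x Ux|i]; first exact: su [::] x Ux.
  by exists (pd i u) => //; apply: closure_smooth; exact: smooth_pd.
- split=> [x Ux|i]; first by split=> [|i]; [exact: cst_continuous|exact: derivable_cst].
  exists (cst 0) => [|x Ux]; first exact: closure_cst.
  exact: derive_cst.
- split=> [x Ux|i].
    have [cu dru] := ru x Ux; have [cv drv] := rv x Ux.
    by split=> [|i]; [exact: continuousD|exact: derivableD].
  have [u' su' Eu] := du i; have [v' sv' Ev] := dv i.
  exists (fun x => u' x + v' x) => [|x Ux]; first exact: closure_add.
  have [_ dru] := ru x Ux; have [_ drv] := rv x Ux.
  by rewrite -Eu // -Ev //; exact: deriveD.
- split=> [x Ux|i].
    have [cu dru] := ru x Ux; have [cv drv] := rv x Ux.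
    by split=> [|i]; [exact: continuousM|exact: derivableM].
  have [u' su' Eu] := du i; have [v' sv' Ev] := dv i.
  exists (fun x => u x * v' x + v x * u' x) => [|x Ux].
    by apply: closure_add; exact: closure_mul.
  have [_ dru] := ru x Ux; have [_ drv] := rv x Ux.
  by rewrite -Eu // -Ev //; exact: deriveM.
- split=> [x Ux|i].
    have [cu dru] := ru x Ux; have ux0 := u0 x Ux.
    by split=> [|i]; [exact: continuousV|exact: derivableV].
  have [u' su' Eu] := du i.
  exists (fun x => -1 * ((u x)^-1 * (u x)^-1 * u' x)) => [|x Ux].
    apply: closure_mul; first exact: closure_cst.
    by apply: closure_mul => //; apply: closure_mul; exact: closure_inv.
  have [_ dru] := ru x Ux.
  rewrite -Eu // mulN1r -mulNr -invfM; exact: deriveV (u0 x Ux) (dru i).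
- split=> [x Ux|i].
    split; last by move=> i; have [] := smooth_comp1 i oV sf UV sh Ux.
    have cf : {for x, continuous f}.
      by apply: continuous_rV => k; exact: smooth_continuous (sf k) Ux.
    have ch0 := smooth_continuous sh (UV _ Ux).
    exact: (continuous_comp cf ch0).
  exists (fun x => \sum_k pd i (fun y => f y 0 k) x * pd k h (f x)) => [|x Ux].
    apply: closure_sum => k; apply: closure_mul.
      by apply: closure_smooth; exact: smooth_pd.
    apply: (closure_comp oV sf UV); exact: smooth_pd.
  by have [] := smooth_comp1 i oV sf UV sh Ux.
Qed.

Lemma smooth_of_closure {m} (U : set 'rV[R]_m) u : open U ->
  smooth_closure U u -> smooth U u.
Proof.
move=> oU su s.
have [v sv Ev] : exists2 v, smooth_closure U v &
    forall x, U x -> foldr pd u s x = v x.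
  elim: s => [|i s [v sv Ev]] /=; first by exists u.
  have [_ /(_ i)[w sw Ew]] := closure_regular oU sv.
  by exists w => // x Ux; rewrite -Ew //; exact: pd_eq_on Ev Ux.
move=> x Ux; have [/(_ x Ux)[cv dv] _] := closure_regular oU sv.
have E1 := eq_open_near oU Ev Ux.
have E2 : \forall y \near x, v y = foldr pd u s y.
  by apply: eq_open_near oU _ Ux => y Uy; rewrite Ev.
split=> [|i]; last exact: near_eq_derivable (dv i).
exact: near_eq_continuous E2 cv.
Qed.

Lemma smooth_eq_on {m} (U : set 'rV[R]_m) u v : open U ->
  (forall x, U x -> u x = v x) -> smooth U u -> smooth U v.
Proof.
move=> oU uv su s x Ux; have [cu du] := su s x Ux.
have E : forall y, U y -> foldr pd u s y = foldr pd v s y.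
  by elim: s {x Ux cu du} => [|i s IH] //= y Uy; exact: pd_eq_on IH Uy.
have E2 := eq_open_near oU E Ux.
split=> [|i]; [exact: near_eq_continuous E2 cu|exact: near_eq_derivable (du i)].
Qed.

End SmoothClosure.

(** * The ring of smooth functions on a domain *)

(** Nonemptiness makes the ring of functions nonzero. *)
Record domain (R : realType) (n : nat) := Domain {
  dom_set :> set 'rV[R]_n;
  dom_open : open dom_set;
  dom_nonempty : dom_set !=set0
}.

(** Functions are normalized to vanish off U, so that equality on U is equality
of elements of the ring. *)
Record smooth_fun (R : realType) (n : nat) (U : domain R n) := SmoothFun {
  sval_fun :> 'rV[R]_n -> R;
  smooth_funP : smooth U sval_fun;
  smooth_fun_out : forall x, ~ dom_set U x -> sval_fun x = 0
}.

Section PartialRules.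
Context {R : realType} {n : nat}.
Implicit Types u v : 'rV[R]_n -> R.

Lemma pdB u v x i : derivable u x (basis_vec i) -> derivable v x (basis_vec i) ->
  pd i (fun y => u y - v y) x = pd i u x - pd i v x.
Proof. exact: deriveB. Qed.

Lemma pdM u v x i : derivable u x (basis_vec i) -> derivable v x (basis_vec i) ->
  pd i (fun y => u y * v y) x = pd i u x * v x + u x * pd i v x.
Proof.
rewrite /pd => du dv; have := deriveM du dv.
by rewrite [in _ * v x]mulrC addrC => <-.
Qed.

End PartialRules.

Section SmoothRing.
Context {R : realType} {n : nat} (U : domain R n).
Local Notation K := (smooth_fun U).

Lemma smooth_fun_ext (a b : K) : (forall x, dom_set U x -> a x = b x) -> a = b.
Proof.
case: a b => [a sa a0] [b sb b0] /= ab.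
have E : a = b.
  apply/funext => x; have [Ux|nUx] := pselect (dom_set U x); first exact: ab.
  by rewrite a0 // b0.
by rewrite -{}E in sb b0 *; congr SmoothFun; exact: Prop_irrelevance.
Qed.

Definition restrict (u : 'rV[R]_n -> R) (x : 'rV[R]_n) : R :=
  if `[< dom_set U x >] then u x else 0.

Lemma restrictE u x : dom_set U x -> restrict u x = u x.
Proof. by rewrite /restrict => /asboolT ->. Qed.

Lemma restrict_out u x : ~ dom_set U x -> restrict u x = 0.
Proof. by rewrite /restrict => /asboolF ->. Qed.

Lemma smooth_restrict u : smooth U u -> smooth U (restrict u).
Proof.
by apply: smooth_eq_on (@dom_open _ _ U) _ => x Ux; rewrite restrictE.
Qed.

Definition mk_smooth u (su : smooth U u) : K :=
  SmoothFun (smooth_restrict su) (@restrict_out u).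

Lemma mk_smoothE u (su : smooth U u) x : dom_set U x -> mk_smooth su x = u x.
Proof. exact: restrictE. Qed.

Let closure (a : K) : smooth_closure U a := closure_smooth (smooth_funP a).

Lemma smooth_cst c : smooth U (cst c : 'rV[R]_n -> R).
Proof. exact: smooth_of_closure (@dom_open _ _ U) (closure_cst U c). Qed.

Lemma smooth_add (a b : K) : smooth U (fun x => a x + b x).
Proof. exact: smooth_of_closure (@dom_open _ _ U) (closure_add (closure a) (closure b)). Qed.

Lemma smooth_mul (a b : K) : smooth U (fun x => a x * b x).
Proof. exact: smooth_of_closure (@dom_open _ _ U) (closure_mul (closure a) (closure b)). Qed.

Lemma smooth_opp (a : K) : smooth U (fun x => -1 * a x).
Proof.
exact: smooth_of_closure (@dom_open _ _ U) (closure_mul (closure_cst U (-1)) (closure a)).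
Qed.

HB.instance Definition _ := gen_eqMixin K.
HB.instance Definition _ := gen_choiceMixin K.

Definition sf_cst c : K := mk_smooth (smooth_cst c).
Definition sf_add (a b : K) : K := mk_smooth (smooth_add a b).
Definition sf_mul (a b : K) : K := mk_smooth (smooth_mul a b).
Definition sf_opp (a : K) : K := mk_smooth (smooth_opp a).

Lemma sf_addA : associative sf_add.
Proof. by move=> a b c; apply: smooth_fun_ext => x Ux; rewrite !mk_smoothE // addrA. Qed.
Lemma sf_addC : commutative sf_add.
Proof. by move=> a b; apply: smooth_fun_ext => x Ux; rewrite !mk_smoothE // addrC. Qed.
Lemma sf_add0 : left_id (sf_cst 0) sf_add.
Proof. by move=> a; apply: smooth_fun_ext => x Ux; rewrite !mk_smoothE // add0r. Qed.
Lemma sf_addN : left_inverse (sf_cst 0) sf_opp sf_add.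
Proof. by move=> a; apply: smooth_fun_ext => x Ux; rewrite !mk_smoothE // mulN1r addNr. Qed.

HB.instance Definition _ := GRing.isZmodule.Build K sf_addA sf_addC sf_add0 sf_addN.

Lemma sf_mulA : associative sf_mul.
Proof. by move=> a b c; apply: smooth_fun_ext => x Ux; rewrite !mk_smoothE // mulrA. Qed.
Lemma sf_mulC : commutative sf_mul.
Proof. by move=> a b; apply: smooth_fun_ext => x Ux; rewrite !mk_smoothE // mulrC. Qed.
Lemma sf_mul1 : left_id (sf_cst 1) sf_mul.
Proof. by move=> a; apply: smooth_fun_ext => x Ux; rewrite !mk_smoothE // mul1r. Qed.
Lemma sf_mulDl : left_distributive sf_mul +%R.
Proof.
by move=> a b c; apply: smooth_fun_ext => x Ux; rewrite !mk_smoothE // mulrDl.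
Qed.
Lemma sf_1_neq0 : sf_cst 1 != 0.
Proof.
apply/eqP => E; have [x Ux] := dom_nonempty U.
have : sf_cst 1 x = (0 : K) x by rewrite E.
by rewrite !mk_smoothE //; apply/eqP; exact: oner_neq0.
Qed.

HB.instance Definition _ :=
  GRing.Zmodule_isComNzRing.Build K sf_mulA sf_mulC sf_mul1 sf_mulDl sf_1_neq0.

Lemma sf_addE (a b : K) x : dom_set U x -> (a + b) x = a x + b x.
Proof. exact: mk_smoothE. Qed.
Lemma sf_mulE (a b : K) x : dom_set U x -> (a * b) x = a x * b x.
Proof. exact: mk_smoothE. Qed.
Lemma sf_cstE c x : dom_set U x -> sf_cst c x = c.
Proof. exact: mk_smoothE. Qed.

Definition ev x (Ux : dom_set U x) (a : K) : R := a x.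

Section Evaluation.
Context (x : 'rV[R]_n) (Ux : dom_set U x).

Lemma ev_is_zmod : zmod_morphism (ev Ux).
Proof. by move=> a b; rewrite /ev sf_addE // [(- b) x]mk_smoothE // mulN1r. Qed.

Lemma ev_is_monoid : monoid_morphism (ev Ux).
Proof. by split=> [|a b]; rewrite /ev ?sf_mulE // [LHS]mk_smoothE. Qed.

HB.instance Definition _ := GRing.isZmodMorphism.Build K R (ev Ux) ev_is_zmod.
HB.instance Definition _ := GRing.isMonoidMorphism.Build K R (ev Ux) ev_is_monoid.

End Evaluation.

Lemma sf_subE (a b : K) x : dom_set U x -> (a - b) x = a x - b x.
Proof. by move=> Ux; exact: (rmorphB (ev Ux)). Qed.
Lemma sf_oneE x : dom_set U x -> (1 : K) x = 1.
Proof. by move=> Ux; exact: (rmorph1 (ev Ux)). Qed.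
Lemma sf_sumE I (r : seq I) (P : pred I) (F : I -> K) x : dom_set U x ->
  (\sum_(i <- r | P i) F i) x = \sum_(i <- r | P i) F i x.
Proof. by move=> Ux; exact: (rmorph_sum (ev Ux)). Qed.

Definition sf_pd i (a : K) : K := mk_smooth (smooth_pd i (smooth_funP a)).

Lemma sf_pdE i a x : dom_set U x -> sf_pd i a x = pd i a x.
Proof. exact: mk_smoothE. Qed.

Lemma sf_pd_mk i u (su : smooth U u) x : dom_set U x ->
  sf_pd i (mk_smooth su) x = pd i u x.
Proof.
move=> Ux; rewrite sf_pdE //; apply: pd_eq_on (@dom_open _ _ U) _ Ux => y Uy.
exact: mk_smoothE.
Qed.

Lemma sf_derivable (a : K) i x : dom_set U x -> derivable a x (basis_vec i).
Proof. exact: smooth_derivable (smooth_funP a). Qed.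

Lemma sf_pd_is_zmod i : zmod_morphism (sf_pd i).
Proof.
move=> a b; apply: smooth_fun_ext => x Ux.
rewrite sf_subE // !sf_pdE //.
rewrite (pd_eq_on i (@dom_open _ _ U) _ Ux (v := fun y => a y - b y)).
  by apply: pdB; exact: sf_derivable.
by move=> y Uy; rewrite sf_subE.
Qed.

HB.instance Definition _ i := GRing.isZmodMorphism.Build K K (sf_pd i) (sf_pd_is_zmod i).

Lemma sf_pdM i a b : sf_pd i (a * b) = sf_pd i a * b + a * sf_pd i b.
Proof.
apply: smooth_fun_ext => x Ux; rewrite sf_addE // !sf_mulE // !sf_pdE //.
rewrite (pd_eq_on i (@dom_open _ _ U) _ Ux (v := fun y => a y * b y)).
  by apply: pdM; exact: sf_derivable.
by move=> y Uy; rewrite sf_mulE.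
Qed.

Definition partial i : derivation K := Derivation (sf_pdM i).

Lemma partialE i a x : dom_set U x -> partial i a x = pd i a x.
Proof. exact: sf_pdE. Qed.

Lemma partial_mk i u (su : smooth U u) x : dom_set U x ->
  partial i (mk_smooth su) x = pd i u x.
Proof. exact: sf_pd_mk. Qed.

(** Schwarz's theorem, which is what the moving frame computation asks of the ring. *)
Lemma partialC i j a : partial i (partial j a) = partial j (partial i a).
Proof.
apply: smooth_fun_ext => x Ux.
have E k l : partial k (partial l a) x = pd k (pd l a) x.
  apply: etrans (sf_pdE k (sf_pd l a) Ux) _.
  exact: pd_eq_on (@dom_open _ _ U) (fun z => @sf_pdE l a z) Ux.
apply: etrans (E i j) (etrans _ (esym (E j i))).
exact: pdC (@dom_open _ _ U) (smooth_funP a) Ux.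
Qed.

Lemma partial_cst i c : partial i (sf_cst c) = 0.
Proof.
apply: smooth_fun_ext => x Ux; rewrite [LHS]sf_pd_mk // [RHS]mk_smoothE //.
exact: derive_cst.
Qed.

End SmoothRing.
Arguments partial {R n U} i.

Section Pullback.
Context {R : realType} {m n : nat} (U : domain R m) (V : domain R n).
Variables (f : 'rV[R]_m -> 'rV[R]_n).
Hypotheses (sf : smooth_vec U f) (fV : forall x, dom_set U x -> dom_set V (f x)).

Lemma smooth_pull (a : smooth_fun V) : smooth U (fun x => a (f x)).
Proof.
apply: smooth_of_closure (@dom_open _ _ U) _.
exact: closure_comp (@dom_open _ _ V) sf fV (smooth_funP a).
Qed.

Definition pull (a : smooth_fun V) : smooth_fun U := mk_smooth (smooth_pull a).

Lemma pullE a x : dom_set U x -> pull a x = a (f x).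
Proof. exact: mk_smoothE. Qed.

Lemma pull_is_zmod : zmod_morphism pull.
Proof.
move=> a b; apply: smooth_fun_ext => x Ux.
by rewrite sf_subE // !pullE // sf_subE //; exact: fV.
Qed.

Lemma pull_is_monoid : monoid_morphism pull.
Proof.
split=> [|a b]; apply: smooth_fun_ext => x Ux.
  by rewrite pullE // !sf_oneE //; exact: fV.
by rewrite sf_mulE // !pullE // sf_mulE //; exact: fV.
Qed.

HB.instance Definition _ :=
  GRing.isZmodMorphism.Build (smooth_fun V) (smooth_fun U) pull pull_is_zmod.
HB.instance Definition _ :=
  GRing.isMonoidMorphism.Build (smooth_fun V) (smooth_fun U) pull pull_is_monoid.

Definition coordf k : smooth_fun U := mk_smooth (sf k).

Lemma partial_pull i a :
  partial i (pull a) = \sum_k partial i (coordf k) * pull (partial k a).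
Proof.
apply: smooth_fun_ext => x Ux.
rewrite sf_sumE // [LHS]sf_pd_mk //.
have [_ _ ->] := smooth_comp1 i (@dom_open _ _ V) sf fV (smooth_funP a) Ux.
apply: eq_bigr => k _; rewrite sf_mulE // [partial i _ x]sf_pd_mk //.
by rewrite pullE // sf_pdE //; exact: fV.
Qed.

End Pullback.
(* Computation in the ring must not unfold derivatives to limits. *)
#[global] Opaque partial.

(** * Metrics of constant sectional curvature *)

Section Metric.
Context {R : realType} {n : nat} (V : domain R n).
Local Notation K := (smooth_fun V).
Variable g : 'rV[R]_n -> 'M[R]_n.

Definition evm p q x (Vx : dom_set V x) (A : 'M[K]_(p, q)) : 'M[R]_(p, q) :=
  map_mx (ev Vx) A.

Lemma evmM p q r x (Vx : dom_set V x) (A : 'M[K]_(p, q)) (B : 'M[K]_(q, r)) :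
  evm Vx (A *m B) = evm Vx A *m evm Vx B.
Proof. exact: map_mxM. Qed.
Lemma evmD p q x (Vx : dom_set V x) (A B : 'M[K]_(p, q)) :
  evm Vx (A + B) = evm Vx A + evm Vx B.
Proof. exact: map_mxD. Qed.
Lemma evmN p q x (Vx : dom_set V x) (A : 'M[K]_(p, q)) :
  evm Vx (- A) = - evm Vx A.
Proof. exact: map_mxN. Qed.
Lemma evmT p q x (Vx : dom_set V x) (A : 'M[K]_(p, q)) :
  evm Vx A^T = (evm Vx A)^T.
Proof. by rewrite /evm map_trmx. Qed.
Lemma evmE p q x (Vx : dom_set V x) (A : 'M[K]_(p, q)) a b :
  evm Vx A a b = A a b x.
Proof. by rewrite mxE. Qed.

Lemma evmZ p q x (Vx : dom_set V x) a (A : 'M[K]_(p, q)) :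
  evm Vx (a *: A) = a x *: evm Vx A.
Proof. exact: map_mxZ. Qed.
Lemma evm_sum I (r : seq I) (P : pred I) p q (F : I -> 'M[K]_(p, q)) x (Vx : dom_set V x) :
  evm Vx (\sum_(i <- r | P i) F i) = \sum_(i <- r | P i) evm Vx (F i).
Proof. exact: map_mx_sum. Qed.

Lemma mx_ext p q (A B : 'M[K]_(p, q)) :
  (forall x (Vx : dom_set V x), evm Vx A = evm Vx B) -> A = B.
Proof.
move=> H; apply/matrixP => a b; apply: smooth_fun_ext => x Vx.
by have /matrixP/(_ a b) := H x Vx; rewrite !evmE.
Qed.

Hypothesis g_smooth : forall a b, smooth V (fun x => g x a b).
Hypothesis g_symm : forall x, dom_set V x -> (g x)^T = g x.
Hypothesis g_pos : forall x, dom_set V x -> forall v, v != 0 -> 0 < ip (g x) v v.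

Definition metric_mx : 'M[K]_n := \matrix_(a, b) mk_smooth (g_smooth a b).

Lemma metric_mxE x (Vx : dom_set V x) : evm Vx metric_mx = g x.
Proof. by apply/matrixP => a b; rewrite evmE mxE mk_smoothE. Qed.

Lemma metric_mx_sym : metric_mx^T = metric_mx.
Proof. by apply: mx_ext => x Vx; rewrite evmT metric_mxE g_symm. Qed.

Lemma metric_unit x : dom_set V x -> g x \in unitmx.
Proof.
move=> Vx; rewrite -row_free_unit -kermx_eq0; apply/negPn/negP => /rowV0Pn[v].
move=> /sub_kermxP vg v0; have := g_pos Vx v0.
by rewrite /ip vg mul0mx mxE ltxx.
Qed.

Lemma det_metric_neq0 x : dom_set V x -> \det metric_mx x != 0.
Proof.
move=> Vx; rewrite -[_ x]/(ev Vx _) -det_map_mx -/(evm Vx _) metric_mxE.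
by have := metric_unit Vx; rewrite unitmxE unitfE.
Qed.

Lemma smooth_inv_det : smooth V (fun x => (\det metric_mx x)^-1).
Proof.
apply: smooth_of_closure (@dom_open _ _ V) _; apply: closure_inv.
  exact: closure_smooth (smooth_funP _).
exact: det_metric_neq0.
Qed.

(** Cramer's formula shows that the inverse metric is smooth. *)
Definition inv_metric_mx : 'M[K]_n := mk_smooth smooth_inv_det *: \adj metric_mx.

Lemma inv_metric_mxK : inv_metric_mx *m metric_mx = 1%:M.
Proof.
rewrite -scalemxAl mul_adj_mx scale_scalar_mx; congr (_%:M).
apply: smooth_fun_ext => x Vx; rewrite sf_mulE // mk_smoothE // sf_oneE //.
by rewrite mulVf // det_metric_neq0.
Qed.

Lemma inv_metric_mxE x (Vx : dom_set V x) : evm Vx inv_metric_mx = invmx (g x).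
Proof.
rewrite -[RHS]mul1mx -[1%:M](map_mx1 (ev Vx)) -inv_metric_mxK -/(evm Vx _) evmM.
by rewrite metric_mxE mulmxK // metric_unit.
Qed.

Definition half_sf : K := sf_cst V 2^-1.

Lemma half_sfE : half_sf * 2 = 1.
Proof.
apply: smooth_fun_ext => x Vx; rewrite sf_mulE // sf_cstE // sf_oneE //.
rewrite -[(2 : K) x]/(ev Vx 2) rmorph_nat mulVf //.
Qed.

Definition Gam i : 'M[K]_n := lc (partial (U := V)) metric_mx inv_metric_mx half_sf i.

Lemma christoffelE x (Vx : dom_set V x) i j k :
  christoffel g x i j k = Gam i j k x.
Proof.
rewrite /Gam /lc mxE sf_sumE // /christoffel mulr_sumr; apply: eq_bigr => l _.
rewrite sf_mulE // [koszul _ _ _ _ _ _]mxE [_^T _ _]mxE -inv_metric_mxE evmE.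
rewrite sf_mulE // [half_sf x]sf_cstE // sf_subE // sf_addE // ![metric_mx _ _]mxE.
rewrite !(partial_mk _ _ Vx).
set a := inv_metric_mx _ _ _; ring.
Qed.

Lemma GammaE x (Vx : dom_set V x) (u v : 'rV[R]_n) :
  Gamma g x u v = \sum_i u 0 i *: (v *m evm Vx (Gam i)).
Proof.
apply/rowP => k; rewrite mxE summxE; apply: eq_bigr => i _.
rewrite mxE [(v *m _) _ _]mxE mulr_sumr; apply: eq_bigr => j _.
by rewrite (christoffelE Vx) evmE -mulrA mulrC -mulrA.
Qed.

Lemma mul_jac q (Y : 'rV[R]_n -> 'rV[R]_q) (YK : 'rV[K]_q) x (Vx : dom_set V x) u :
  (forall y (Vy : dom_set V y), Y y = evm Vy YK) ->
  u *m jac Y x = \sum_i u 0 i *: evm Vx (map_mx (partial i) YK).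
Proof.
move=> YE; apply/rowP => k; rewrite mxE summxE; apply: eq_bigr => i _.
rewrite [RHS]mxE evmE [map_mx _ _ _ _]mxE mxE; congr (_ * _).
rewrite [RHS]partialE //; apply: pd_eq_on (@dom_open _ _ V) _ Vx => y Vy.
by rewrite YE evmE.
Qed.

Lemma nablaE (X Y : 'rV[R]_n -> 'rV[R]_n) (YK : 'rV[K]_n) x (Vx : dom_set V x) :
  (forall y (Vy : dom_set V y), Y y = evm Vy YK) ->
  nabla g X Y x =
  \sum_i X x 0 i *: evm Vx (map_mx (partial i) YK + YK *m Gam i).
Proof.
move=> YE; rewrite /nabla (mul_jac _ _ YE) (GammaE Vx) -big_split.
apply: eq_bigr => i _; rewrite (YE x Vx) -evmM evmD; exact/esym/scalerDr.
Qed.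

Lemma jac_cst q (w : 'rV[R]_q) (x : 'rV[R]_n) : jac (cst w) x = 0.
Proof. by apply/matrixP => i j; rewrite !mxE; exact: derive_cst. Qed.

Definition riem_mx i j : 'M[K]_n :=
  riemann (partial (U := V)) metric_mx inv_metric_mx half_sf i j.

Definition cstm p q (A : 'M[R]_(p, q)) : 'M[K]_(p, q) := map_mx (sf_cst V) A.

Lemma cstmE p q (A : 'M[R]_(p, q)) x (Vx : dom_set V x) : evm Vx (cstm A) = A.
Proof. by apply/matrixP => a b; rewrite evmE mxE sf_cstE. Qed.

Lemma partial_cstm p q i (A : 'M[R]_(p, q)) : map_mx (partial i) (cstm A) = 0.
Proof. by apply/matrixP => a b; rewrite !mxE partial_cst. Qed.

(** Covariant derivatives of constant fields involve only Christoffel symbols and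
their derivatives, which assemble into the matrix [riemann]. *)
Lemma curvatureE x (Vx : dom_set V x) (u v w : 'rV[R]_n) :
  curvature g x u v w =
  \sum_i \sum_j (u 0 i * v 0 j) *: (w *m evm Vx (riem_mx i j)).
Proof.
pose F (b : 'rV[R]_n) : 'rV[K]_n := \sum_j sf_cst V (b 0 j) *: (cstm w *m Gam j).
have evF b y (Vy : dom_set V y) : evm Vy (F b) = Gamma g y b w.
  rewrite (GammaE Vy) evm_sum; apply: eq_bigr => j _.
  by rewrite evmZ sf_cstE // evmM cstmE.
have N1 b y (Vy : dom_set V y) : nabla g (cst b) (cst w) y = evm Vy (F b).
  by rewrite /nabla jac_cst mulmx0 add0r evF.
have N2 a b : nabla g (cst a) (nabla g (cst b) (cst w)) x =
   \sum_i \sum_j (a 0 i * b 0 j) *: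
     (w *m evm Vx (map_mx (partial i) (Gam j) + Gam j *m Gam i)).
  rewrite (nablaE _ _ (N1 b)); apply: eq_bigr => i _.
  have -> : map_mx (partial i) (F b) + F b *m Gam i =
     \sum_j sf_cst V (b 0 j) *:
        (cstm w *m (map_mx (partial i) (Gam j) + Gam j *m Gam i)).
    rewrite map_der_sum mulmx_suml -big_split; apply: eq_bigr => j _ /=.
    rewrite map_der_scale partial_cst scale0r add0r map_der_mul partial_cstm.
    by rewrite mul0mx add0r mulmxDr scalerDr -scalemxAl mulmxA.
  rewrite evm_sum scaler_sumr; apply: eq_bigr => j _.
  by rewrite evmZ sf_cstE // scalerA evmM cstmE.
rewrite /curvature !N2 [X in _ - X]exchange_big -sumrB; apply: eq_bigr => i _ /=.
rewrite -sumrB; apply: eq_bigr => j _.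
rewrite [v 0 j * _]mulrC -scalerBr -mulmxBr -evmN -evmD; congr (_ *: (_ *m evm _ _)).
rewrite /riem_mx /riemann -/(Gam i) -/(Gam j).
by rewrite opprD addrACA addrA.
Qed.

Lemma curvature_skew34 x (u v w z : 'rV[R]_n) : dom_set V x ->
  ip (g x) (curvature g x u v w) z = - ip (g x) (curvature g x u v z) w.
Proof.
move=> Vx; have sk i j : (evm Vx (riem_mx i j) *m g x)^T = - (evm Vx (riem_mx i j) *m g x).
  rewrite -(metric_mxE Vx) -evmM -evmT -evmN; congr (evm _ _).
  apply: riemann_skew34 => [k l a|||]; first exact: partialC.
  - exact: metric_mx_sym.
  - exact: inv_metric_mxK.
  - exact: half_sfE.
have E a b : ip (g x) (curvature g x u v a) b = \sum_i \sum_j u 0 i * v 0 j *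
    (a *m (evm Vx (riem_mx i j) *m g x) *m b^T) 0 0.
  rewrite (curvatureE Vx) /ip !mulmx_suml summxE; apply: eq_bigr => i _.
  rewrite !mulmx_suml summxE; apply: eq_bigr => j _.
  by rewrite -!scalemxAl mxE !mulmxA.
rewrite !E -sumrN; apply: eq_bigr => i _; rewrite -sumrN; apply: eq_bigr => j _.
rewrite -mulrN; congr (_ * _).
have := sk i j; move: (evm _ _ *m _) => A sA.
have T (B : 'M[R]_1) : B^T 0 0 = B 0 0 by rewrite mxE.
by rewrite -T !trmx_mul trmxK sA mulNmx mulmxN mulmxA mxE.
Qed.

Lemma curvature_entry x (Vx : dom_set V x) (u v w : 'rV[R]_n) l :
  curvature g x u v w 0 l =
  \sum_i \sum_j \sum_k u 0 i * v 0 j * w 0 k * riem_mx i j k l x.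
Proof.
rewrite (curvatureE Vx) summxE; apply: eq_bigr => i _.
rewrite summxE; apply: eq_bigr => j _; rewrite mxE [X in _ * X]mxE mulr_sumr.
by apply: eq_bigr => k _; rewrite evmE mulrA.
Qed.

Lemma curvature_bianchi x (u v w : 'rV[R]_n) : dom_set V x ->
  curvature g x u v w + curvature g x v w u + curvature g x w u v = 0.
Proof.
move=> Vx; apply/rowP => l; rewrite mxDE [X in X + _]mxDE.
rewrite !(curvature_entry Vx) [RHS]mxE.
have -> : \sum_i \sum_j \sum_k v 0 i * w 0 j * u 0 k * riem_mx i j k l x =
   \sum_i \sum_j \sum_k v 0 j * w 0 k * u 0 i * riem_mx j k i l x.
  under eq_bigr do rewrite exchange_big.
  by rewrite exchange_big.
have -> : \sum_i \sum_j \sum_k w 0 i * u 0 j * v 0 k * riem_mx i j k l x =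
   \sum_i \sum_j \sum_k w 0 k * u 0 i * v 0 j * riem_mx k i j l x.
  by rewrite exchange_big; apply: eq_bigr => i _; rewrite exchange_big.
rewrite -!big_split big1 //= => i _; rewrite -!big_split big1 //= => j _.
rewrite -!big_split big1 //= => k _.
have B : riem_mx i j k l x + riem_mx j k i l x + riem_mx k i j l x = 0.
  have := riemann_bianchi (partial (U := V)) inv_metric_mx half_sf metric_mx_sym i j k l.
  rewrite -/(riem_mx i j) -/(riem_mx j k) -/(riem_mx k i) => /(congr1 (ev Vx)).
  by rewrite rmorph0 !rmorphD.
rewrite -[RHS](mulr0 (u 0 i * v 0 j * w 0 k)) -B; ring.
Qed.

Variable c : R.
Hypothesis g_curv : forall x, dom_set V x -> forall u v : 'rV[R]_n,
  \rank (col_mx u v) = 2%N -> sectional g x u v = c.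

Lemma ipC x (u v : 'rV[R]_n) : dom_set V x -> ip (g x) u v = ip (g x) v u.
Proof.
move=> Vx; rewrite /ip -[LHS]/((u *m g x *m v^T) 0 0) -[u *m _ *m _]trmxK mxE.
by rewrite !trmx_mul trmxK g_symm // mulmxA.
Qed.

Lemma ipDl (B : 'M[R]_n) u v w : ip B (u + v) w = ip B u w + ip B v w.
Proof. by rewrite /ip !mulmxDl mxE. Qed.
Lemma ipDr (B : 'M[R]_n) u v w : ip B w (u + v) = ip B w u + ip B w v.
Proof. by rewrite /ip linearD mulmxDr mxE. Qed.
Lemma ipZl (B : 'M[R]_n) a u v : ip B (a *: u) v = a * ip B u v.
Proof. by rewrite /ip -!scalemxAl mxE. Qed.
Lemma ipZr (B : 'M[R]_n) a u v : ip B u (a *: v) = a * ip B u v.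
Proof. by rewrite /ip linearZ -scalemxAr mxE. Qed.
Lemma ipNl (B : 'M[R]_n) u v : ip B (- u) v = - ip B u v.
Proof. by rewrite -scaleN1r ipZl mulN1r. Qed.

Lemma ip_eq0 x v : dom_set V x -> ip (g x) v v = 0 -> v = 0.
Proof.
move=> Vx vv; apply/eqP; apply: contraT => v0.
by have := g_pos Vx v0; rewrite vv ltxx.
Qed.

(** A nonzero Gram determinant excludes linear dependence; this is the case in
which the sectional curvature is prescribed. *)
Lemma gram_rank2 x (u v : 'rV[R]_n) : dom_set V x ->
  ip (g x) u u * ip (g x) v v - ip (g x) u v ^+ 2 != 0 ->
  \rank (col_mx u v) = 2%N.
Proof.
move=> Vx den; apply/eqP; rewrite -[_ == _]/(row_free (col_mx u v)).
rewrite -kermx_eq0; apply: contraT => /rowV0Pn[w /sub_kermxP].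
rewrite -[w]hsubmxK mul_row_col.
set a := lsubmx w; set b := rsubmx w.
rewrite [a]mx11_scalar [b]mx11_scalar !mul_scalar_mx.
move: (a 0 0) (b 0 0) => {}a {}b E w0.
have E1 : a * ip (g x) u u + b * ip (g x) u v = 0.
  rewrite [ip (g x) u v]ipC // -!ipZl -ipDl E.
  by rewrite /ip !mul0mx mxE.
have E2 : a * ip (g x) u v + b * ip (g x) v v = 0.
  by rewrite -!ipZl -ipDl E /ip !mul0mx mxE.
have a0 : a = 0.
  apply: (mulIf den); rewrite mul0r.
  transitivity (ip (g x) v v * (a * ip (g x) u u + b * ip (g x) u v)
    - ip (g x) u v * (a * ip (g x) u v + b * ip (g x) v v)); first by ring.
  by rewrite E1 E2 !mulr0 subr0.
have b0 : b = 0.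
  apply: (mulIf den); rewrite mul0r.
  transitivity (ip (g x) u u * (a * ip (g x) u v + b * ip (g x) v v)
    - ip (g x) u v * (a * ip (g x) u u + b * ip (g x) u v)); first by ring.
  by rewrite E1 E2 !mulr0 subr0.
by move: w0; rewrite a0 b0 raddf0 row_mx0 eqxx.
Qed.

Lemma gram0_dep x (u v : 'rV[R]_n) : dom_set V x -> v != 0 ->
  ip (g x) u u * ip (g x) v v - ip (g x) u v ^+ 2 = 0 ->
  exists a, u = a *: v.
Proof.
move=> Vx v0 den; have vv := g_pos Vx v0.
exists (ip (g x) u v / ip (g x) v v); apply/eqP; rewrite -subr_eq0; apply/eqP.
apply: (ip_eq0 Vx); rewrite -scaleNr !(ipDl, ipDr, ipZl, ipZr) (ipC v u) //.
have vn : ip (g x) v v != 0 by rewrite gt_eqF.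
apply: (mulIf vn); rewrite mul0r -den; field.
by rewrite vn.
Qed.

(** The difference with the model tensor has the symmetries of a curvature tensor
and vanishes on the planes: on independent vectors by hypothesis, on dependent
ones by skewness. *)
Lemma curvature_constant x (Vx : dom_set V x) (u v w z : 'rV[R]_n) :
  ip (g x) (curvature g x u v w) z =
  c * (ip (g x) v w * ip (g x) u z - ip (g x) u w * ip (g x) v z).
Proof.
pose S u v w z := ip (g x) (curvature g x u v w) z -
  c * (ip (g x) v w * ip (g x) u z - ip (g x) u w * ip (g x) v z).
suff : S u v w z = 0 by move/eqP; rewrite subr_eq0 => /eqP.
have cD a a' b e : curvature g x (a + a') b e = curvature g x a b e + curvature g x a' b e.
  rewrite !(curvatureE Vx) -big_split; apply: eq_bigr => i _ /=.
  by rewrite -big_split; apply: eq_bigr => j _ /=; rewrite mxE mulrDl scalerDl.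
have cD3 a b e e' : curvature g x a b (e + e') = curvature g x a b e + curvature g x a b e'.
  rewrite !(curvatureE Vx) -big_split; apply: eq_bigr => i _ /=.
  by rewrite -big_split; apply: eq_bigr => j _ /=; rewrite mulmxDl scalerDr.
have cN a b e : curvature g x a b e = - curvature g x b a e.
  by rewrite /curvature opprB.
have cZ a b e r : curvature g x (r *: a) b e = r *: curvature g x a b e.
  rewrite !(curvatureE Vx) scaler_sumr; apply: eq_bigr => i _.
  by rewrite scaler_sumr; apply: eq_bigr => j _; rewrite mxE scalerA mulrA.
have c34 a b e f : ip (g x) (curvature g x a b e) f = - ip (g x) (curvature g x a b f) e.
  by exact: curvature_skew34.
have cB a b e : curvature g x a b e + curvature g x b e a + curvature g x e a b = 0.
  by exact: curvature_bianchi.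
apply: curvature_tensor_eq0 => [a a' b e f|a b e f|a b e f|a b e f|a b e e' f|a b].
- rewrite /S cD !ipDl; ring.
- rewrite /S cN ipNl; ring.
- rewrite /S c34; ring.
- have E : ip (g x) (curvature g x a b e) f + ip (g x) (curvature g x b e a) f
    + ip (g x) (curvature g x e a b) f = 0 by rewrite -!ipDl cB /ip !mul0mx mxE.
  rewrite /S (ipC e a) // (ipC b a) // (ipC e b) //.
  by rewrite -[RHS]E; ring.
- rewrite /S cD3 !ipDr ipDl; ring.
rewrite /S (ipC b a) //.
have cc d : curvature g x d d = fun=> 0.
  by apply/funext => e; rewrite /curvature subrr.
have [->|b0] := eqVneq b 0.
  have ip0 d : ip (g x) 0 d = 0 by rewrite /ip !mul0mx mxE.
  rewrite [curvature _ _ _ _ _]cN -[X in curvature _ _ X](scale0r 0) cZ scale0r oppr0.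
  by rewrite ip0 (ipC a) // !ip0; ring.
have [den|den] := eqVneq (ip (g x) a a * ip (g x) b b - ip (g x) a b ^+ 2) 0.
  have [r ar] := gram0_dep Vx b0 den.
  rewrite [in curvature _ _ _ _ _]ar cZ cc scaler0 /ip !mul0mx [X in X - _]mxE -!/(ip _ _ _).
  by rewrite mulrC -expr2 in den *; rewrite mulrC den mul0r subrr.
have := g_curv Vx (gram_rank2 Vx den); rewrite /sectional => <-.
by rewrite mulrAC mulrC; apply/eqP; rewrite subr_eq0; apply/eqP; field.
Qed.

Lemma riem_mx_constant i j : riem_mx i j *m metric_mx = sf_cst V c *:
  \matrix_(k, l) (metric_mx j k * metric_mx i l - metric_mx i k * metric_mx j l).
Proof.
apply: mx_ext => x Vx; rewrite evmM evmZ sf_cstE // metric_mxE.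
have ipb (k l : 'I_n) : ip (g x) (basis_vec k) (basis_vec l) = metric_mx k l x.
  by rewrite /ip -(metric_mxE Vx) -evmE -[in LHS]rowE trmx_delta -colE !mxE.
apply/matrixP => k l; rewrite [RHS]mxE.
have -> : evm Vx (\matrix_(k, l) (metric_mx j k * metric_mx i l
     - metric_mx i k * metric_mx j l)) k l = metric_mx j k x * metric_mx i l x
     - metric_mx i k x * metric_mx j l x.
  by rewrite evmE mxE sf_subE // !sf_mulE.
rewrite -!ipb -(curvature_constant Vx) (curvatureE Vx).
rewrite (bigD1 i) //= [X in _ + X]big1 ?addr0 => [|q qi]; last first.
  by apply: big1 => r _; rewrite !mxE eqxx (negPf qi) mul0r scale0r.
rewrite (bigD1 j) //= [X in _ + X]big1 ?addr0 => [|q qj]; last first.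
  by rewrite !mxE !eqxx (negPf qj) mulr0 scale0r.
have b1 (q : 'I_n) : (basis_vec q : 'rV[R]_n) 0 q = 1 by rewrite mxE !eqxx.
by rewrite !b1 mulr1 scale1r /ip -[basis_vec k *m _ *m _]mulmxA -rowE trmx_delta -colE !mxE.
Qed.

End Metric.

(** * Christoffel symbols of a product with the line *)

Section ProductMetric.
Context {R : realType} {n : nat}.
Implicit Types (u : 'rV[R]_n -> R) (y v : 'rV[R]_(n + 1)).

(** The difference quotients agree. *)
Lemma derive_lsubmx u y v :
  'D_v (fun z : 'rV[R]_(n + 1) => u (lsubmx z)) y = 'D_(lsubmx v) u (lsubmx y).
Proof.
rewrite /derive.
have -> : (fun h : R => h^-1 *: (((fun z => u (lsubmx z)) \o shift y) (h *: v)
    - u (lsubmx y))) =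
    (fun h : R => h^-1 *: ((u \o shift (lsubmx y)) (h *: lsubmx v) - u (lsubmx y))).
  apply/funext => h /=; congr (_ *: (u _ - _)).
  by apply/rowP => j; rewrite !mxE.
by [].
Qed.

Lemma derive_dir0 u x : 'D_0 u x = 0.
Proof.
rewrite -(derive_cst (u x) x (0 : 'rV[R]_n)) /derive.
have -> : (fun h : R => h^-1 *: ((u \o shift x) (h *: 0) - u x)) =
    (fun h : R => h^-1 *: ((cst (u x) \o shift x) (h *: 0) - cst (u x) x)).
  by apply/funext => h /=; rewrite scaler0 add0r.
by [].
Qed.

Lemma pd_left u q y :
  pd (lshift 1 q) (fun z : 'rV[R]_(n + 1) => u (lsubmx z)) y = pd q u (lsubmx y).
Proof.
rewrite /pd derive_lsubmx; congr ('D_ _ u _).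
by apply/rowP => j; rewrite !mxE (inj_eq (@lshift_inj n 1)).
Qed.

Lemma pd_right u r y :
  pd (rshift n r) (fun z : 'rV[R]_(n + 1) => u (lsubmx z)) y = 0.
Proof.
rewrite /pd derive_lsubmx -[RHS](derive_dir0 u (lsubmx y)); congr ('D_ _ u _).
by apply/rowP => j; rewrite !mxE eq_lrshift andbF.
Qed.

Variable gM : 'rV[R]_n -> 'M[R]_n.

Definition prod_metric y : 'M[R]_(n + 1) := block_mx (gM (lsubmx y)) 0 0 1%:M.

Lemma pd_cst (F : 'rV[R]_(n + 1) -> R) a i y : (forall z, F z = a) -> pd i F y = 0.
Proof. by move=> FE; rewrite (_ : F = cst a) ?/pd ?derive_cst //; apply/funext. Qed.

Lemma pd_metric_r i j r y : pd i (fun z => prod_metric z j (rshift n r)) y = 0.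
Proof.
rewrite -(splitK j); case: (fintype.split j) => a /=.
  by apply: (@pd_cst _ 0) => z; rewrite block_mxEur mxE.
by apply: (@pd_cst _ ((1%:M : 'M[R]_1) a r)) => z; rewrite block_mxEdr.
Qed.

Lemma pd_metric_rr i j r y : pd i (fun z => prod_metric z (rshift n r) j) y = 0.
Proof.
rewrite -(splitK j); case: (fintype.split j) => a /=.
  by apply: (@pd_cst _ 0) => z; rewrite block_mxEdl mxE.
by apply: (@pd_cst _ ((1%:M : 'M[R]_1) r a)) => z; rewrite block_mxEdr.
Qed.

Lemma pd_metric_ll i a b y :
  pd (lshift 1 i) (fun z => prod_metric z (lshift 1 a) (lshift 1 b)) y =
  pd i (fun x => gM x a b) (lsubmx y).
Proof.
rewrite -pd_left; congr (pd _ _ y); apply/funext => z.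
by rewrite /prod_metric block_mxEul.
Qed.

Lemma pd_metric_dir r i j y : pd (rshift n r) (fun z => prod_metric z i j) y = 0.
Proof.
rewrite -(splitK i) -(splitK j); case: (fintype.split i) (fintype.split j) => a [] b /=.
- rewrite -[RHS](pd_right (fun x => gM x a b) r y); congr (pd _ _ y).
  by apply/funext => z; rewrite /prod_metric block_mxEul.
- exact: pd_metric_r.
- exact: pd_metric_rr.
- exact: pd_metric_r.
Qed.

Lemma invmx_prod y : gM (lsubmx y) \in unitmx ->
  invmx (prod_metric y) = block_mx (invmx (gM (lsubmx y))) 0 0 1%:M.
Proof.
move=> gu; have E : block_mx (invmx (gM (lsubmx y))) 0 0 1%:M *m prod_metric y = 1%:M.
  rewrite /prod_metric mulmx_block !(mul0mx, mulmx0, mulmx1, addr0, add0r) mulVmx //.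
  by rewrite -scalar_mx_block.
have [_ pu] := mulmx1_unit E.
by rewrite -[RHS]mulmx1 -(mulmxV pu) mulmxA E mul1mx.
Qed.

(** The metric is block diagonal, does not depend on the last coordinate and has
constant entries outside the block of M. *)
Lemma christoffel_prod y i j k : gM (lsubmx y) \in unitmx ->
  christoffel prod_metric y i j k =
  match fintype.split i, fintype.split j, fintype.split k with
  | inl a, inl b, inl q => christoffel gM (lsubmx y) a b q
  | _, _, _ => 0
  end.
Proof.
move=> gu; rewrite /christoffel invmx_prod // big_split_ord /=.
rewrite [X in _ * (_ + X)]big1 ?addr0 => [|r _]; last first.
  by rewrite !pd_metric_r pd_metric_dir subr0 addr0 mulr0.
rewrite -[in LHS](splitK i) -[in LHS](splitK j) -[in LHS](splitK k).
case: (fintype.split i) (fintype.split j) (fintype.split k) => a [] b [] q /=; last first.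
1,3,5,7: by rewrite big1 ?mulr0 // => l _; rewrite block_mxEdl mxE mul0r.
all: try by rewrite big1 ?mulr0 // => l _;
  rewrite ?(pd_metric_dir, pd_metric_r, pd_metric_rr) ?(addr0, add0r, subr0) ?mulr0.
by congr (_ * _); apply: eq_bigr => l _; rewrite block_mxEul !pd_metric_ll.
Qed.

Lemma Gamma_prod y (u v : 'rV[R]_(n + 1)) : gM (lsubmx y) \in unitmx ->
  Gamma prod_metric y u v =
  row_mx (Gamma gM (lsubmx y) (lsubmx u) (lsubmx v)) 0.
Proof.
move=> gu; apply/rowP => k; rewrite mxE.
under eq_bigr do under eq_bigr do rewrite christoffel_prod //.
have sl (a : 'I_n) : fintype.split (lshift 1 a) = inl a by exact: (unsplitK (inl a)).
have sr (a : 'I_1) : fintype.split (rshift n a) = inr a by exact: (unsplitK (inr a)).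
rewrite -(splitK k); case: (fintype.split k) => q /=; last first.
  rewrite row_mxEr mxE big1 // => i _; rewrite big1 // => j _.
  by rewrite sr; case: (fintype.split i) (fintype.split j) => ? [] ?; rewrite !mul0r.
rewrite row_mxEl mxE big_split_ord /= [X in _ + X]big1 ?addr0 => [|i _]; last first.
  by rewrite big1 // => j _; rewrite sr !mul0r.
apply: eq_bigr => i _; rewrite big_split_ord /= [X in _ + X]big1 ?addr0 => [|j _].
  by apply: eq_bigr => j _; rewrite !sl !mxE.
by rewrite sl sr !mul0r.
Qed.

End ProductMetric.

(** * Evaluation of the operators at points *)

Lemma rmorph_ambient_term (K L : comNzRingType) (phi : {rmorphism K -> L}) q
    (a s y z b r t : K) :
  phi ((q%:R - a) * s - 2 * q%:R * y + 3 * q%:R * z + q%:R * b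
       - q%:R ^+ 2 * r ^+ 2 - q%:R ^+ 2 * t) =
  (q%:R - phi a) * phi s - 2 * q%:R * phi y + 3 * q%:R * phi z + q%:R * phi b
       - q%:R ^+ 2 * phi r ^+ 2 - q%:R ^+ 2 * phi t.
Proof.
by rewrite !(rmorph_nat, rmorphXn, rmorphM, rmorphB, rmorphD).
Qed.

(** The only analytic input is [pd_ev], which says that the derivations of K
become partial derivatives under evaluation; [lifts V0 VK] says that the matrix VK
over K represents the matrix valued function V0 on U.  Each operator of the
statement is represented by its counterpart over K. *)
Section Lift.
Context {R : realType} {m k : nat} (U : set 'rV[R]_m) {K : comNzRingType}.
Variables (d : 'I_m -> derivation K) (ev : forall x, U x -> {rmorphism K -> R}).
Hypothesis pd_ev : forall (u : 'rV[R]_m -> R) a,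
  (forall y Uy, u y = @ev y Uy a) -> forall x Ux i, pd i u x = @ev x Ux (d i a).
Variables (e : 'M[K]_m) (J : 'M[K]_(m, k)) (G : 'M[K]_k) (Gt : 'I_m -> 'M[K]_k).
Variables (half minv : K).
Variables (g0 : 'rV[R]_m -> 'M[R]_m) (G0 : 'rV[R]_k -> 'M[R]_k).
Variable f : 'rV[R]_m -> 'rV[R]_k.

Definition lifts q r (V0 : 'rV[R]_m -> 'M[R]_(q, r)) (VK : 'M[K]_(q, r)) :=
  forall x Ux, V0 x = map_mx (@ev x Ux) VK.

Hypothesis J_lift : lifts (jac f) J.
Hypothesis G_lift : lifts (G0 \o f) G.
Hypothesis g_lift : lifts g0 (J *m G *m J^T).
Hypothesis gram_inv_lift : lifts (fun x => invmx (g0 x)) (gram_inv e).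
Hypothesis half_lift : forall x Ux, 2^-1 = @ev x Ux half.
Hypothesis Gt_lift : forall x Ux u v, Gamma G0 (f x) (u *m jac f x) v =
  \sum_i u 0 i *: (v *m map_mx (@ev x Ux) (Gt i)).
Hypothesis minv_lift : forall x Ux, m%:R^-1 = @ev x Ux minv.

Lemma em_sum I (r : seq I) (P : pred I) q s (F : I -> 'M[K]_(q, s)) x (Ux : U x) :
  map_mx (ev Ux) (\sum_(i <- r | P i) F i) = \sum_(i <- r | P i) map_mx (ev Ux) (F i).
Proof. exact: map_mx_sum. Qed.

Lemma emZ q s (a : K) (A : 'M[K]_(q, s)) x (Ux : U x) :
  map_mx (ev Ux) (a *: A) = ev Ux a *: map_mx (ev Ux) A.
Proof. by apply/matrixP => i j; rewrite !mxE rmorphM. Qed.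

Lemma emD q s (A B : 'M[K]_(q, s)) x (Ux : U x) :
  map_mx (ev Ux) (A + B) = map_mx (ev Ux) A + map_mx (ev Ux) B.
Proof. exact: map_mxD. Qed.
Lemma emB q s (A B : 'M[K]_(q, s)) x (Ux : U x) :
  map_mx (ev Ux) (A - B) = map_mx (ev Ux) A - map_mx (ev Ux) B.
Proof. exact: map_mxB. Qed.
Lemma emN q s (A : 'M[K]_(q, s)) x (Ux : U x) :
  map_mx (ev Ux) (- A) = - map_mx (ev Ux) A.
Proof. exact: map_mxN. Qed.
Lemma emM q r s (A : 'M[K]_(q, r)) (B : 'M[K]_(r, s)) x (Ux : U x) :
  map_mx (ev Ux) (A *m B) = map_mx (ev Ux) A *m map_mx (ev Ux) B.
Proof. exact: map_mxM. Qed.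

Lemma jac_lift q (Y : 'rV[R]_m -> 'rV[R]_q) YK x (Ux : U x) u : lifts Y YK ->
  u *m jac Y x = \sum_i u 0 i *: map_mx (ev Ux) (map_mx (d i) YK).
Proof.
move=> YE; apply/rowP => j; rewrite mxE summxE; apply: eq_bigr => i _.
rewrite [RHS]mxE [jac Y x i j]mxE; congr (_ * _); rewrite !mxE.
by apply: pd_ev => y Uy; rewrite (YE y Uy) mxE.
Qed.

(** The Christoffel symbols are given by the same expression in the metric on both
sides. *)
Lemma lc_lift x (Ux : U x) i j q :
  christoffel g0 x i j q = ev Ux (lc_gram d e J G half i j q).
Proof.
have gE y z x' (Ux' : U x') : g0 x' y z = ev Ux' ((J *m G *m J^T) y z).
  by rewrite (g_lift Ux') mxE.
have dg a y z : pd a (fun x => g0 x y z) x = ev Ux (d a ((J *m G *m J^T) y z)).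
  by apply: pd_ev => x' Ux'; exact: gE.
rewrite /lc_gram /lc mxE rmorph_sum /christoffel mulr_sumr; apply: eq_bigr => l _.
rewrite rmorphM /= (gram_inv_lift Ux) [map_mx _ _ _ _]mxE !dg (half_lift Ux).
rewrite [koszul _ _ _ _ _ _]mxE rmorphM rmorphB rmorphD [(gram_inv e)^T _ _]mxE /=.
by rewrite mulrA mulrAC.
Qed.

Lemma nabla_lift X Y XK YK : lifts X XK -> lifts Y YK ->
  lifts (nabla g0 X Y) (nablaK d e J G half XK YK).
Proof.
move=> XE YE x Ux; rewrite /nabla (jac_lift Ux _ YE).
have -> : Gamma g0 x (X x) (Y x) =
    \sum_i X x 0 i *: (Y x *m map_mx (ev Ux) (lc_gram d e J G half i)).
  apply/rowP => q; rewrite mxE summxE; apply: eq_bigr => i _.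
  rewrite [RHS]mxE [X in _ = _ * X]mxE mulr_sumr; apply: eq_bigr => j _.
  by rewrite (lc_lift Ux) [map_mx _ _ _ _]mxE -mulrA mulrC -mulrA.
rewrite /nablaK em_sum -big_split; apply: eq_bigr => i _.
have -> : X x 0 i = ev Ux (XK 0 i) by rewrite (XE x Ux) mxE.
by rewrite emZ emD emM -(YE x Ux); exact/esym/scalerDr.
Qed.

Lemma push_lift X XK : lifts X XK -> lifts (push f X) (XK *m J).
Proof. by move=> XE x Ux; rewrite /push emM -(XE x Ux) -(J_lift Ux). Qed.

Lemma nablabar_lift X V XK VK : lifts X XK -> lifts V VK ->
  lifts (nablabar G0 f X V) (nablabarK d Gt XK VK).
Proof.
move=> XE VE x Ux; rewrite /nablabar (jac_lift Ux _ VE) (Gt_lift Ux).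
rewrite /nablabarK em_sum -big_split; apply: eq_bigr => i _.
have -> : X x 0 i = ev Ux (XK 0 i) by rewrite (XE x Ux) mxE.
by rewrite emZ /nabla_dir emD emM -(VE x Ux); exact/esym/scalerDr.
Qed.

Lemma tan_lift (V : 'rV[R]_m -> 'rV[R]_k) VK : lifts V VK ->
  lifts (fun x => tanp g0 G0 f (V x) x) (tangentK e J G VK).
Proof.
move=> VE x Ux; rewrite /tanp /tangentK (VE x Ux) (J_lift Ux) (gram_inv_lift Ux).
by rewrite -[G0 (f x)]/((G0 \o f) x) (G_lift Ux) !emM map_trmx.
Qed.

Lemma nor_lift (V : 'rV[R]_m -> 'rV[R]_k) VK : lifts V VK ->
  lifts (fun x => norp g0 G0 f (V x) x) (normalK e J G VK).
Proof.
move=> VE x Ux; rewrite /norp /normalK (tan_lift VE Ux) (VE x Ux) (J_lift Ux).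
by rewrite emB emM.
Qed.

Lemma sff_lift X Y XK YK : lifts X XK -> lifts Y YK ->
  lifts (sff g0 G0 f X Y) (sffK d e J G Gt half XK YK).
Proof.
move=> XE YE x Ux; rewrite /sff /sffK emB.
rewrite (nablabar_lift XE (push_lift YE) Ux).
by rewrite (push_lift (nabla_lift XE YE) Ux).
Qed.

Lemma shape_op_lift V X VK XK : lifts V VK -> lifts X XK ->
  lifts (shape_op g0 G0 f V X) (shape_opK d e J G Gt VK XK).
Proof.
move=> VE XE x Ux; rewrite /shape_op /shape_opK emN.
by rewrite (tan_lift (nablabar_lift XE VE) Ux).
Qed.

Lemma basis_lift i : lifts (cst (basis_vec i)) (delta_mx 0 i : 'rV[K]_m).
Proof. by move=> x Ux; rewrite map_delta_mx. Qed.

Lemma shape_mx_lift V VK : lifts V VK ->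
  lifts (shape_mx g0 G0 f V) (shape_mxK d e J G Gt VK).
Proof.
move=> VE x Ux; apply/matrixP => i j; rewrite [LHS]mxE (shape_op_lift VE (basis_lift j) Ux).
by rewrite [LHS]mxE [RHS]mxE; congr (ev Ux _); rewrite [RHS]mxE.
Qed.

Lemma nablaN_lift X V XK VK : lifts X XK -> lifts V VK ->
  lifts (nablaN g0 G0 f X V) (normalK e J G (nablabarK d Gt XK VK)).
Proof. by move=> XE VE x Ux; rewrite /nablaN (nor_lift (nablabar_lift XE VE) Ux). Qed.

Lemma dsff_lift X Y Z XK YK ZK : lifts X XK -> lifts Y YK -> lifts Z ZK ->
  lifts (dsff g0 G0 f X Y Z) (dsffK d e J G Gt half XK YK ZK).
Proof.
move=> XE YE ZE x Ux; rewrite /dsff /dsffK 2!emB.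
rewrite (nablaN_lift XE (sff_lift YE ZE) Ux).
rewrite (sff_lift (nabla_lift XE YE) ZE Ux).
by rewrite (sff_lift YE (nabla_lift XE ZE) Ux).
Qed.

Lemma mean_lift : lifts (mean_curv g0 G0 f) (meanK d e J G Gt half minv).
Proof.
move=> x Ux; rewrite /mean_curv /meanK emZ (minv_lift Ux); congr (_ *: _).
rewrite em_sum; apply: eq_bigr => i _; rewrite em_sum; apply: eq_bigr => j _.
rewrite emZ (sff_lift (basis_lift i) (basis_lift j) Ux).
by rewrite (gram_inv_lift Ux) mxE.
Qed.

Lemma shape_sq_lift V VK x (Ux : U x) : lifts V VK ->
  shape_sq g0 G0 f V x = ev Ux (shape_sqK d e J G Gt VK).
Proof.
move=> VE; rewrite /shape_sq /shape_sqK (shape_mx_lift VE Ux).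
by rewrite -emM trace_map_mx.
Qed.

Lemma ip_lift q (B : 'M[K]_q) (y z : 'rV[K]_q) x (Ux : U x) :
  ip (map_mx (ev Ux) B) (map_mx (ev Ux) y) (map_mx (ev Ux) z) = ev Ux (ipK B y z).
Proof. by rewrite /ip /ipK map_trmx -!emM mxE. Qed.

Lemma laplacian_lift u a x (Ux : U x) : (forall y (Uy : U y), u y = ev Uy a) ->
  laplacian g0 u x = ev Ux (lapK d e J G half a).
Proof.
move=> uE; rewrite /laplacian /lapK rmorph_sum; apply: eq_bigr => i _.
rewrite rmorph_sum; apply: eq_bigr => j _.
rewrite rmorphM /= (gram_inv_lift Ux) mxE; congr (_ * _).
rewrite rmorphB rmorph_sum /=; congr (_ - _).
  by apply: pd_ev => y Uy; exact: pd_ev.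
apply: eq_bigr => q _; rewrite rmorphM (lc_lift Ux) /=; congr (_ * _).
exact: pd_ev.
Qed.

Variables (nu : 'M[K]_(k - m, k)) (xK : 'rV[K]_k) (c : R) (cK : K).
Variables (e0 : 'I_m -> 'rV[R]_m -> 'rV[R]_m).
Variables (nu0 : 'I_(k - m) -> 'rV[R]_m -> 'rV[R]_k) (xi0 : 'rV[R]_k).
Hypothesis e_lift : forall i, lifts (e0 i) (row i e).
Hypothesis nu_lift : forall a, lifts (nu0 a) (row a nu).
Hypothesis xi_lift : lifts (cst xi0) xK.
Hypothesis c_lift : forall x Ux, c = @ev x Ux cK.

Lemma formula_lift x (Ux : U x) :
  lapK d e J G half (\sum_a shape_sqK d e J G Gt (row a nu))
    = 2 * simons_rhs d e J G Gt nu xK cK half minv ->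
  let ipT := ip (g0 x) in
  let ipN := ip (G0 (f x)) in
  let T := tanp g0 G0 f xi0 in
  let N := norp g0 G0 f xi0 in
  let H := mean_curv g0 G0 f in
  let sigma := sff g0 G0 f in
  let sigma2 := sff_sq g0 G0 f nu0 in
  let A := fun a => shape_mx g0 G0 f (nu0 a) x in
  let AT := fun a => shape_op g0 G0 f (nu0 a) T x in
  2^-1 * laplacian g0 sigma2 x =
    dsff_sq g0 G0 f e0 x
    + c * ((m%:R - ipT (T x) (T x)) * sigma2 x
           - 2 * m%:R * (\sum_a ipT (AT a) (AT a))
           + 3 * m%:R * ipN (sigma T T x) (H x)
           + m%:R * shape_sq g0 G0 f N x
           - m%:R ^+ 2 * ipN (H x) (N x) ^+ 2
           - m%:R ^+ 2 * ipN (H x) (H x))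
    + \sum_a \sum_b
        (\tr (A b) * \tr (A a *m A a *m A b)
         + \tr ((A a *m A b - A b *m A a) *m (A a *m A b - A b *m A a))
         - \tr (A a *m A b) ^+ 2).
Proof.
move=> E ipT ipN T N H sigma sigma2 A AT.
have T_lift : lifts T (tangentK e J G xK) by exact: tan_lift xi_lift.
have N_lift : lifts N (normalK e J G xK) by exact: nor_lift xi_lift.
have S_lift y (Uy : U y) : sigma2 y = ev Uy (\sum_a shape_sqK d e J G Gt (row a nu)).
  by rewrite rmorph_sum; apply: eq_bigr => a _; exact: shape_sq_lift.
have A_lift a : A a = map_mx (ev Ux) (shape_mxK d e J G Gt (row a nu)).
  exact: shape_mx_lift.
have AT_lift a : AT a =
    map_mx (ev Ux) (shape_opK d e J G Gt (row a nu) (tangentK e J G xK)).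
  exact: shape_op_lift.
have G_E : G0 (f x) = map_mx (ev Ux) G by exact: G_lift.
rewrite (laplacian_lift Ux S_lift) E rmorphM rmorph_nat mulrA mulVf ?pnatr_eq0 // mul1r.
rewrite /simons_rhs !rmorphD /=; congr (_ + _ + _).
- rewrite rmorph_sum; apply: eq_bigr => i _; rewrite rmorph_sum; apply: eq_bigr => j _.
  rewrite rmorph_sum; apply: eq_bigr => l _ /=.
  by rewrite (dsff_lift (e_lift i) (e_lift j) (e_lift l) Ux) G_E ip_lift.
- rewrite rmorphM /= -(c_lift Ux); congr (_ * _).
  rewrite rmorph_ambient_term -(S_lift x Ux) rmorph_sum.
  congr (_ * _ - _ * _ + _ * _ + _ * _ - _ * _ ^+ 2 - _ * _).
  + by rewrite /ipT (g_lift Ux) (T_lift x Ux) ip_lift.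
  + by apply: eq_bigr => a _; rewrite AT_lift /ipT (g_lift Ux) ip_lift.
  + by rewrite /ipN G_E /H /sigma (mean_lift Ux) (sff_lift T_lift T_lift Ux) ip_lift.
  + exact/esym/shape_sq_lift.
  + by rewrite /ipN G_E /H (mean_lift Ux) (N_lift x Ux) ip_lift.
  + by rewrite /ipN G_E /H (mean_lift Ux) ip_lift.
- rewrite rmorph_sum; apply: eq_bigr => a _; rewrite rmorph_sum; apply: eq_bigr => b _.
  rewrite /= rmorphB rmorphD rmorphXn rmorphM /= -!trace_map_mx.
  by rewrite !(emM, emB) -!A_lift.
Qed.

End Lift.

(** * The formula from an adapted frame in a chart *)

(** Equality of the dimensions is propositional where this is applied. *)
Lemma mulmx1C_dim (K : comNzRingType) (a b : nat) (A : 'M[K]_(a, b)) (B : 'M[K]_(b, a)) :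
  a = b -> A *m B = 1%:M -> B *m A = 1%:M.
Proof. by move=> ab; case: b / ab A B => A B; exact: mulmx1C. Qed.

Lemma ip_row (R : realType) (a b q : nat) (A : 'M[R]_(a, q)) (B : 'M[R]_q) (C : 'M[R]_(b, q)) i j :
  ip B (row i A) (row j C) = (A *m B *m C^T) i j.
Proof.
rewrite /ip -[row i A *m B]row_mul [LHS]mxE [RHS]mxE; apply: eq_bigr => l _.
by rewrite [row _ _ _ _]mxE ![_^T _ _]mxE [row _ _ _ _]mxE.
Qed.

Section ChartFormula.
Context {R : realType} {m n : nat} (U : set 'rV[R]_m) {K KV : comNzRingType}.
Variables (d : 'I_m -> derivation K) (dV : 'I_n -> derivation KV).
Variable ev : forall x, U x -> {rmorphism K -> R}.
Hypothesis pd_ev : forall (u : 'rV[R]_m -> R) a,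
  (forall y Uy, u y = @ev y Uy a) -> forall x Ux i, pd i u x = @ev x Ux (d i a).
Hypothesis ev_inj : forall a b, (forall x Ux, @ev x Ux a = @ev x Ux b) -> a = b.
Hypothesis dC : forall i j a, d i (d j a) = d j (d i a).
Variables (pl : {rmorphism KV -> K}) (F : 'I_(n + 1) -> K).
Hypothesis chain : forall i a,
  d i (pl a) = \sum_k d i (F (lshift 1 k)) * pl (dV k a).
Variables (gK giK : 'M[KV]_n) (halfV cV : KV) (half minv : K).
Hypothesis gK_sym : gK^T = gK.
Hypothesis gmK : giK *m gK = 1%:M.
Hypothesis halfVE : halfV * 2 = 1.
Hypothesis gK_curv : forall i j, riemann dV gK giK halfV i j *m gK = cV *:
  \matrix_(k, l) (gK j k * gK i l - gK i k * gK j l).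
Hypothesis c_const : forall i, d i (pl cV) = 0.

Variables (g0 : 'rV[R]_m -> 'M[R]_m) (gM : 'rV[R]_n -> 'M[R]_n).
Variables (f : 'rV[R]_m -> 'rV[R]_(n + 1)) (c : R).
Let G0 := prod_metric gM.
Hypothesis F_lift : forall x Ux j, f x 0 j = @ev x Ux (F j).
Hypothesis gM_lift : forall x Ux,
  gM (lsubmx (f x)) = map_mx (@ev x Ux) (map_mx pl gK).
Hypothesis GammaM_lift : forall x Ux u v, Gamma gM (lsubmx (f x)) u v =
  \sum_k u 0 k *: (v *m map_mx (@ev x Ux) (map_mx pl (lc dV gK giK halfV k))).
Hypothesis c_lift : forall x Ux, c = @ev x Ux (pl cV).
Hypothesis half_lift : forall x Ux, 2^-1 = @ev x Ux half.
Hypothesis minv_lift : forall x Ux, m%:R^-1 = @ev x Ux minv.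
Hypothesis m_gt0 : (0 < m)%N.
Hypothesis isometric : forall x, U x ->
  g0 x = jac f x *m G0 (f x) *m (jac f x)^T.

Variables (eK : 'M[K]_m) (nuK : 'M[K]_(n + 1 - m, n + 1)).
Variables (e0 : 'I_m -> 'rV[R]_m -> 'rV[R]_m).
Variables (nu0 : 'I_(n + 1 - m) -> 'rV[R]_m -> 'rV[R]_(n + 1)).
Hypothesis e_lift : forall i, lifts ev (e0 i) (row i eK).
Hypothesis nu_lift : forall a, lifts ev (nu0 a) (row a nuK).
Hypothesis e_orthonormal : forall x, U x -> forall i j,
  ip (g0 x) (e0 i x) (e0 j x) = (i == j)%:R.
Hypothesis nu_normal : forall x, U x -> forall a v,
  ip (G0 (f x)) (nu0 a x) (v *m jac f x) = 0.
Hypothesis nu_orthonormal : forall x, U x -> forall a b,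
  ip (G0 (f x)) (nu0 a x) (nu0 b x) = (a == b)%:R.
Hypothesis mean_parallel : forall x, U x -> forall X,
  nablaN g0 G0 f X (mean_curv g0 G0 f) x = 0.

Let J : 'M[K]_(m, n + 1) := jacK d F.
Let G : 'M[K]_(n + 1) := ambient_metricK pl gK.
Let Gt := ambient_connK dV d pl F gK giK halfV.

Lemma mx_ev_inj q r (A B : 'M[K]_(q, r)) :
  (forall x Ux, map_mx (@ev x Ux) A = map_mx (@ev x Ux) B) -> A = B.
Proof.
move=> AB; apply/matrixP => i j; apply: ev_inj => x Ux.
by have /matrixP/(_ i j) := AB x Ux; rewrite !mxE.
Qed.

Lemma J_lift : lifts ev (jac f) J.
Proof.
move=> x Ux; apply/matrixP => i j; rewrite !mxE; apply: pd_ev => y Uy.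
exact: F_lift.
Qed.

Lemma G_lift : lifts ev (G0 \o f) G.
Proof.
move=> x Ux; rewrite /G /ambient_metricK map_block_mx !map_mx0 map_mx1 /=.
by rewrite /G0 /prod_metric (gM_lift Ux).
Qed.

Lemma g_lift : lifts ev g0 (J *m G *m J^T).
Proof.
move=> x Ux; rewrite !emM -map_trmx -(J_lift Ux) -(G_lift Ux).
exact: isometric.
Qed.

Lemma gM_unit x : U x -> gM (lsubmx (f x)) \in unitmx.
Proof.
move=> Ux; have := congr1 (fun A => map_mx (ev Ux) (map_mx pl A)) gmK.
rewrite !map_mxM !map_mx1 -(gM_lift Ux).
by move=> /mulmx1_unit[].
Qed.

(** Only the component of the differential in M meets the Christoffel symbols of
the product. *)
Lemma Gt_lift x Ux u v : Gamma G0 (f x) (u *m jac f x) v =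
  \sum_i u 0 i *: (v *m map_mx (@ev x Ux) (Gt i)).
Proof.
rewrite /G0 Gamma_prod ?gM_unit // (GammaM_lift Ux).
have E i : v *m map_mx (ev Ux) (Gt i) = row_mx (\sum_k ev Ux (J i (lshift 1 k)) *:
    (lsubmx v *m map_mx (ev Ux) (map_mx pl (lc dV gK giK halfV k)))) 0.
  rewrite /Gt /ambient_connK map_block_mx !map_mx0 -{1}[v]hsubmxK mul_row_block.
  rewrite !mulmx0 !addr0; congr row_mx; rewrite /GtM em_sum mulmx_sumr.
  by apply: eq_bigr => k _; rewrite emZ -scalemxAr.
under [RHS]eq_bigr do rewrite E scale_row_mx scaler0.
have -> (C : 'I_m -> 'rV[R]_n) : \sum_i row_mx (C i) (0 : 'rV_1) = row_mx (\sum_i C i) 0.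
  by elim/big_ind2: _ => [|A ? B ? -> ->|//]; rewrite ?row_mx0 // add_row_mx addr0.
congr row_mx; under [RHS]eq_bigr do rewrite scaler_sumr.
rewrite exchange_big; apply: eq_bigr => k _ /=.
rewrite !mxE scaler_suml; apply: eq_bigr => i _.
by rewrite (J_lift Ux) scalerA [map_mx _ _ _ _]mxE.
Qed.

Lemma eK_rows x (Ux : U x) i : row i (map_mx (ev Ux) eK) = e0 i x.
Proof. by rewrite (e_lift i Ux) map_row. Qed.

Lemma nuK_rows x (Ux : U x) a : row a (map_mx (ev Ux) nuK) = nu0 a x.
Proof. by rewrite (nu_lift a Ux) map_row. Qed.

Lemma e_orthK : eK *m (J *m G *m J^T) *m eK^T = 1%:M.
Proof.
apply: mx_ev_inj => x Ux; rewrite 2!emM -map_trmx -(g_lift Ux) map_mx1.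
by apply/matrixP => i j; rewrite -ip_row !eK_rows e_orthonormal // mxE.
Qed.

Lemma nu_orthK : nuK *m G *m nuK^T = 1%:M.
Proof.
apply: mx_ev_inj => x Ux; rewrite 2!emM -map_trmx -(G_lift Ux) map_mx1.
by apply/matrixP => a b; rewrite -ip_row !nuK_rows nu_orthonormal // mxE.
Qed.

Lemma nu_eK : nuK *m G *m (eK *m J)^T = 0.
Proof.
apply: mx_ev_inj => x Ux; rewrite 2!emM -map_trmx emM -(G_lift Ux) -(J_lift Ux) map_mx0.
apply/matrixP => a i; rewrite -ip_row nuK_rows row_mul eK_rows [RHS]mxE.
exact: nu_normal.
Qed.

Lemma G_symK : G^T = G.
Proof. exact: ambient_metricK_sym. Qed.

Lemma frame_orthK : frame eK J nuK *m G *m (frame eK J nuK)^T = 1%:M.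
Proof.
have E1 : eK *m J *m G *m (eK *m J)^T = 1%:M.
  by rewrite trmx_mul !mulmxA -[RHS]e_orthK !mulmxA.
have E2 : eK *m J *m G *m nuK^T = 0.
  by have := congr1 trmx nu_eK; rewrite !trmx_mul !trmxK G_symK trmx0 !mulmxA.
rewrite /frame mul_col_mx tr_col_mx mul_col_row E1 E2 nu_eK nu_orthK.
by rewrite -scalar_mx_block.
Qed.

(** Independence of the tangent frame gives m <= n + 1, hence the adapted frame
has m + (n + 1 - m) = n + 1 elements and its matrix is square. *)
Lemma frame_completeK : (frame eK J nuK)^T *m frame eK J nuK *m G = 1%:M.
Proof.
have m_le : (m <= n + 1)%N.
  apply: (@mulmx1_min _ _ _ (eK *m J) (G *m J^T *m eK^T)).
  by rewrite -[RHS]e_orthK !mulmxA.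
have E := frame_orthK; rewrite -mulmxA in E.
have := congr1 trmx (mulmx1C_dim (subnKC m_le) E).
by rewrite !trmx_mul trmxK G_symK trmx1 mulmxA.
Qed.

Lemma gram_inv_lift : lifts ev (fun x => invmx (g0 x)) (gram_inv eK).
Proof.
move=> x Ux; have E : map_mx (ev Ux) (gram_inv eK) *m g0 x = 1%:M.
  rewrite (g_lift Ux) -emM -(map_mx1 (ev Ux)); congr (map_mx _ _).
  by rewrite /gram_inv -mulmxA; apply: mulmx1C; rewrite e_orthK.
have [_ gu] := mulmx1_unit E.
by rewrite -[RHS]mulmx1 -(mulmxV gu) mulmxA E mul1mx.
Qed.

Lemma halfK : half * 2 = 1.
Proof.
apply: ev_inj => x Ux.
by rewrite rmorphM rmorph_nat rmorph1 -(half_lift Ux) mulVf // pnatr_eq0.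
Qed.

Lemma minvK : minv * m%:R = 1.
Proof.
apply: ev_inj => x Ux.
by rewrite rmorphM rmorph_nat rmorph1 -(minv_lift Ux) mulVf // pnatr_eq0 -lt0n.
Qed.

Lemma mean_parallelK i :
  normalK eK J G (nablabarK d Gt (row i eK) (meanK d eK J G Gt half minv)) = 0.
Proof.
apply: mx_ev_inj => x Ux; rewrite map_mx0 -(mean_parallel Ux (e0 i)).
apply/esym; apply: (nablaN_lift pd_ev J_lift G_lift gram_inv_lift Gt_lift (e_lift i) _ Ux).
exact: (mean_lift pd_ev J_lift g_lift gram_inv_lift half_lift Gt_lift minv_lift).
Qed.

Lemma formulaK :
  lapK d eK J G half (\sum_a shape_sqK d eK J G Gt (row a nuK)) =
  2 * simons_rhs d eK J G Gt nuK xiK (pl cV) half minv.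
Proof.
apply: simons_submanifold.
- exact: dC.
- exact: c_const.
- exact: G_symK.
- exact: ambient_metricK_compat.
- exact: torsion_free.
- exact: xi_parallel.
- exact: amb_curvE.
- exact: frame_orthK.
- exact: frame_completeK.
- exact: halfK.
- exact: minvK.
- exact: mean_parallelK.
Qed.

Lemma xi_lift : lifts ev (cst xi) (xiK : 'rV[K]_(n + 1)).
Proof. by move=> x Ux; rewrite /xiK map_row_mx map_mx0 map_mx1. Qed.

Definition chart_formula x (Ux : U x) := formula_lift pd_ev J_lift G_lift g_lift
  gram_inv_lift half_lift Gt_lift minv_lift e_lift nu_lift xi_lift c_lift Ux formulaK.

End ChartFormula.

(** * The formula for smooth immersions *)

Section SmoothChart.
Context {R : realType} {m n : nat} (U : domain R m) (V : domain R n).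
Local Notation K := (smooth_fun U).
Local Notation KV := (smooth_fun V).
Variables (gM : 'rV[R]_n -> 'M[R]_n) (c : R).
Hypothesis gM_smooth : forall a b, smooth V (fun x => gM x a b).
Hypothesis gM_symm : forall x, dom_set V x -> (gM x)^T = gM x.
Hypothesis gM_pos : forall x, dom_set V x -> forall v, v != 0 -> 0 < ip (gM x) v v.
Hypothesis gM_curv : forall x, dom_set V x -> forall u v : 'rV[R]_n,
  \rank (col_mx u v) = 2%N -> sectional (gM) x u v = c.
Variable f : 'rV[R]_m -> 'rV[R]_(n + 1).
Hypothesis f_smooth : smooth_vec U f.
Hypothesis fV : forall x, dom_set U x -> dom_set V (lsubmx (f x)).

Let fM x : 'rV[R]_n := lsubmx (f x).

Lemma fM_smooth : smooth_vec U fM.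
Proof.
move=> j; have -> : (fun x => fM x 0 j) = (fun x => f x 0 (lshift 1 j)).
  by apply/funext => x; rewrite /fM mxE.
exact: f_smooth.
Qed.

Let pl : {rmorphism KV -> K} := pull fM_smooth fV.
Let evU x (Ux : dom_set U x) : {rmorphism K -> R} := ev Ux.

Lemma pd_evU (u : 'rV[R]_m -> R) (a : K) :
  (forall y (Uy : dom_set U y), u y = evU Uy a) ->
  forall x (Ux : dom_set U x) i, pd i u x = evU Ux (partial i a).
Proof.
move=> ua x Ux i; rewrite [RHS](partialE i a Ux).
exact: pd_eq_on (@dom_open _ _ U) ua Ux.
Qed.

(** The first n coordinates of f are those of its projection to M. *)
Lemma chain_rule_pull i a :
  partial i (pl a) = \sum_k partial i (coordf f_smooth (lshift 1 k)) * pl (partial k a).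
Proof.
rewrite [LHS](partial_pull fM_smooth fV i a); apply: eq_bigr => k _; congr (_ * _).
apply: smooth_fun_ext => x Ux; rewrite !partial_mk //; congr (pd i _ x).
by apply/funext => y; rewrite /fM mxE.
Qed.

Lemma pull_cst b : pl (sf_cst V b) = sf_cst U b.
Proof.
by apply: smooth_fun_ext => x Ux; rewrite [LHS]pullE // !sf_cstE //; exact: fV.
Qed.

Lemma pull_evm q r x (Ux : dom_set U x) (A : 'M[KV]_(q, r)) :
  map_mx (evU Ux) (map_mx pl A) = evm (fV Ux) A.
Proof. by apply/matrixP => a b; rewrite !mxE; exact: pullE. Qed.

Variables (g0 : 'rV[R]_m -> 'M[R]_m).
Hypothesis m_gt0 : (0 < m)%N.
Let G0 := prod_metric gM.
Hypothesis isometric : forall x, dom_set U x ->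
  g0 x = jac f x *m G0 (f x) *m (jac f x)^T.
Variables (e0 : 'I_m -> 'rV[R]_m -> 'rV[R]_m).
Variables (nu0 : 'I_(n + 1 - m) -> 'rV[R]_m -> 'rV[R]_(n + 1)).
Hypothesis e_frame : tangent_frame g0 U e0.
Hypothesis nu_frame : normal_frame G0 f U nu0.
Hypothesis mean_parallel : forall x, dom_set U x -> forall X,
  nablaN g0 G0 f X (mean_curv g0 G0 f) x = 0.

Let eK : 'M[K]_m := \matrix_(i, j) mk_smooth (e_frame.1 i j).

Lemma nu_smooth a j : smooth U (fun x => nu0 a x 0 j).
Proof. by case: nu_frame => nu_s _ _; exact: nu_s. Qed.

Let nuK : 'M[K]_(n + 1 - m, n + 1) := \matrix_(a, j) mk_smooth (nu_smooth a j).

Theorem chart_formula_smooth x (Ux : dom_set U x) :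
  let ipT := ip (g0 x) in
  let ipN := ip (G0 (f x)) in
  let T := tanp g0 G0 f xi in
  let N := norp g0 G0 f xi in
  let H := mean_curv g0 G0 f in
  let sigma := sff g0 G0 f in
  let sigma2 := sff_sq g0 G0 f nu0 in
  let A := fun a => shape_mx g0 G0 f (nu0 a) x in
  let AT := fun a => shape_op g0 G0 f (nu0 a) T x in
  2^-1 * laplacian g0 sigma2 x =
    dsff_sq g0 G0 f e0 x
    + c * ((m%:R - ipT (T x) (T x)) * sigma2 x
           - 2 * m%:R * (\sum_a ipT (AT a) (AT a))
           + 3 * m%:R * ipN (sigma T T x) (H x)
           + m%:R * shape_sq g0 G0 f N x
           - m%:R ^+ 2 * ipN (H x) (N x) ^+ 2
           - m%:R ^+ 2 * ipN (H x) (H x))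
    + \sum_a \sum_b
        (\tr (A b) * \tr (A a *m A a *m A b)
         + \tr ((A a *m A b - A b *m A a) *m (A a *m A b - A b *m A a))
         - \tr (A a *m A b) ^+ 2).
Proof.
have [e_smooth e_orth] := e_frame; have [nu_s nu_norm nu_orth] := nu_frame.
apply: (@chart_formula R m n (dom_set U) K KV partial partial evU pd_evU _ (@partialC _ _ U)
   pl (coordf f_smooth) chain_rule_pull (metric_mx gM_smooth)
   (inv_metric_mx gM_smooth gM_pos) (half_sf V) (sf_cst V c) (half_sf U)
   (sf_cst U m%:R^-1) (metric_mx_sym gM_smooth gM_symm)
   (inv_metric_mxK gM_smooth gM_pos) (half_sfE V)
   (riem_mx_constant gM_smooth gM_symm gM_pos gM_curv) _ g0 gM f c _ _ _ _ _ _
   m_gt0 isometric eK nuK e0 nu0 _ _ e_orth nu_norm nu_orth mean_parallel x Ux).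
- by move=> a b ab; apply: smooth_fun_ext => y Uy; exact: ab y Uy.
- by move=> i; rewrite pull_cst partial_cst.
- by move=> y Uy j; rewrite [RHS]mk_smoothE.
- by move=> y Uy; rewrite pull_evm metric_mxE.
- move=> y Uy u v; rewrite (GammaE gM_smooth gM_pos (fV Uy)); apply: eq_bigr => k _.
  by rewrite pull_evm.
- by move=> y Uy; rewrite pull_cst [RHS]sf_cstE.
- by move=> y Uy; rewrite [RHS]sf_cstE.
- by move=> y Uy; rewrite [RHS]sf_cstE.
- by move=> i y Uy; apply/rowP => j; rewrite !mxE [RHS]mk_smoothE.
- by move=> a y Uy; apply/rowP => j; rewrite !mxE [RHS]mk_smoothE.
Qed.

End SmoothChart.

Theorem proposition3p1 (R : realType) (m n : nat) (c : R)
    (M : riem R n) (S : riem R m) (F : S -> prod_line M)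
    (m_gt0 : (0 < m)%N)
    (HM : space_form M c)
    (HS : riemannian_manifold S)
    (HF : isometric_immersion F)
    (Hpmc : parallel_mean_curvature F)
    (i : chart_index S) (j : chart_index (prod_line M)) (W : set 'rV[R]_m)
    (W_open : open W) (W_dom : W `<=` local_dom F i j)
    (e : 'I_m -> 'rV[R]_m -> 'rV[R]_m)
    (nu : 'I_(n + 1 - m) -> 'rV[R]_m -> 'rV[R]_(n + 1))
    (He : tangent_frame (metric i) W e)
    (Hnu : normal_frame (metric j) (local_rep F i j) W nu)
    (x : 'rV[R]_m) (Wx : W x) :
  let g := metric i in
  let G := metric j in
  let f := local_rep F i j in
  let ipT := ip (g x) in
  let ipN := ip (G (f x)) in
  let T := tanp g G f xi in
  let N := norp g G f xi in
  let H := mean_curv g G f in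
  let sigma := sff g G f in
  let sigma2 := sff_sq g G f nu in
  let A := fun a => shape_mx g G f (nu a) x in
  let AT := fun a => shape_op g G f (nu a) T x in
  2^-1 * laplacian g sigma2 x =
    dsff_sq g G f e x
    + c * ((m%:R - ipT (T x) (T x)) * sigma2 x
           - 2 * m%:R * (\sum_a ipT (AT a) (AT a))
           + 3 * m%:R * ipN (sigma T T x) (H x)
           + m%:R * shape_sq g G f N x
           - m%:R ^+ 2 * ipN (H x) (N x) ^+ 2
           - m%:R ^+ 2 * ipN (H x) (H x))
    + \sum_a \sum_b
        (\tr (A b) * \tr (A a *m A a *m A b)
         + \tr ((A a *m A b - A b *m A a) *m (A a *m A b - A b *m A a))
         - \tr (A a *m A b) ^+ 2).
Proof.
have [[_ [M_chart _] _ [g_smooth g_sp] _] _ _ M_curv] := HM.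
have [_ [S_chart _] _ _ _] := HS.
have [_ /(_ i j)[F_smooth F_isom]] := HF.
pose jM : chart_index M := j.
pose V0 := chart_map (atlas jM) @` chart_dom (atlas jM).
have V0_open : open V0 by case: (M_chart jM).
have fV0 y : W y -> V0 (lsubmx (local_rep F i j y)).
  move=> /W_dom[p [ip Fp] <-]; exists (F p).1; first by case: Fp.
  by rewrite /local_rep; case: (S_chart i) => _ _ -> // _ _; rewrite row_mxKl.
have W0 : W !=set0 by exists x.
have V00 : V0 !=set0 by exists (lsubmx (local_rep F i j x)); exact: fV0.
pose U := Domain W_open W0; pose V := Domain V0_open V00.
apply: (@chart_formula_smooth R m n U V (metric jM) c _ _ _ _ (local_rep F i j)).
- by move=> a b; exact: g_smooth.
- by move=> y [p jp <-]; case: (g_sp jM p jp).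
- by move=> y [p jp <-]; case: (g_sp jM p jp).
- by move=> y [p jp <-]; exact: M_curv.
- by move=> k s y Wy; exact: F_smooth (W_dom y Wy).
- exact: fV0.
- exact: m_gt0.
- by move=> y Wy; exact: F_isom (W_dom y Wy).
- exact: He.
- exact: Hnu.
- by move=> y Wy; exact: Hpmc (W_dom y Wy).
- exact: Wx.
Qed.
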